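(* Let $p,r,n$ be integers with $1\le r\le p-2$, $n\ge1$ and $n\ge\frac{4-r}{p-r-1}$, let $\Omega$ be a planar multi-patch domain with an analysis-suitable $G^1$ multi-patch spline parametrization, let $\mathcal V^1$ be the associated $C^1$ isogeometric space, and let $\mathbf x^{(i)}$, $i\in\mathcal I_{\mathcal X}$, be a vertex. There exist a function space $\mathcal A_{\mathbf x^{(i)}}\subset\mathcal V^1$ of dimension $6$ and a projector $\Pi_{\mathcal A_{\mathbf x^{(i)}}}:C^2(\mathbf x^{(i)})\to\mathcal A_{\mathbf x^{(i)}}\subset\mathcal V^1$ such that for all $\varphi\in C^2(\mathbf x^{(i)})$ $$\partial_{x_1}^{m_1}\partial_{x_2}^{m_2}\big(\Pi_{\mathcal A_{\mathbf x^{(i)}}}\varphi\big)(\mathbf x^{(i)})=\partial_{x_1}^{m_1}\partial_{x_2}^{m_2}\varphi(\mathbf x^{(i)})$$ for all $m_1,m_2\ge0$ with $m_1+m_2\le2$.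
   Context: **Splines.** For integers $p,r,n$, $h=1/n$, $\mathcal S^{p,r}_h$ is the space of $C^r$ piecewise polynomials of degree $p$ on $[0,1]$ with $n$ uniform elements (open knot vector, interior knots of multiplicity $p-r$), and $\mathcal S^{\mathbf p,\mathbf r}_h=\mathcal S^{p,r}_h\otimes\mathcal S^{p,r}_h$ on $[0,1]^2$. **Domain.** $\Omega\subset\mathbb R^2$ is open, connected, regular, $\overline\Omega=\bigcup_{i\in\mathcal I_\Omega}\overline{\Omega^{(i)}}$ (finite), where the $\Omega^{(i)}$ are disjoint open patches, $\overline{\Omega^{(i)}}$ is parametrized one-to-one by $\mathbf F^{(i)}:[0,1]^2\to\overline{\Omega^{(i)}}$, $\mathbf F^{(i)}\in\mathcal S^{\mathbf p,\mathbf r}_h\times\mathcal S^{\mathbf p,\mathbf r}_h$, $\det[\partial_1\mathbf F^{(i)},\partial_2\mathbf F^{(i)}]>0$ on $[0,1]^2$. Edges (open) and vertices are the images of the sides and corners of $[0,1]^2$. No hanging nodes: distinct closed patches are disjoint, or share exactly one vertex, or exactly one closed edge, along which the two parametrizations agree up to orientation. The patches around a vertex form a full cycle (interior vertex) or a chain bounded by two boundary edges (boundary vertex), consecutive ones sharing an edge. Interfaces are the edges inside $\Omega$ shared by two patches; $\mathcal I_{\mathcal X}$ indexes all vertices $\mathbf x^{(i)}$, interior and boundary. **Standard form.** After rotating the parameter squares by multiples of $\pi/2$, an interface $\Sigma^{(i)}$ between $\Omega^{(\imath_1)},\Omega^{(\imath_2)}$ is in standard form: $\mathbf F^{(\imath_1)}(0,\xi)=\mathbf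 F^{(\imath_2)}(\xi,0)$ for $\xi\in[0,1]$, this being the parametrization of $\overline{\Sigma^{(i)}}$. **Analysis-suitable $G^1$.** For each interface in standard form there are polynomials $\alpha^{(i,\imath_1)},\alpha^{(i,\imath_2)},\beta^{(i,\imath_1)},\beta^{(i,\imath_2)}$ of degree at most $1$, with $\alpha^{(i,\imath_1)},\alpha^{(i,\imath_2)}$ relatively prime, such that on $[0,1]$: $\alpha^{(i,\imath_1)}\alpha^{(i,\imath_2)}>0$ and, with $\beta^{(i)}=\alpha^{(i,\imath_1)}\beta^{(i,\imath_2)}+\alpha^{(i,\imath_2)}\beta^{(i,\imath_1)}$, $$\alpha^{(i,\imath_1)}(\xi)\,\partial_2\mathbf F^{(\imath_2)}(\xi,0)+\alpha^{(i,\imath_2)}(\xi)\,\partial_1\mathbf F^{(\imath_1)}(0,\xi)+\beta^{(i)}(\xi)\,\partial_2\mathbf F^{(\imath_1)}(0,\xi)=\mathbf 0.$$ **Function spaces.** $\mathcal V^0=\{\varphi_h\in C^0(\overline\Omega):\varphi_h\circ\mathbf F^{(i)}\in\mathcal S^{\mathbf p,\mathbf r}_h\text{ for all }i\in\mathcal I_\Omega\}$ and $\mathcal V^1=\mathcal V^0\cap C^1(\overline\Omega)$. $C^2(\mathbf x^{(i)})$ is the set of piecewise smooth functions whose derivatives up to order $2$ are continuous at the point $\mathbf x^{(i)}$. A projector is a linear idempotent map onto the indicated space; the displayed identity includes the assertion that $\Pi_{\mathcal A_{\mathbf x^{(i)}}}\varphi\in C^2(\mathbf x^{(i)})$. *)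

(* Defs.v *)
From mathcomp Require Export all_boot all_order all_algebra.
From mathcomp Require Export all_classical all_reals all_analysis.

Set Implicit Arguments.
Unset Strict Implicit.
Unset Printing Implicit Defensive.
Import Order.TTheory GRing.Theory Num.Theory.
Import numFieldNormedType.Exports.
Local Open Scope classical_set_scope.
Local Open Scope ring_scope.

(* A function on [0,1], on [0,1]^2 or on the closure of Omega is a function on
   R or R * R.  In the first two cases its values elsewhere are never used;
   the function spaces on the closure of Omega consist of functions that vanish
   elsewhere, so that Leibniz equality is equality on the closure of Omega. *)

Section OneVariable.
Variable R : realType.

Definition I01 : set R := [set` `[0, 1]].
Definition I01o : set R := [set` `]0, 1[].

(* Derivative relative to [0,1]: one-sided at the end points. *)
Definition is_deriv01 (V : normedModType R) (f : R -> V) (s : R) (l : V) :=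
  (fun t => (t - s)^-1 *: (f t - f s)) @ within I01 s^' --> l.

Definition deriv01 (V : normedModType R) (f : R -> V) (s : R) : V :=
  lim ((fun t => (t - s)^-1 *: (f t - f s)) @ within I01 s^').

Definition Ck01 (k : nat) (f : R -> R) :=
  exists g : nat -> R -> R,
    [/\ forall s, I01 s -> g 0%N s = f s,
        forall j, (j < k)%N -> forall s, I01 s ->
          is_deriv01 (g j) s (g j.+1 s)
      & forall j, (j <= k)%N -> {within I01, continuous (g j)}].

Definition spline (p r n : nat) (f : R -> R) :=
  Ck01 r f /\
  forall j : 'I_n, exists2 q : {poly R}, (size q <= p.+1)%N &
    forall s, j%:R / n%:R <= s <= j.+1%:R / n%:R -> f s = q.[s].

End OneVariable.

Section Square.
Variable R : realType.

Definition Sq : set (R * R) := @I01 R `*` @I01 R.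
Definition Sqo : set (R * R) := @I01o R `*` @I01o R.

Definition spline2 (p r n : nat) (f : R * R -> R) :=
  exists (m : nat) (u v : 'I_m -> R -> R),
    (forall k, spline p r n (u k) /\ spline p r n (v k)) /\
    (forall z, Sq z -> f z = \sum_(k < m) u k z.1 * v k z.2).

Definition d1 (V : normedModType R) (f : R * R -> V) (z : R * R) : V :=
  deriv01 (fun s => f (s, z.2)) z.1.
Definition d2 (V : normedModType R) (f : R * R -> V) (z : R * R) : V :=
  deriv01 (fun s => f (z.1, s)) z.2.

Definition det2 (a b : R * R) : R := a.1 * b.2 - b.1 * a.2.

(* Rotation of the square by pi/2 about its centre.  Corners and sides are
   numbered counterclockwise, the side k running from corner k to corner k+1
   (mod 4). *)
Definition rot (z : R * R) : R * R := (1 - z.2, z.1).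
Definition rotn (k : nat) (z : R * R) : R * R := iter k rot z.
Definition corner (k : 'I_4) : R * R := rotn k (0, 0).
Definition side (k : 'I_4) (xi : R) : R * R := rotn k (xi, 0).

End Square.

Section Domain.
Variables (R : realType) (p r n : nat) (I : finType).
Variables (Omega : set (R * R)) (F : I -> R * R -> R * R).

Definition patch (i : I) : set (R * R) := F i @` @Sqo R.
Definition cpatch (i : I) : set (R * R) := F i @` @Sq R.
Definition cedge (i : I) (k : 'I_4) : set (R * R) :=
  (fun xi => F i (side k xi)) @` @I01 R.

Definition vertex (x : R * R) := exists i k, x = F i (corner R k).

Definition bdry : set (R * R) := closure Omega `\` Omega.

Definition meet_in_vertex (i j : I) :=
  exists k l, F i (corner R k) = F j (corner R l) /\
    cpatch i `&` cpatch j = [set F i (corner R k)].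

Definition meet_in_edge (i j : I) :=
  exists k l,
    cpatch i `&` cpatch j = cedge i k /\
    ((forall xi, I01 xi -> F i (side k xi) = F j (side l xi)) \/
     (forall xi, I01 xi -> F i (side k xi) = F j (side l (1 - xi)))).

(* The patches around x are s 0, ..., s (nu-1), and e l, e l.+1 are the two
   closed edges of s l that contain x; thus s l and s l.+1 share e l.+1.  The
   edges e 0, ..., e (nu-1) are distinct; e nu closes the cycle (e nu = e 0) at
   an interior vertex, and is a further edge at a boundary vertex. *)
Definition vertex_star (x : R * R) :=
  exists (nu : nat) (s : nat -> I) (e : nat -> set (R * R)),
  [/\ (0 < nu)%N,
      {in gtn nu &, injective s},
      (forall i, cpatch i x <-> exists2 l, (l < nu)%N & s l = i),
      (forall l, (l < nu)%N ->
         [/\ e l <> e l.+1, e l x, e l.+1 x,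
             exists k, e l = cedge (s l) k
           & exists k, e l.+1 = cedge (s l) k])
    & [/\ Omega x, {in gtn nu &, injective e} & e nu = e 0%N] \/
      [/\ bdry x, {in gtn nu.+1 &, injective e},
          e 0%N `<=` bdry & e nu `<=` bdry]].

Record multipatch : Prop := Multipatch {
  mp_open : open Omega;
  mp_connected : connected Omega;
  mp_regular : regopen Omega;
  mp_cover : closure Omega = \bigcup_i cpatch i;
  mp_patch_open : forall i, open (patch i);
  mp_disjoint : forall i j, i <> j -> patch i `&` patch j = set0;
  mp_inj : forall i, {in @Sq R &, injective (F i)};
  mp_spline : forall i, spline2 p r n (fst \o F i) /\
                        spline2 p r n (snd \o F i);
  mp_jacobian : forall i z, Sq z -> 0 < det2 (d1 (F i) z) (d2 (F i) z);
  mp_conforming : forall i j, i <> j ->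
    [\/ cpatch i `&` cpatch j = set0, meet_in_vertex i j | meet_in_edge i j];
  mp_star : forall x, vertex x -> vertex_star x
}.

Definition standard_form (G1 G2 : R * R -> R * R) :=
  forall xi, I01 xi -> G1 (0, xi) = G2 (xi, 0).

Definition AS_G1_gluing (G1 G2 : R * R -> R * R) :=
  exists alpha1 alpha2 beta1 beta2 : {poly R},
  [/\ (size alpha1 <= 2)%N /\ (size alpha2 <= 2)%N,
      (size beta1 <= 2)%N /\ (size beta2 <= 2)%N,
      coprimep alpha1 alpha2
    & forall xi, I01 xi ->
        let beta := alpha1 * beta2 + alpha2 * beta1 in
        0 < alpha1.[xi] * alpha2.[xi] /\
        alpha1.[xi] *: d2 G2 (xi, 0) + alpha2.[xi] *: d1 G1 (0, xi)
          + beta.[xi] *: d2 G1 (0, xi) = 0].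

(* Since Omega is the interior of its closure, an edge shared by two patches
   lies inside Omega, apart possibly from its end points. *)
Definition AS_G1 := forall i j, i <> j -> meet_in_edge i j ->
  exists a b : 'I_4,
    let G1 := F i \o rotn a in
    let G2 := F j \o rotn b in
    [/\ cpatch i `&` cpatch j = (fun xi => G1 (0, xi)) @` @I01 R,
        standard_form G1 G2 & AS_G1_gluing G1 G2].

Definition fun_on_closure (phi : R * R -> R) :=
  forall z, ~ closure Omega z -> phi z = 0.

Definition C1_closure (phi : R * R -> R) :=
  exists g1 g2 : R * R -> R,
  [/\ {within closure Omega, continuous g1},
      {within closure Omega, continuous g2}
    & forall z, Omega z -> is_derive z (1, 0) phi (g1 z) /\
                           is_derive z (0, 1) phi (g2 z)].

Definition V0 : set (R * R -> R) := [set phi |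
  [/\ fun_on_closure phi, {within closure Omega, continuous phi}
    & forall i, spline2 p r n (phi \o F i)]].

Definition V1 : set (R * R -> R) := V0 `&` [set phi | C1_closure phi].

(* The mesh elements, on which spline functions on Omega are smooth: images of
   the n^2 open (resp. closed) cells of the unit square in each patch. *)
Definition elt (i : I) (j k : 'I_n) : set (R * R) := F i @`
  ([set` `]j%:R / n%:R, j.+1%:R / n%:R[] `*`
   [set` `]k%:R / n%:R, k.+1%:R / n%:R[]).
Definition celt (i : I) (j k : 'I_n) : set (R * R) := F i @`
  ([set` `[j%:R / n%:R, j.+1%:R / n%:R]] `*`
   [set` `[k%:R / n%:R, k.+1%:R / n%:R]]).

Definition elts : set (R * R) := [set z | exists i j k, elt i j k z].

Definition partial (b : bool) (phi : R * R -> R) : R * R -> R :=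
  fun z => 'D_(if b then (0, 1) else (1, 0)) phi z.

Definition partials (w : seq bool) (phi : R * R -> R) : R * R -> R :=
  foldr partial phi w.

Definition pderiv (m1 m2 : nat) (phi : R * R -> R) : R * R -> R :=
  iter m1 (partial false) (iter m2 (partial true) phi).

(* Smooth on each open element, with all derivatives extending continuously to
   the closed element.  Jumps across element boundaries are allowed. *)
Definition piecewise_smooth (phi : R * R -> R) :=
  forall i j k (w : seq bool),
    (forall z, elt i j k z -> differentiable (partials w phi) z) /\
    (forall z, celt i j k z ->
       cvg (partials w phi @ within (elt i j k) (nbhs z))).

(* A piecewise smooth function need not have classical derivatives at x, in
   particular when x is on the boundary.  Its derivatives are continuous at x
   if the ones on the union of the open elements, which is dense, have a limit
   at x; this limit is the derivative at x. *)
Definition C2_at (x : R * R) : set (R * R -> R) := [set phi |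
  [/\ fun_on_closure phi, piecewise_smooth phi,
      phi @ within (closure Omega) (nbhs x) --> phi x
    & forall m1 m2, (m1 + m2 <= 2)%N ->
        cvg (pderiv m1 m2 phi @ within elts (nbhs x))]].

Definition pderiv_at (m1 m2 : nat) (phi : R * R -> R) (x : R * R) : R :=
  lim (pderiv m1 m2 phi @ within elts (nbhs x)).

End Domain.

Section Linear.
Variables (R : realType) (V : lmodType R).

Definition dimension (d : nat) (A : set V) :=
  exists b : 'I_d -> V,
    (forall c : 'I_d -> R, \sum_i c i *: b i = 0 -> forall i, c i = 0) /\
    A = [set v | exists c : 'I_d -> R, v = \sum_i c i *: b i].

Definition projector (C A : set V) (P : V -> V) :=
  [/\ forall (a : R) u v, C u -> C v -> P (a *: u + v) = a *: P u + P v,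
      P @` C = A, A `<=` C & forall u, C u -> P (P u) = P u].

End Linear.

(* Main.v *)
From HB Require Import structures.
Require Import Defs.
From mathcomp Require Import ring lra.
Import Order.TTheory GRing.Theory Num.Theory.
Import numFieldNormedType.Exports.
Local Open Scope classical_set_scope.
Local Open Scope ring_scope.

Set Implicit Arguments.
Unset Strict Implicit.
Unset Printing Implicit Defensive.

(** A quadratic polynomial [Q] prescribes the 2-jet at the vertex.  On each patch
    around the vertex a tensor-product spline is built from a trace and a
    transversal derivative on the two sides through the vertex.  A trace is a
    spline in S^{p,r+1} with the 2-jet of [Q] at the vertex that vanishes to second
    order at the other end; this is where the bound on [n] enters.  The transversal
    derivatives on the two sides of an interface are
    [alpha1 K' - beta1 f'] and [- alpha2 K' - beta2 f'], with [f] the trace and [K]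
    another such spline, so that the G^1 gluing relation makes the gradients of the
    two pieces agree along the interface, and the 1-jet of [K'] can be chosen so that
    they match the gradient of [Q] to first order at the vertex.  The inverse of a
    chart is never differentiated: Caratheodory's form of differentiability passes
    through an injective continuous chart on a compact square with invertible
    Jacobian, and relative differentiability on finitely many closed patches gives
    differentiability on their union.  On a mesh element all derivatives in physical
    coordinates are rational expressions in the parameters with powers of the
    Jacobian in the denominator, hence extend continuously. *)

(** * Differentiability in the sense of Caratheodory *)

(** The bound on [n] is a dimension count: S^{p,r+1} on n elements has dimension p + 1 +
    (n-1)(p-r-1), and the bound says exactly that this is at least 6, three conditions at each end
    of a side. The trace is asked for one extra order of smoothness because its derivative, times a
    linear gluing factor, must lie in S^{p,r}. Vanishing to second order at the far end makes each
    piece and its gradient vanish on the two far sides, so that extension by zero to the other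
    patches stays C^1. The obstacle is the mixed derivative at the corner: the two transversal
    derivatives on one patch come from different interfaces and must prescribe the same value. It is
    overcome by taking all data from pullbacks of the one polynomial [Q]. These satisfy the gluing
    relation themselves near the vertex, so once K'(0) and K''(0) are fitted to one side of an
    interface, the relation and its derivative at the vertex give the data on the other side. The
    interpolants are not canonical. Six of them, dual to the six derivatives at the vertex, span the
    space and define the projector. *)

Section Filters.

Lemma near_cvg_eq (T U : Type) (F : set_system T) (G : set_system U)
    (f g : T -> U) {FF : Filter F} :
  {near F, f =1 g} -> g @ F --> G -> f @ F --> G.
Proof.
move=> fg; apply: cvg_trans; apply: near_eq_cvg.
by apply: filterS fg => x ->.
Qed.

Lemma cvg_to_eq (T : Type) (U : topologicalType) (F : set_system T) (f : T -> U)
  (a b : U) : a = b -> f @ F --> a -> f @ F --> b.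
Proof. by move=> ->. Qed.

Lemma within_sub (T : topologicalType) (A B : set T) (z : T) (P : set T) :
  A `<=` B -> (\forall w \near within B (nbhs z), P w) ->
  \forall w \near within A (nbhs z), P w.
Proof.
move=> AB; rewrite !near_withinE; apply: filterS => w Bw Aw.
by apply: Bw; exact: AB.
Qed.

Lemma cvg_within_sub (T U : topologicalType) (A B : set T) (z : T) (f : T -> U)
    (l : U) :
  A `<=` B -> f @ within B (nbhs z) --> l -> f @ within A (nbhs z) --> l.
Proof. by move=> AB fl U0 /fl; exact: (@within_sub _ A B). Qed.

Lemma near_within_self (T : topologicalType) (A : set T) (z : T) :
  \forall w \near within A (nbhs z), A w.
Proof. by rewrite near_withinE; apply: nearW. Qed.

Lemma within_cvg_unique (R : realType) (T : Type) (F : set_system T)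
    (f : T -> R) (a b : R) {PF : ProperFilter F} :
  f @ F --> a -> f @ F --> b -> a = b.
Proof. apply: cvg_unique; exact: norm_hausdorff. Qed.

End Filters.

Section Caratheodory.
Variable R : realType.
Implicit Types (S : set (R * R)) (f g : R * R -> R) (z : R * R).

(* Differentiability relative to [S] with gradient [(a, b)], in Caratheodory's
   form, so that the rules of calculus become algebraic identities. *)
Definition cara S f z (a b : R) := exists p q : R * R -> R,
  [/\ p @ within S (nbhs z) --> a, q @ within S (nbhs z) --> b
    & \forall w \near within S (nbhs z),
        f w - f z = p w * (w.1 - z.1) + q w * (w.2 - z.2)].

Lemma cara_eq S f g z a b : S z -> (forall w, S w -> f w = g w) ->
  cara S f z a b -> cara S g z a b.
Proof.
move=> Sz fg [p [q [pa qb fpq]]]; exists p, q; split => //.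
near=> w; rewrite -!fg//; first by near: w.
near: w; exact: near_within_self.
Unshelve. all: by end_near. Qed.

Lemma fst_cvg S z : fst @ within S (nbhs z) --> z.1.
Proof. by apply: cvg_within_filter; exact: cvg_fst. Qed.

Lemma snd_cvg S z : snd @ within S (nbhs z) --> z.2.
Proof. by apply: cvg_within_filter; exact: cvg_snd. Qed.

Lemma cara_cvg S f z a b : cara S f z a b -> f @ within S (nbhs z) --> f z.
Proof.
move=> [p [q [pa qb fpq]]].
apply: (@near_cvg_eq _ _ _ _ _
    (fun w => f z + (p w * (w.1 - z.1) + q w * (w.2 - z.2)))).
  by apply: filterS fpq => w <-; rewrite addrC subrK.
apply: (@cvg_to_eq _ _ _ _ (f z + (a * (z.1 - z.1) + b * (z.2 - z.2)))).
  by ring.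
apply: cvgD; first exact: cvg_cst.
apply: cvgD; apply: cvgM => //.
  by apply: cvgB; [exact: fst_cvg|exact: cvg_cst].
by apply: cvgB; [exact: snd_cvg|exact: cvg_cst].
Qed.

Lemma cara_cst S (c : R) z : cara S (fun=> c) z 0 0.
Proof.
exists (fun=> 0), (fun=> 0); split; [exact: cvg_cst|exact: cvg_cst|].
by apply: nearW => w; rewrite subrr !mul0r addr0.
Qed.

Lemma caraD S f g z a b c d : cara S f z a b -> cara S g z c d ->
  cara S (fun w => f w + g w) z (a + c) (b + d).
Proof.
move=> [p [q [pa qb fpq]]] [p' [q' [pc qd gpq]]].
exists (fun w => p w + p' w), (fun w => q w + q' w).
split; [exact: cvgD|exact: cvgD|].
near=> w; have -> : f w + g w - (f z + g z) = f w - f z + (g w - g z) by ring.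
have -> : f w - f z = p w * (w.1 - z.1) + q w * (w.2 - z.2) by near: w.
have -> : g w - g z = p' w * (w.1 - z.1) + q' w * (w.2 - z.2) by near: w.
by ring.
Unshelve. all: by end_near. Qed.

Lemma caraM S f g z a b c d : cara S f z a b -> cara S g z c d ->
  cara S (fun w => f w * g w) z (a * g z + f z * c) (b * g z + f z * d).
Proof.
move=> cf [p' [q' [pc qd gpq]]]; have fz := cara_cvg cf.
case: cf => [p [q [pa qb fpq]]].
exists (fun w => p w * g z + f w * p' w), (fun w => q w * g z + f w * q' w).
split.
- by apply: cvgD; apply: cvgM => //; exact: cvg_cst.
- by apply: cvgD; apply: cvgM => //; exact: cvg_cst.
near=> w.
have -> : f w * g w - f z * g z = (f w - f z) * g z + f w * (g w - g z) by ring.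
have -> : f w - f z = p w * (w.1 - z.1) + q w * (w.2 - z.2) by near: w.
have -> : g w - g z = p' w * (w.1 - z.1) + q' w * (w.2 - z.2) by near: w.
by ring.
Unshelve. all: by end_near. Qed.

Lemma caraV S f z a b : f z != 0 -> cara S f z a b ->
  cara S (fun w => (f w)^-1) z (- a * ((f z)^-1 * (f z)^-1))
    (- b * ((f z)^-1 * (f z)^-1)).
Proof.
move=> fz0 cf; have fz := cara_cvg cf; case: cf => [p [q [pa qb fpq]]].
exists (fun w => - p w * ((f w)^-1 * (f z)^-1)),
  (fun w => - q w * ((f w)^-1 * (f z)^-1)).
have fV : (fun w => (f w)^-1 * (f z)^-1) @ within S (nbhs z) -->
    (f z)^-1 * (f z)^-1.
  by apply: cvgM; [exact: cvgV|exact: cvg_cst].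
split; [by apply: cvgM => //; exact: cvgN|by apply: cvgM => //; exact: cvgN|].
near=> w.
have fw0 : f w != 0.
  near: w; move/cvgrPdist_lt: fz => /(_ `|f z|); rewrite normr_gt0 => /(_ fz0).
  apply: filterS => w; apply: contraTneq => ->.
  by rewrite subr0 ltxx.
have -> : (f w)^-1 - (f z)^-1 = - (f w - f z) * ((f w)^-1 * (f z)^-1).
  by field; rewrite fz0 fw0.
have -> : f w - f z = p w * (w.1 - z.1) + q w * (w.2 - z.2) by near: w.
by ring.
Unshelve. all: by end_near. Qed.

(** By the factor theorem the slope is itself a polynomial, so its continuity at [c] is free. *)
Lemma poly_slope (p : {poly R}) (c : R) : exists2 q : {poly R},
  (forall t, p.[t] - p.[c] = q.[t] * (t - c)) & q.[c] = p^`().[c].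
Proof.
have /factor_theorem [q pq] : root (p - p.[c]%:P) c.
  by rewrite /root !hornerE subrr.
have {}pq : p = q * ('X - c%:P) + p.[c]%:P by rewrite -pq subrK.
exists q; first by move=> t; rewrite {1}pq !hornerE; ring.
by rewrite [in RHS]pq derivD derivC addr0 derivM derivXsubC !hornerE subrr mulr0 add0r.
Qed.

Lemma fst_poly_cvg S (p : {poly R}) z :
  (fun w => p.[w.1]) @ within S (nbhs z) --> p.[z.1].
Proof.
apply: (@cvg_comp _ _ _ fst (horner p)); first exact: fst_cvg.
exact: continuous_horner.
Qed.

Lemma snd_poly_cvg S (p : {poly R}) z :
  (fun w => p.[w.2]) @ within S (nbhs z) --> p.[z.2].
Proof.
apply: (@cvg_comp _ _ _ snd (horner p)); first exact: snd_cvg.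
exact: continuous_horner.
Qed.

Lemma cara_poly1 S (p : {poly R}) z :
  cara S (fun w => p.[w.1]) z p^`().[z.1] 0.
Proof.
have [q qE <-] := poly_slope p z.1.
exists (fun w => q.[w.1]), (fun=> 0).
split; [exact: fst_poly_cvg|exact: cvg_cst|].
by apply: nearW => w; rewrite qE mul0r addr0.
Qed.

Lemma cara_poly2 S (p : {poly R}) z :
  cara S (fun w => p.[w.2]) z 0 p^`().[z.2].
Proof.
have [q qE <-] := poly_slope p z.2.
exists (fun=> 0), (fun w => q.[w.2]).
split; [exact: cvg_cst|exact: snd_poly_cvg|].
by apply: nearW => w; rewrite qE mul0r add0r.
Qed.

(** Along a coordinate direction one of the two terms drops out, and the difference quotient is the
    remaining slope function, which converges in full since [S] is a neighbourhood. *)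
Lemma cara_is_derive S f z a b : nbhs z S -> cara S f z a b ->
  is_derive z (1, 0) f a /\ is_derive z (0, 1) f b.
Proof.
move=> zS [p [q [pa qb fpq]]].
have nb : within S (nbhs z) `=>` nbhs z by exact: cvg_within.
have nb' : nbhs z `=>` within S (nbhs z).
  move=> A; rewrite /within/= => AS; near=> w.
  by have : S w by [near: w]; near: w.
have sc (v : R * R) : (fun h : R => h *: v + z) @ 0^' --> z.
  apply: (@cvg_to_eq _ _ _ _ (0 *: v + z)); first by rewrite scale0r add0r.
  apply: cvgD; last exact: cvg_cst.
  apply: cvgZr_tmp; apply: cvg_within_filter; exact: cvg_id.
have key (v : R * R) (c : R) (g : R * R -> R) : g @ nbhs z --> c ->
    (\forall h \near 0^', f (h *: v + z) - f z = h * g (h *: v + z)) ->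
    is_derive z v f c.
  move=> gc fg.
  have H : (fun h => h^-1 *: (f (h *: v + z) - f z)) @ 0^' --> c.
    apply: (@near_cvg_eq _ _ _ _ _ (g \o (fun h => h *: v + z))); last first.
      exact: cvg_comp (sc v) gc.
    near=> h; rewrite /=.
    have -> : f (h *: v + z) - f z = h * g (h *: v + z) by near: h.
    rewrite /GRing.scale/= mulKf//.
    near: h; exact: nbhs_dnbhs_neq.
  by apply: DeriveDef; [apply/cvg_ex; exists c|exact/cvg_lim].
split.
- apply: (key _ _ p); first by move=> A /pa /nb'.
  near=> h.
  have -> : f (h *: (1, 0) + z) - f z = p (h *: (1, 0) + z) *
      ((h *: (1, 0) + z).1 - z.1) + q (h *: (1, 0) + z) *
      ((h *: (1, 0) + z).2 - z.2).
    by near: h; exact: (sc (1, 0) _ (nb' _ fpq)).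
  by rewrite /= /GRing.scale/=; ring.
- apply: (key _ _ q); first by move=> A /qb /nb'.
  near=> h.
  have -> : f (h *: (0, 1) + z) - f z = p (h *: (0, 1) + z) *
      ((h *: (0, 1) + z).1 - z.1) + q (h *: (0, 1) + z) *
      ((h *: (0, 1) + z).2 - z.2).
    by near: h; exact: (sc (0, 1) _ (nb' _ fpq)).
  by rewrite /= /GRing.scale/=; ring.
Unshelve. all: by end_near. Qed.

End Caratheodory.

(** * Symbolic derivatives and inversion of charts *)

Section Differentiable.
Variable R : realType.

Definition lin2 (a b : R) (w : R * R) : R := a * w.1 + b * w.2.

Lemma lin2_linear a b : linear (lin2 a b).
Proof.
move=> c u v; rewrite /lin2 /=.
change (a * (c * u.1 + v.1) + b * (c * u.2 + v.2) =
  c * (a * u.1 + b * u.2) + (a * v.1 + b * v.2)); ring.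
Qed.

HB.instance Definition _ a b :=
  @GRing.isLinear.Build R (R * R)%type R _ (lin2 a b) (lin2_linear a b).

Lemma lin2_continuous a b : continuous (lin2 a b).
Proof.
move=> z; apply: cvgD; apply: cvgM; try exact: cvg_cst.
  exact: cvg_fst.
exact: cvg_snd.
Qed.

(** The remainder is [(p - a) * y.1 + (q - b) * y.2]; in the maximum norm each term is at most half
    of [e] times the norm of [y]. *)
Lemma cara_differentiable S (f : R * R -> R) z a b : nbhs z S ->
  cara S f z a b -> differentiable f z.
Proof.
move=> zS [p [q [pa qb fpq]]].
have nb' : nbhs z `=>` within S (nbhs z).
  move=> A; rewrite /within/= => AS; near=> w.
  by have : S w by [near: w]; near: w.
have E e : 0 < e -> \forall y \near (0 : R * R),
    `|(f \o shift z - (cst (f z) + lin2 a b)) y| <= e * `|y|.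
  move=> e0; have e20 : 0 < e / 2 by rewrite divr_gt0.
  have sz : shift z @ (0 : R * R) --> z.
    apply: (@cvg_to_eq _ _ _ _ (0 + z)); first by rewrite add0r.
    by apply: cvgD; [exact: cvg_id|exact: cvg_cst].
  move/cvgrPdist_le : pa => /(_ _ e20) /nb' /sz pa.
  move/cvgrPdist_le : qb => /(_ _ e20) /nb' /sz qb.
  have {}fpq := sz _ (nb' _ fpq).
  near=> y.
  have py : `|a - p (shift z y)| <= e / 2 by near: y; exact: pa.
  have qy : `|b - q (shift z y)| <= e / 2 by near: y; exact: qb.
  have fy : f (shift z y) - f z = p (shift z y) * ((shift z y).1 - z.1) +
    q (shift z y) * ((shift z y).2 - z.2) by near: y; exact: fpq.
  rewrite [X in `|X|](_ : _ = (p (shift z y) - a) * y.1 + (q (shift z y) - b) * y.2).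
    apply: (le_trans (ler_normD _ _)); rewrite !normrM.
    have y1 : `|y.1| <= `|y| by rewrite prod_normE le_max lexx.
    have y2 : `|y.2| <= `|y| by rewrite prod_normE le_max lexx orbT.
    rewrite (splitr e) mulrDl; apply: lerD; apply: ler_pM => //; by rewrite distrC.
  rewrite [LHS](_ : _ = f (shift z y) - f z - lin2 a b y); last first.
    by rewrite !fctE; ring.
  by rewrite fy /lin2 /shift/=; ring.
have dE : 'd f z = lin2 a b :> (_ -> _).
  apply: (@diff_unique R (R * R)%type R f (lin2 a b) z).
    exact: lin2_continuous.
  by apply/eqaddoP => e /E.
apply/diff_locallyP; rewrite dE; split; first exact: lin2_continuous.
by apply/eqaddoP => e /E.
Unshelve. all: by end_near. Qed.

End Differentiable.

(** * Rational expressions closed under differentiation *)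

Section Expressions.
Variable R : realType.

(** A class that contains the polynomial pieces of splines and is stable under the chain rule
    through an inverse chart, where the Jacobian appears as a denominator. *)
Inductive expr :=
| EX of {poly R}
| EY of {poly R}
| EAdd of expr & expr
| EMul of expr & expr
| EInv of expr.

Fixpoint ev (e : expr) (z : R * R) : R :=
  match e with
  | EX p => p.[z.1]
  | EY p => p.[z.2]
  | EAdd e f => ev e z + ev f z
  | EMul e f => ev e z * ev f z
  | EInv e => (ev e z)^-1
  end.

Definition EC (c : R) := EX c%:P.

(* [D false] is the derivative in the first variable, [D true] in the second. *)
Fixpoint D (b : bool) (e : expr) : expr :=
  match e with
  | EX p => EX (if b then 0 else p^`())
  | EY p => EY (if b then p^`() else 0)
  | EAdd e f => EAdd (D b e) (D b f)
  | EMul e f => EAdd (EMul (D b e) f) (EMul e (D b f))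
  | EInv e => EMul (EMul (EC (-1)) (D b e)) (EMul (EInv e) (EInv e))
  end.

Fixpoint ok (e : expr) (z : R * R) : bool :=
  match e with
  | EX _ | EY _ => true
  | EAdd e f | EMul e f => ok e z && ok f z
  | EInv e => ok e z && (ev e z != 0)
  end.

Lemma ok_D b e z : ok e z -> ok (D b e) z.
Proof.
elim: e => //= [e IHe f IHf|e IHe f IHf|e IHe] /andP[e1 e2].
- by rewrite IHe// IHf.
- by rewrite IHe// IHf// e1 e2.
- by rewrite IHe// e1 e2.
Qed.

Lemma ev_DC b c e z : ev (D b (D c e)) z = ev (D c (D b e)) z.
Proof.
elim: e => [p|p|e IHe f IHf|e IHe f IHf|e IHe] /=.
- by case: b c => [] []; rewrite ?raddf0.
- by case: b c => [] []; rewrite ?raddf0.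
- by rewrite IHe IHf.
- by rewrite IHe IHf; ring.
- by rewrite IHe !derivC !if_same !hornerC; ring.
Qed.

Lemma cara_ev S e z : ok e z ->
  cara S (ev e) z (ev (D false e) z) (ev (D true e) z).
Proof.
elim: e => [p|p|e IHe f IHf|e IHe f IHf|e IHe] /=.
- by rewrite horner0 => _; exact: cara_poly1.
- by rewrite horner0 => _; exact: cara_poly2.
- by move=> /andP[/IHe ce /IHf cf]; exact: caraD.
- by move=> /andP[/IHe ce /IHf cf]; exact: caraM.
- move=> /andP[/IHe ce e0]; rewrite !hornerC !mulN1r; exact: caraV.
Qed.

Lemma ev_cvg S e z : ok e z -> ev e @ within S (nbhs z) --> ev e z.
Proof. by move=> /(cara_ev S); exact: cara_cvg. Qed.

End Expressions.

(** * Inverting a chart on the compact square *)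

Section Inverse.
Variables (R : realType) (F : R * R -> R * R).
Hypothesis Fc : {within @Sq R, continuous F}.
Hypothesis Fi : {in @Sq R &, injective F}.

Lemma Sq_compact : compact (@Sq R).
Proof. by apply: compact_setX; exact: segment_compact. Qed.

Lemma prod_hausdorff : hausdorff_space (R * R)%type.
Proof. exact: norm_hausdorff. Qed.

Lemma image_closed K : closed K -> K `<=` @Sq R -> closed (F @` K).
Proof.
move=> cK KS; apply: (compact_closed prod_hausdorff).
apply: continuous_compact; first exact: continuous_subspaceW Fc.
exact: subclosed_compact Sq_compact KS.
Qed.

(** Continuity of the inverse chart, stated without an inverse: the parameters outside the interior
    of [U] form a compact set, whose image is closed and misses [F s0] by injectivity. *)
Lemma inv_near (U : set (R * R)) s0 : Sq s0 -> nbhs s0 U ->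
  \forall w \near F s0, forall s, Sq s -> F s = w -> U s.
Proof.
move=> S0 U0; pose K := @Sq R `\` U°.
have cK : closed (F @` K).
  apply: image_closed; last by move=> s [].
  apply: closedI; first exact: compact_closed prod_hausdorff Sq_compact.
  by apply: open_closedC; exact: open_interior.
have : nbhs (F s0) (~` (F @` K)).
  apply: open_nbhs_nbhs; split; first exact: closed_openC.
  move=> [s [Ss Us] /Fi]; rewrite !inE => /(_ Ss S0) ss0.
  by apply: Us; rewrite ss0.
apply: filterS => w nK s Ss Fs; apply: contrapT => nU; apply: nK.
by exists s => //; split => // /interior_subset.
Qed.

Variables (S : set (R * R)) (s0 : R * R).
Hypotheses (SSq : S `<=` @Sq R) (S0 : Sq s0).

Lemma push_near (P : R * R -> Prop) :
  (\forall s \near within S (nbhs s0), P s) ->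
  \forall w \near F s0, forall s, S s -> F s = w -> P s.
Proof.
rewrite near_withinE => /(inv_near S0); apply: filterS => w H s Ss Fs.
by apply: (H s) => //; exact: SSq.
Qed.

Lemma push_cvg (h v : R * R -> R) (l : R) :
  (forall s, S s -> h (F s) = v s) -> v @ within S (nbhs s0) --> l ->
  h @ within (F @` S) (nbhs (F s0)) --> l.
Proof.
move=> hv vl A /vl /push_near H; rewrite /= /within/=.
by apply: filterS H => w H [s Ss Fs]; rewrite /= -Fs hv//; exact: H.
Qed.

(** The slope functions of the two coordinates of [F] form a matrix that is invertible near [s0].
    Solving with it by Cramer's rule, before any limit is taken, expresses the increment of [h]
    through that of [w]. *)
Lemma push_cara (h v : R * R -> R) a11 a12 a21 a22 c d : S s0 ->
  (forall s, S s -> h (F s) = v s) ->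
  cara S (fst \o F) s0 a11 a12 -> cara S (snd \o F) s0 a21 a22 ->
  cara S v s0 c d -> a11 * a22 - a12 * a21 != 0 ->
  cara (F @` S) h (F s0) ((c * a22 - d * a21) / (a11 * a22 - a12 * a21))
    ((d * a11 - c * a12) / (a11 * a22 - a12 * a21)).
Proof.
move=> SS0 hv [p1 [q1 [p1l q1l F1]]] [p2 [q2 [p2l q2l F2]]] [p [q [pl ql vE]]] J0.
(* The default [s0] is harmless: only values on the image of [S] are used. *)
pose Finv w := xget s0 [set s | S s /\ F s = w].
have FinvK s : S s -> Finv (F s) = s.
  move=> Ss; rewrite /Finv; case: xgetP => [t _ [St Ft]|/(_ s)[]//].
  by apply: Fi => //; rewrite inE; exact: SSq.
pose det s := p1 s * q2 s - q1 s * p2 s.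
have detl : det @ within S (nbhs s0) --> a11 * a22 - a12 * a21.
  by apply: cvgB; apply: cvgM.
pose P s := (p s * q2 s - q s * p2 s) / det s.
pose Q s := (q s * p1 s - p s * q1 s) / det s.
exists (P \o Finv), (Q \o Finv); split.
- apply: (@push_cvg _ P); first by move=> s Ss /=; rewrite FinvK.
  by apply: cvgM; [apply: cvgB; apply: cvgM|exact: cvgV].
- apply: (@push_cvg _ Q); first by move=> s Ss /=; rewrite FinvK.
  by apply: cvgM; [apply: cvgB; apply: cvgM|exact: cvgV].
have det0 : \forall s \near within S (nbhs s0), det s != 0.
  move/cvgrPdist_lt: detl => /(_ `|a11 * a22 - a12 * a21|).
  rewrite normr_gt0 => /(_ J0); apply: filterS => w; apply: contraTneq => ->.
  by rewrite subr0 ltxx.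
move: (push_near det0) (push_near F1) (push_near F2) (push_near vE).
rewrite near_withinE => H1 H2 H3 H4; near=> w.
have D1 : forall s, S s -> F s = w -> det s != 0 by near: w.
have D2 : forall s, S s -> F s = w -> (fst \o F) s - (fst \o F) s0 =
  p1 s * (s.1 - s0.1) + q1 s * (s.2 - s0.2) by near: w.
have D3 : forall s, S s -> F s = w -> (snd \o F) s - (snd \o F) s0 =
  p2 s * (s.1 - s0.1) + q2 s * (s.2 - s0.2) by near: w.
have D4 : forall s, S s -> F s = w -> v s - v s0 =
  p s * (s.1 - s0.1) + q s * (s.2 - s0.2) by near: w.
move=> [s Ss Fs].
have {D1}ds := D1 _ Ss Fs; have {D2}F1s := D2 _ Ss Fs.
have {D3}F2s := D3 _ Ss Fs; have {D4}vs := D4 _ Ss Fs.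
rewrite -Fs hv// hv// vs; move: F1s F2s => /= -> ->; rewrite FinvK// /P /Q.
by move: ds; rewrite /det => ds; field.
Unshelve. all: by end_near. Qed.

End Inverse.

(** * Univariate splines *)

Section OneVariableCalculus.
Variable R : realType.
Implicit Types (A : set R) (f g : R -> R) (s t l : R) (p q : {poly R}).

Definition cara1 A f s l := exists2 p : R -> R, p @ within A (nbhs s) --> l &
  \forall t \near within A (nbhs s), f t - f s = p t * (t - s).

Lemma within_dnbhs A s (P : R -> Prop) :
  (\forall t \near within A s^', P t) ->
  \forall t \near within A (nbhs s), t != s -> P t.
Proof.
move=> H; change (nbhs s [set t | A t -> t != s -> P t]).
have {}H : nbhs s [set t | t != s -> A t -> P t] := H.
by apply: filterS H => t H At ts; exact: H.
Qed.

Lemma dnbhs_within A s (P : R -> Prop) :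
  (\forall t \near within A (nbhs s), P t) -> \forall t \near within A s^', P t.
Proof.
move=> H; change (nbhs s [set t | t != s -> A t -> P t]).
have {}H : nbhs s [set t | A t -> P t] := H.
by apply: filterS H => t H _.
Qed.

Lemma dnbhs_neq A s : \forall t \near within A s^', t != s.
Proof.
change (nbhs s [set t | t != s -> A t -> t != s]).
by apply: filterE => t /=.
Qed.

Lemma is_deriv01P f s l : is_deriv01 f s l <-> cara1 (@I01 R) f s l.
Proof.
split => [fl|[p pl fp]].
(* Filling the quotient with [l] at [s] passes from the punctured filter to the full one. *)
- exists (fun t => if t == s then l else (t - s)^-1 * (f t - f s)).
    move=> U Ul; have /within_dnbhs := fl _ Ul; apply: filterS => t H.
    rewrite /=; case: (eqVneq t s) => ts; first exact: nbhs_singleton.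
    exact: H.
  apply: nearW => t; case: eqVneq => [->|ts]; first by rewrite !subrr mulr0.
  by rewrite mulrC mulrA mulfV ?mul1r// subr_eq0.
- apply: (@near_cvg_eq _ _ _ _ _ p); last first.
    by move=> U /pl /dnbhs_within.
  have H := dnbhs_within fp; near=> t.
  have -> : f t - f s = p t * (t - s) by near: t.
  have ts : t != s.
    by near: t; apply: dnbhs_neq.
  by rewrite /GRing.scale/= mulrC mulfK// subr_eq0.
Unshelve. all: by end_near. Qed.

(** Each point is approached from the right inside the segment, except the right end, which is
    approached from the left. Uniqueness of one-sided derivatives rests on this. *)
Lemma segment_proper (a b s : R) : a < b -> a <= s <= b ->
  ProperFilter (within [set` `[a, b]] s^').
Proof.
move=> ab /andP[as_ sb]; apply: Build_ProperFilter_ex => P.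
move=> PF; have /nbhs_ballP[e /= e0 H] :
  nbhs s [set t | t != s -> t \in `[a, b] -> P t] := PF.
have [sb'|bs] := ltP s b.
- exists (Num.min b (s + e / 2)); apply: H.
  + rewrite /ball/= distrC ger0_norm; last first.
      by rewrite subr_ge0 le_min sb lerDl divr_ge0// ltW.
    by rewrite ltrBlDl gt_min (_ : s + e / 2 < s + e) ?orbT// ltrD2l; lra.
  + by rewrite gt_eqF// lt_min sb' ltrDl divr_gt0.
  + rewrite /= in_itv/= le_min (ltW ab) ge_min lexx/= andbT.
    by rewrite (le_trans as_)// lerDl divr_ge0// ltW.
- have as' : a < s by rewrite (lt_le_trans ab).
  exists (Num.max a (s - e / 2)); apply: H.
  + rewrite /ball/= ger0_norm; last first.
      by rewrite subr_ge0 ge_max as_ gerBl divr_ge0// ltW.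
    by rewrite ltrBlDr -ltrBlDl lt_max (_ : s - e < s - e / 2) ?orbT//; lra.
  + by rewrite lt_eqF// gt_max as' gtrBl divr_gt0.
  + rewrite /= in_itv/= ge_max (ltW ab) le_max lexx/=.
    by rewrite (le_trans _ sb)// gerBl divr_ge0// ltW.
Qed.

Lemma cara1_unique (a b : R) f s l l' : a < b -> a <= s <= b ->
  cara1 [set` `[a, b]] f s l -> cara1 [set` `[a, b]] f s l' -> l = l'.
Proof.
move=> ab asb; have PF := segment_proper ab asb.
have key k : cara1 [set` `[a, b]] f s k ->
    (fun t => (t - s)^-1 * (f t - f s)) @ within [set` `[a, b]] s^' --> k.
  move=> [p pl fp]; apply: (@near_cvg_eq _ _ _ _ _ p); last first.
    by move=> U /pl /dnbhs_within.
  have H := dnbhs_within fp; near=> t.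
  have -> : f t - f s = p t * (t - s) by near: t.
  have ts : t != s.
    by near: t; apply: dnbhs_neq.
  by rewrite mulrC mulfK// subr_eq0.
by move=> /key H /key H'; exact: within_cvg_unique H H'.
Unshelve. all: by end_near. Qed.

Lemma I01_proper s : I01 s -> ProperFilter (within (@I01 R) s^').
Proof. by rewrite /I01/= in_itv/=; exact: segment_proper. Qed.

Lemma deriv01_eq (V : normedModType R) (f : R -> V) s (l : V) : I01 s ->
  is_deriv01 f s l -> deriv01 f s = l.
Proof. by move=> /I01_proper PF fl; apply: cvg_lim => //; exact: norm_hausdorff. Qed.

Lemma cara1_deriv01 f s l : I01 s -> cara1 (@I01 R) f s l -> deriv01 f s = l.
Proof. by move=> Is /is_deriv01P; exact: deriv01_eq. Qed.

Lemma cara1_sub A B f s l : A `<=` B -> cara1 B f s l -> cara1 A f s l.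
Proof.
move=> AB [p pl fp]; exists p; first exact: cvg_within_sub pl.
exact: within_sub fp.
Qed.

Lemma cara1_eq A f g s l : A s -> (forall t, A t -> f t = g t) ->
  cara1 A f s l -> cara1 A g s l.
Proof.
move=> As fg [p pl fp]; exists p => //; near=> t.
rewrite -!fg//; first by near: t.
near: t; exact: near_within_self.
Unshelve. all: by end_near. Qed.

Lemma id_cvg A s : id @ within A (nbhs s) --> s.
Proof. by apply: cvg_within_filter; exact: cvg_id. Qed.

Lemma cara1_cvg A f s l : cara1 A f s l -> f @ within A (nbhs s) --> f s.
Proof.
move=> [p pl fp].
apply: (@near_cvg_eq _ _ _ _ _ (fun t => f s + p t * (t - s))).
  by apply: filterS fp => w <-; rewrite addrC subrK.
apply: (@cvg_to_eq _ _ _ _ (f s + l * (s - s))); first by ring.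
apply: cvgD; first exact: cvg_cst.
by apply: cvgM => //; apply: cvgB; [exact: id_cvg|exact: cvg_cst].
Qed.

Lemma cara1_poly A q s : cara1 A (horner q) s q^`().[s].
Proof.
have [q' qE <-] := poly_slope q s; exists (horner q').
  by apply: cvg_within_filter; exact: continuous_horner.
by apply: nearW => w; rewrite qE.
Qed.

Lemma cara1D A f g s l k : cara1 A f s l -> cara1 A g s k ->
  cara1 A (fun t => f t + g t) s (l + k).
Proof.
move=> [p pl fp] [q ql gq]; exists (fun t => p t + q t); first exact: cvgD.
near=> t; have -> : f t + g t - (f s + g s) = f t - f s + (g t - g s) by ring.
have -> : f t - f s = p t * (t - s) by near: t.
have -> : g t - g s = q t * (t - s) by near: t.
by ring.
Unshelve. all: by end_near. Qed.

Lemma cara1M A f g s l k : cara1 A f s l -> cara1 A g s k ->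
  cara1 A (fun t => f t * g t) s (l * g s + f s * k).
Proof.
move=> cf [q ql gq]; have fs := cara1_cvg cf; case: cf => [p pl fp].
exists (fun t => p t * g s + f t * q t).
  by apply: cvgD; apply: cvgM => //; exact: cvg_cst.
near=> t.
have -> : f t * g t - f s * g s = (f t - f s) * g s + f t * (g t - g s) by ring.
have -> : f t - f s = p t * (t - s) by near: t.
have -> : g t - g s = q t * (t - s) by near: t.
by ring.
Unshelve. all: by end_near. Qed.

Lemma cara1Z A f s l (c : R) : cara1 A f s l ->
  cara1 A (fun t => c * f t) s (c * l).
Proof.
move=> [p pl fp]; exists (fun t => c * p t).
  by apply: cvgM => //; exact: cvg_cst.
near=> t; have -> : c * f t - c * f s = c * (f t - f s) by ring.
have -> : f t - f s = p t * (t - s) by near: t.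
by ring.
Unshelve. all: by end_near. Qed.

Lemma I01_rev s : I01 (1 - s) <-> I01 s.
Proof. by rewrite /I01/= !in_itv/=; split => /andP[H1 H2]; apply/andP; split; lra. Qed.

Lemma rev_cvg (T : topologicalType) (f : R -> T) s (l : T) :
  f @ within (@I01 R) (nbhs (1 - s)) --> l ->
  (fun t => f (1 - t)) @ within (@I01 R) (nbhs s) --> l.
Proof.
move=> fl; apply: cvg_comp fl => U; rewrite /within/= => HU.
have : (fun t : R => 1 - t) @ nbhs s --> 1 - s.
  by apply: cvgB; [exact: cvg_cst|exact: cvg_id].
move=> /(_ _ HU) H.
have {}H : nbhs s [set t | I01 (1 - t) -> U (1 - t)] := H.
by apply: filterS H => t H /I01_rev; exact: H.
Qed.

Lemma cara1_rev f s l : cara1 (@I01 R) f (1 - s) l ->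
  cara1 (@I01 R) (fun t => f (1 - t)) s (- l).
Proof.
move=> [p pl fp]; exists (fun t => - p (1 - t)).
  by apply: cvgN; exact: rev_cvg.
have H : \forall t \near within (@I01 R) (nbhs s), f (1 - t) - f (1 - s) =
    p (1 - t) * ((1 - t) - (1 - s)).
  have : (fun t : R => 1 - t) @ nbhs s --> 1 - s.
    by apply: cvgB; [exact: cvg_cst|exact: cvg_id].
  move=> /(_ _ fp) H.
  have {}H : nbhs s [set t | I01 (1 - t) -> f (1 - t) - f (1 - s) =
    p (1 - t) * ((1 - t) - (1 - s))] := H.
  by rewrite near_withinE; apply: filterS H => t H /I01_rev; exact: H.
by apply: filterS H => t ->; ring.
Qed.

(** The derivative relative to [0,1] restricts to the cell and is unique there, so the formula of
    the polynomial piece holds at the knots as well. *)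
Lemma cell_deriv (a b : R) f q s l : a < b -> 0 <= a -> b <= 1 ->
  a <= s <= b -> (forall t, a <= t <= b -> f t = q.[t]) ->
  cara1 (@I01 R) f s l -> l = q^`().[s].
Proof.
move=> ab a0 b1 asb fq fl.
have sub : [set` `[a, b]] `<=` @I01 R.
  move=> t; rewrite /I01/= !in_itv/= => /andP[at_ tb].
  by rewrite (le_trans a0)//= (le_trans tb).
apply: (cara1_unique ab asb); last exact: (cara1_poly _ q).
apply: (@cara1_eq _ f); last exact: cara1_sub fl.
- by rewrite /= in_itv.
- by move=> t; rewrite /= in_itv/=; exact: fq.
Qed.

End OneVariableCalculus.

(** * Splines in one variable and truncated powers *)

Section Splines.
Variables (R : realType) (n : nat).
Hypothesis n0 : (0 < n)%N.
Implicit Types (f g : R -> R) (s t : R) (q : {poly R}).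

Let nR : (0 : R) < n%:R. Proof. by rewrite ltr0n. Qed.

Lemma cell_lt (j : nat) : j%:R / n%:R < j.+1%:R / n%:R :> R.
Proof. by rewrite ltr_pM2r ?invr_gt0// ltr_nat. Qed.

Lemma cell_ge0 (j : nat) : 0 <= j%:R / n%:R :> R.
Proof. by rewrite divr_ge0. Qed.

Lemma cell_le1 (j : nat) : (j <= n)%N -> j%:R / n%:R <= 1 :> R.
Proof. by move=> jn; rewrite ler_pdivrMr// mul1r ler_nat. Qed.

Lemma cell_I01 (j : 'I_n) s : j%:R / n%:R <= s <= j.+1%:R / n%:R -> I01 s.
Proof.
move=> /andP[js sj]; rewrite /I01/= in_itv/= (le_trans (cell_ge0 j))//=.
by rewrite (le_trans sj)// cell_le1.
Qed.

Lemma spline_cara1 p r f s : (0 < r)%N -> spline p r n f -> I01 s ->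
  cara1 (@I01 R) f s (deriv01 f s).
Proof.
case: r => // r _ [[g [g0 gd gc]] _] Is.
have fg : cara1 (@I01 R) f s (g 1%N s).
  apply: (@cara1_eq _ _ (g 0%N)) => //; apply/is_deriv01P; exact: gd.
by rewrite (cara1_deriv01 Is fg).
Qed.

Lemma spline_deriv p r f : spline p r.+1 n f -> spline p r n (deriv01 f).
Proof.
move=> sf; have fc := spline_cara1 (ltn0Sn r) sf.
case: sf => -[g [g0 gd gc]] fq; split.
- exists (fun j => g j.+1); split.
  + move=> s Is; apply/esym/deriv01_eq => //; apply/is_deriv01P.
    apply: (@cara1_eq _ _ (g 0%N)) => //; apply/is_deriv01P; exact: gd.
  + by move=> j jr s Is; apply: gd.
  + by move=> j jr; apply: gc.
- move=> j; have [q qs fqE] := fq j; exists q^`().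
    rewrite (leq_trans (size_poly _ _))// -ltnS ltnW//.
    by case: (size q) qs => //= k /ltnW.
  move=> s sj; exact: (cell_deriv (cell_lt j) (cell_ge0 j) (cell_le1 (ltn_ord j)) sj fqE
    (fc _ (cell_I01 sj))).
Qed.

Lemma spline_continuous p r f : spline p r n f -> {within @I01 R, continuous f}.
Proof.
move=> [[g [g0 _ gc]] _]; apply/subspace_continuousP => s Is.
have /subspace_continuousP := gc 0%N isT => /(_ s Is) H.
apply: (cvg_to_eq (g0 s Is)); apply: (@near_cvg_eq _ _ _ _ _ (g 0%N)) => //.
by rewrite near_withinE; apply: nearW => t It; rewrite g0.
Qed.

Lemma spline_lin p r f g (c : R) : spline p r n f -> spline p r n g ->
  spline p r n (fun s => c * f s + g s).
Proof.
move=> [[f' [f0 fd fc]] fq] [[g' [g0 gd gc]] gq]; split.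
- exists (fun j s => c * f' j s + g' j s); split.
  + by move=> s Is; rewrite f0// g0.
  + move=> j jr s Is; apply/is_deriv01P.
    apply: cara1D; last by apply/is_deriv01P; exact: gd.
    by apply: cara1Z; apply/is_deriv01P; exact: fd.
  + move=> j jr; apply/subspace_continuousP => s Is.
    have /subspace_continuousP/(_ s Is) Hf := fc j jr.
    have /subspace_continuousP/(_ s Is) Hg := gc j jr.
    by apply: cvgD => //; apply: cvgM => //; exact: cvg_cst.
- move=> j; have [q qs fqE] := fq j; have [q' qs' gqE] := gq j.
  exists (c *: q + q').
    rewrite (leq_trans (size_polyD _ _))// geq_max qs'.
    by rewrite (leq_trans (size_scale_leq _ _)).
  by move=> s sj; rewrite fqE// gqE// !hornerE.
Qed.

Lemma spline_rev p r f : spline p r n f -> spline p r n (fun s => f (1 - s)).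
Proof.
move=> [[f' [f0 fd fc]] fq]; split.
(* Each derivative of the reflection contributes one sign. *)
- exists (fun j s => (-1) ^+ j * f' j (1 - s)); split.
  + by move=> s Is; rewrite expr0 mul1r f0//; apply/I01_rev.
  + move=> j jr s Is; apply/is_deriv01P; rewrite exprS mulN1r mulNr -mulrN.
    apply: cara1Z; apply: cara1_rev; apply/is_deriv01P; apply: fd => //.
    exact/I01_rev.
  + move=> j jr; apply/subspace_continuousP => s Is.
    have Is' : I01 (1 - s) by exact/I01_rev.
    have /subspace_continuousP/(_ _ Is') Hf := fc j jr.
    by apply: cvgM; [exact: cvg_cst|exact: (rev_cvg Hf)].
- move=> j; have [q qs fqE] := fq (rev_ord j); exists (q \Po (1 - 'X)).
    apply: leq_trans (size_comp_poly_leq _ _) _; rewrite ltnS.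
    have -> : size (1 - 'X : {poly R}) = 2%N.
      by rewrite -opprB size_polyN -polyC1 size_XsubC.
    by rewrite muln1; case: (size q) qs.
  move=> s /andP[js sj]; rewrite horner_comp !hornerE; apply: fqE => /=.
  have jn := ltn_ord j; rewrite subnSK// !natrB//; last exact: ltnW.
  move: js sj; rewrite !ler_pdivrMr// !ler_pdivlMr// => js sj.
  by apply/andP; split; lra.
Qed.

(** Differentiation lowers the degree by one and the linear factor restores it, while the smoothness
    drops from [r.+1] to [r]. This is why traces are taken in the smoother space. *)
Lemma spline_mul_deriv p r f (L : {poly R}) : (size L <= 2)%N ->
  spline p r.+1 n f -> spline p r n (fun s => L.[s] * deriv01 f s).
Proof.
move=> sL sf; have [_ dq] := spline_deriv sf.
have fc := spline_cara1 (ltn0Sn r) sf.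
have LE s : L^`().[s] = L^`().[0].
  have /size1_polyC -> : (size L^`() <= 1)%N.
    rewrite (leq_trans (size_poly _ _))//.
    by case: (size L) sL.
  by rewrite !hornerC.
case: sf => -[g [g0 gd gc]] fq; split.
(* Leibniz's rule has only two terms, because the second derivative of [L] is zero; the first is
   constant and is read off at 0. *)
- exists (fun j s => L.[s] * g j.+1 s + j%:R * L^`().[0] * g j s); split.
  + move=> s Is; rewrite !mul0r addr0; congr (_ * _).
    apply/esym/deriv01_eq => //; apply/is_deriv01P.
    apply: (@cara1_eq _ _ (g 0%N)) => //; apply/is_deriv01P; exact: gd.
  + move=> j jr s Is; apply/is_deriv01P.
    have -> : L.[s] * g j.+2 s + j.+1%:R * L^`().[0] * g j.+1 s =
        L^`().[s] * g j.+1 s + L.[s] * g j.+2 s + j%:R * L^`().[0] * g j.+1 s.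
      by rewrite LE -natr1; ring.
    apply: cara1D.
      apply: cara1M; first exact: cara1_poly.
      by apply/is_deriv01P; exact: gd.
    apply: cara1Z; apply/is_deriv01P; apply: gd => //; exact: ltnW.
  + move=> j jr; apply/subspace_continuousP => s Is.
    have /subspace_continuousP/(_ s Is) H1 := gc j.+1 jr.
    have /subspace_continuousP/(_ s Is) H2 := gc j (leqW jr).
    apply: cvgD; apply: cvgM => //; last exact: cvg_cst.
    by apply: cvg_within_filter; exact: continuous_horner.
- move=> j; have [q qs fqE] := fq j; exists (L * q^`()).
    apply: (leq_trans (size_polyMleq _ _)).
    rewrite -subn1 leq_subLR add1n -addn2 addnC.
    apply: leq_trans (leq_add (size_poly _ _) sL) _.
    rewrite !addn2 !ltnS; case: (size q) qs => //= k; exact: leqW.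
  move=> s sj; rewrite hornerM; congr (_ * _).
  exact: (cell_deriv (cell_lt j) (cell_ge0 j) (cell_le1 (ltn_ord j)) sj fqE
    (fc _ (cell_I01 sj))).
Qed.

Lemma spline_poly p r q : (size q <= p.+1)%N -> spline p r n (horner q).
Proof.
move=> sq; split; last by move=> j; exists q.
exists (fun j s => (q^`(j)).[s]); split => //.
- move=> j jr s Is; apply/is_deriv01P; rewrite derivnS; exact: cara1_poly.
- move=> j jr; apply: continuous_subspaceT; exact: continuous_horner.
Qed.

(** Cut off on the right of the knot, so that the jet at 1 is zero when the knot lies before the
    last cell ends. *)
Definition truncate t q s := if s <= t then q.[s] else 0.

(** Since [q] vanishes at [t], truncation is composition of [q] with the minimum of [s] and [t]. *)
Lemma truncate_continuous t q : q.[t] = 0 -> continuous (truncate t q).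
Proof.
move=> qt; have -> : truncate t q = horner q \o (fun s => Num.min s t).
  apply/funext => s; rewrite /truncate/=; case: (leP s t) => st.
    by [].
  by rewrite qt.
move=> s; apply: continuous_comp; last exact: continuous_horner.
by apply: continuous_min; [exact: cvg_id|exact: cvg_cst].
Qed.

Lemma truncate_cara1 A t q s : q.[t] = 0 -> q^`().[t] = 0 ->
  cara1 A (truncate t q) s (truncate t q^`() s).
Proof.
move=> qt q't; have [st|ts|->] := ltgtP s t.
- have [p pl fp] := cara1_poly A q s; exists p.
    by rewrite /truncate (ltW st).
  near=> u; rewrite /truncate (ltW st) ifT; first by near: u.
  apply: ltW; near: u; rewrite near_withinE.
  by apply: filterS (lt_nbhsl st) => u H _.
- have ts' : (s <= t) = false by rewrite leNgt ts.
  exists (fun=> 0); first by rewrite /truncate ts'; exact: cvg_cst.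
  near=> u; rewrite /truncate ts' ifF ?mul0r ?subrr//.
  apply/negbTE; rewrite -ltNge; near: u; rewrite near_withinE.
  by apply: filterS (lt_nbhsr ts) => u H _.
- have [q' qE q'E] := poly_slope q t.
  exists (truncate t q').
    apply: (@cvg_to_eq _ _ _ _ (truncate t q' t)).
      by rewrite /truncate lexx q'E.
    apply: cvg_within_filter; apply: truncate_continuous; by rewrite q'E.
  apply: nearW => u; rewrite /truncate lexx; case: ifP => _; first exact: qE.
  by rewrite qt mul0r subrr.
Unshelve. all: by end_near. Qed.

Lemma spline_truncate p r q (k : nat) : (size q <= p.+1)%N ->
  (forall j, (j <= r)%N -> (q^`(j)).[k%:R / n%:R] = 0) ->
  spline p r n (truncate (k%:R / n%:R) q).
Proof.
move=> sq qt; split.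
- exists (fun j => truncate (k%:R / n%:R) q^`(j)); split => //.
  + move=> j jr s Is; apply/is_deriv01P; rewrite derivnS.
    apply: truncate_cara1; first by apply: qt; exact: ltnW.
    by rewrite -derivnS; exact: qt.
  + move=> j jr; apply: continuous_subspaceT; apply: truncate_continuous.
    exact: qt.
- move=> j; have [jk|kj] := ltnP j k.
  + exists q => // s /andP[js sj]; rewrite /truncate (le_trans sj)//.
    by rewrite ler_pM2r ?invr_gt0// ler_nat.
  + exists 0; first by rewrite size_poly0.
    move=> s /andP[js sj]; rewrite horner0 /truncate; case: ifP => // sk.
    have -> : s = k%:R / n%:R.
      apply/eqP; rewrite eq_le sk/= (le_trans _ js)//.
      by rewrite ler_pM2r ?invr_gt0// ler_nat.
    by rewrite -[RHS](qt 0%N).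
Qed.

(** One derivative costs one power of the factor; the cofactor changes, so [u] is general in the
    induction. *)
Lemma derivn_mul_exp t (j m : nat) (u : {poly R}) : (j < m)%N ->
  ((u * (t%:P - 'X) ^+ m)^`(j)).[t] = 0.
Proof.
elim: j m u => [|j IH] [|m] u // jm.
  by rewrite derivn0 hornerM horner_exp !hornerE subrr expr0n mulr0.
have -> : (u * (t%:P - 'X) ^+ m.+1)^`(j.+1) =
    ((u^`() * (t%:P - 'X) - u *+ m.+1) * (t%:P - 'X) ^+ m)^`(j).
  rewrite derivSn derivM deriv_exp derivB derivC derivX exprS.
  by congr (_^`(_)); ring.
exact: IH.
Qed.

End Splines.

(** * Hermite interpolation by splines of smoothness [r.+1] *)

Section Hermite.
Variables (R : realType) (p r n : nat).
Hypotheses (hr : (1 <= r)%N) (hn : (1 <= n)%N).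
Implicit Types (f g : R -> R) (s t : R) (q : {poly R}).

Lemma spline_cell_deriv p' r' f q (j : 'I_n) s : (0 < r')%N ->
  spline p' r' n f ->
  (forall s, j%:R / n%:R <= s <= j.+1%:R / n%:R -> f s = q.[s]) ->
  j%:R / n%:R <= s <= j.+1%:R / n%:R -> deriv01 f s = q^`().[s].
Proof.
move=> r0 sf fq sj.
exact: (cell_deriv (cell_lt R hn j) (cell_ge0 R n j) (cell_le1 R hn (ltn_ord j)) sj
  fq (spline_cara1 r0 sf (cell_I01 hn sj))).
Qed.

Definition jet2 f s (c : R * R * R) :=
  [/\ f s = c.1.1, deriv01 f s = c.1.2 & deriv01 (deriv01 f) s = c.2].

Lemma jet2_cell f q (j : 'I_n) s : spline p r.+1 n f ->
  (forall s, j%:R / n%:R <= s <= j.+1%:R / n%:R -> f s = q.[s]) ->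
  j%:R / n%:R <= s <= j.+1%:R / n%:R ->
  jet2 f s (q.[s], q^`().[s], q^`()^`().[s]).
Proof.
move=> sf fq sj; split => /=; first exact: fq.
  exact: spline_cell_deriv sf fq sj.
apply: (spline_cell_deriv hr (spline_deriv hn sf) _ sj) => u uj.
exact: spline_cell_deriv sf fq uj.
Qed.

Lemma deriv01_lin f g s l k (c : R) : I01 s -> cara1 (@I01 R) f s l ->
  cara1 (@I01 R) g s k -> deriv01 (fun s => c * f s + g s) s = c * l + k.
Proof.
move=> Is fl gk; apply: cara1_deriv01 => //.
by apply: cara1D => //; exact: cara1Z.
Qed.

Lemma jet2_lin f g s (c : R) a b : spline p r.+1 n f -> spline p r.+1 n g ->
  I01 s -> jet2 f s a -> jet2 g s b ->
  jet2 (fun s => c * f s + g s) s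
    (c * a.1.1 + b.1.1, c * a.1.2 + b.1.2, c * a.2 + b.2).
Proof.
move=> sf sg Is [f0 f1 f2] [g0 g1 g2].
have df u : I01 u -> deriv01 (fun s => c * f s + g s) u =
    c * deriv01 f u + deriv01 g u.
  move=> Iu; exact: (deriv01_lin c Iu (spline_cara1 (ltn0Sn r) sf Iu)
    (spline_cara1 (ltn0Sn r) sg Iu)).
split => /=; [by rewrite f0 g0|by rewrite df// f1 g1|].
rewrite -f2 -g2; apply: cara1_deriv01 => //.
apply: (@cara1_eq _ _ (fun s => c * deriv01 f s + deriv01 g s)) => //.
  by move=> u Iu; rewrite df.
apply: cara1D; last exact: (spline_cara1 hr (spline_deriv hn sg) Is).
by apply: cara1Z; exact: (spline_cara1 hr (spline_deriv hn sf) Is).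
Qed.

(** The 2-jet at 0 of (t - s)^m, untruncated or truncated. *)
Let power_jet t m : R * R * R :=
  (t ^+ m, - (m%:R * t ^+ m.-1), m%:R * m.-1%:R * t ^+ m.-2).

Let good T t m := [/\ spline p r.+1 n T, jet2 T 0 (power_jet t m) &
  jet2 T 1 (0, 0, 0)].

Let E t m : {poly R} := (t%:P - 'X) ^+ m.

Let E1 t m s : (E t m)^`().[s] = - (m%:R * (t - s) ^+ m.-1).
Proof.
rewrite /E deriv_exp derivB derivC derivX sub0r mulN1r.
by rewrite hornerMn hornerN horner_exp !hornerE -mulr_natl; ring.
Qed.

Let E2 t m s : (E t m)^`()^`().[s] = m%:R * m.-1%:R * (t - s) ^+ m.-2.
Proof.
rewrite /E deriv_exp derivB derivC derivX sub0r mulN1r derivMn derivN deriv_exp.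
rewrite derivB derivC derivX sub0r mulN1r !(hornerMn, hornerN) horner_exp.
by rewrite !hornerE !mulNrn opprK -mulrnA -[LHS]mulr_natl natrM; ring.
Qed.

Let E0 t m s : (E t m).[s] = (t - s) ^+ m.
Proof. by rewrite /E horner_exp !hornerE. Qed.

Let size_E t m : (m <= p)%N -> (size (E t m) <= p.+1)%N.
Proof.
move=> mp; apply: leq_trans (size_exp_leq _ _) _.
have -> : size (t%:P - 'X : {poly R}) = 2%N by rewrite -opprB size_polyN size_XsubC.
by rewrite mul1n ltnS.
Qed.

Let zero_cell s : 0 <= s <= n%:R^-1 ->
  (Ordinal hn)%:R / n%:R <= s <= (Ordinal hn).+1%:R / n%:R.
Proof. by rewrite /= mul0r mul1r. Qed.

Let ltn_pred : (n.-1 < n)%N. Proof. by rewrite prednK. Qed.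

Let zero_in : (Ordinal hn)%:R / n%:R <= (0 : R) <= (Ordinal hn).+1%:R / n%:R.
Proof. by apply: zero_cell; rewrite lexx/= invr_ge0. Qed.

Let one_in : (Ordinal ltn_pred)%:R / n%:R <= (1 : R) <=
  (Ordinal ltn_pred).+1%:R / n%:R.
Proof.
rewrite /= prednK// mulfV ?pnatr_eq0 -?lt0n// lexx andbT.
by apply: cell_le1 => //; exact: leq_pred.
Qed.

(** The exponent 3 is the least for which (1 - s)^m vanishes to second order at 1. *)
Let good_poly m : (3 <= m <= p)%N -> good (horner (E 1 m)) 1 m.
Proof.
move=> /andP[m3 mp]; have sE := spline_poly n r.+1 (size_E 1 mp).
split=> //.
- have := jet2_cell (q := E 1 m) sE (fun _ _ => erefl) zero_in.
  by rewrite E0 E1 E2 subr0.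
- have := jet2_cell (q := E 1 m) sE (fun _ _ => erefl) one_in.
  rewrite E0 E1 E2 subrr !expr0n.
  by case: m m3 {mp sE} => [|[|[|m]]] //= _; rewrite !mulr0 oppr0.
Qed.

(** An exponent at least [r + 2] makes all derivatives up to order [r.+1] vanish at the knot, and
    [k < n] makes the function zero on the last cell. *)
Let good_truncate k m : (0 < k < n)%N -> (r + 2 <= m <= p)%N ->
  good (truncate (k%:R / n%:R) (E (k%:R / n%:R) m)) (k%:R / n%:R) m.
Proof.
move=> /andP[k0 kn] /andP[rm mp]; set t := k%:R / n%:R.
have n0 : (0 : R) < n%:R by rewrite ltr0n.
have sT : spline p r.+1 n (truncate t (E t m)).
  apply: spline_truncate => //; first exact: size_E.
  move=> j jr; rewrite /E -[X in X^`(_)]mul1r.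
  by apply: derivn_mul_exp; rewrite (leq_trans _ rm)// addn2 ltnS.
split=> //.
- have := jet2_cell (q := E t m) sT _ zero_in.
  rewrite E0 E1 E2 subr0; apply => s /andP[_ s1].
  rewrite /truncate (le_trans s1)//= /t.
  by rewrite ler_pM2r ?invr_gt0// ler_nat.
- have := jet2_cell (q := 0) sT _ one_in.
  rewrite !linear0 !horner0; apply => s /andP[s1 _].
  rewrite /truncate horner0; case: ifP => // st.
  have -> : s = t.
    apply/eqP; rewrite eq_le st/= (le_trans _ s1)//= /t.
    by rewrite ler_pM2r ?invr_gt0// ler_nat -ltnS prednK.
  by rewrite E0 subrr expr0n; case: m rm {mp sT} => //; rewrite addn2.
Qed.

Let hermite_comb T1 T2 T3 t1 t2 t3 m1 m2 m3 (x y z c0 c1 c2 : R) :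
  good T1 t1 m1 -> good T2 t2 m2 -> good T3 t3 m3 ->
  x * t1 ^+ m1 + y * t2 ^+ m2 + z * t3 ^+ m3 = c0 ->
  x * (m1%:R * t1 ^+ m1.-1) + y * (m2%:R * t2 ^+ m2.-1) +
    z * (m3%:R * t3 ^+ m3.-1) = - c1 ->
  x * (m1%:R * m1.-1%:R * t1 ^+ m1.-2) + y * (m2%:R * m2.-1%:R * t2 ^+ m2.-2) +
    z * (m3%:R * m3.-1%:R * t3 ^+ m3.-2) = c2 ->
  exists f, [/\ spline p r.+1 n f, jet2 f 0 (c0, c1, c2) & jet2 f 1 (0, 0, 0)].
Proof.
move=> [s1 z1 e1] [s2 z2 e2] [s3 z3 e3] h0 h1 h2.
have I0 : I01 (0 : R) by rewrite /I01/= in_itv/= lexx ler01.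
have I1 : I01 (1 : R) by rewrite /I01/= in_itv/= lexx ler01.
have s0 : spline p r.+1 n (horner (0 : {poly R})).
  by apply: spline_poly; rewrite size_poly0.
have z0 : jet2 (horner (0 : {poly R})) 0 (0, 0, 0).
  by have := jet2_cell (q := 0) s0 (fun _ _ => erefl) zero_in; rewrite !linear0 !horner0.
have e0 : jet2 (horner (0 : {poly R})) 1 (0, 0, 0).
  by have := jet2_cell (q := 0) s0 (fun _ _ => erefl) one_in; rewrite !linear0 !horner0.
have s30 := spline_lin z s3 s0; have s230 := spline_lin y s2 s30.
exists (fun s => x * T1 s + (y * T2 s + (z * T3 s + (0 : {poly R}).[s]))).
split; first exact: spline_lin s1 s230.
- have := jet2_lin x s1 s230 I0 z1 (jet2_lin y s2 s30 I0 z2 (jet2_lin z s3 s0 I0 z3 z0)).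
  congr (jet2 _ _ (_, _, _)) => /=.
  + by rewrite -h0; ring.
  + by rewrite -[RHS]opprK -h1; ring.
  + by rewrite -h2; ring.
- have := jet2_lin x s1 s230 I1 e1 (jet2_lin y s2 s30 I1 e2 (jet2_lin z s3 s0 I1 e3 e0)).
  by rewrite /= !mulr0 !addr0.
Qed.

Hypotheses (hp : (r + 2 <= p)%N)
  (hn4 : (4%:R - r%:R) / (p%:R - r%:R - 1) <= n%:R :> R).

(** The cases are sorted by the number of interior knots used to reach three interpolating
    functions: none for degree at least 5, one for degree 4, two for degree 3. *)
Lemma degree_cases : [\/ (5 <= p)%N, p = 4%N /\ (2 <= n)%N
  | [/\ p = 3%N, r = 1%N & (3 <= n)%N]].
Proof.
have [p5|p5] := leqP 5 p; first by constructor 1.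
have d0 : 0 < p%:R - r%:R - 1 :> R.
  have : (r + 2)%:R <= p%:R :> R by rewrite ler_nat.
  by rewrite natrD; lra.
move: hn4; rewrite ler_pdivrMr//.
have [p4|p4] := leqP 4 p.
- have -> : p = 4%N by apply/eqP; rewrite eqn_leq p4 -ltnS p5.
  move=> H; constructor 2; split => //; rewrite ltnNge; apply/negP => n1.
  have n1R : n%:R = 1 :> R.
    by have -> : n = 1%N by apply/eqP; rewrite eqn_leq n1 hn.
  by move: H; rewrite n1R; lra.
- have p3 : p = 3%N by apply/eqP; rewrite eqn_leq -ltnS p4 (leq_trans _ hp)// addn2 !ltnS.
  have r1 : r = 1%N by apply/eqP; rewrite eqn_leq hr andbT -(leq_add2r 2) (leq_trans hp)// p3.
  rewrite p3 r1 => H; constructor 3; split => //.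
  rewrite -(ler_nat R); move: H; lra.
Qed.

(* [S^{p,r+1}] has the basis [(1 - s)^m], [(t - s)_+^m], whose elements vanish
   to second order at 1; the condition on [n] says that there are three. *)
Lemma hermite (c : R * R * R) : exists f,
  [/\ spline p r.+1 n f, jet2 f 0 c & jet2 f 1 (0, 0, 0)].
Proof.
case: c => -[c0 c1] c2.
have n0 : (0 : R) < n%:R by rewrite ltr0n.
case: degree_cases => [p5|[p4 n2]|[p3 r1 n3]].
- have [p3 p4] : (3 <= p /\ 4 <= p)%N by split; rewrite (leq_trans _ p5).
  (* Elimination in x + y + z = c0, 3x + 4y + 5z = -c1, 6x + 12y + 20z = c2, the conditions on (1 -
     s)^3, (1 - s)^4, (1 - s)^5. *)
  pose z := (c2 + 12 * c0 + 6 * c1) / 2.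
  pose y := - c1 - 3 * c0 - 2 * z.
  apply: (@hermite_comb _ _ _ 1 1 1 3 4 5 (c0 - y - z) y z);
    [exact: good_poly|exact: good_poly|exact: good_poly|..];
    by rewrite !expr1n /y /z/=; field.
- have t0 : n%:R^-1 != 0 :> R by rewrite invr_eq0 gt_eqF.
  have t1 : 1 - n%:R^-1 != 0 :> R.
    rewrite subr_eq0 eq_sym invr_eq1; apply/negP => /eqP n1.
    by move: n2; rewrite -(ltr_nat R) n1 ltxx.
  pose t : R := n%:R^-1; rewrite -/t in t0 t1.
  (* The same elimination with (1 - s)^3, (1 - s)^4 and the fourth power truncated at the first knot
     t = 1/n. The pivot vanishes only at t = 0 and t = 1, and [n2] excludes the latter. *)
  pose z := (c2 + 6 * c1 + 12 * c0) / (12 * t ^+ 2 * (1 - t) ^+ 2).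
  pose y := - c1 - 3 * c0 - 4 * t ^+ 3 * z + 3 * t ^+ 4 * z.
  have gt : good (truncate t (E t 4)) t 4.
    have := @good_truncate 1 4; rewrite mul1r; apply => //.
    by rewrite p4 leqnn andbT -p4.
  apply: (@hermite_comb _ _ _ 1 1 t 3 4 4 (c0 - y - t ^+ 4 * z) y z _ _ _ _ _ gt);
    [by apply: good_poly; rewrite p4|by apply: good_poly; rewrite p4|..];
    by rewrite !expr1n /y /z/=; field; rewrite t0 t1.
- pose t1 : R := 1 / n%:R; pose t2 : R := 2 / n%:R.
  have n3R : (3 : R) <= n%:R by rewrite ler_nat.
  have t10 : t1 != 0 by rewrite /t1 mulf_neq0// ?oner_eq0// invr_eq0 gt_eqF.
  have t21 : t2 = 2 * t1 by rewrite /t1 /t2; field; rewrite gt_eqF.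
  have t11 : t1 - 1 != 0.
    by rewrite lt_eqF// subr_lt0 /t1 ltr_pdivrMr//; lra.
  have t22 : 2 * t1 - 1 != 0.
    by rewrite -t21 lt_eqF// subr_lt0 /t2 ltr_pdivrMr//; lra.
  have d1 : 1 - t1 != 0 by rewrite -opprB oppr_eq0.
  have d2 : 1 - 2 * t1 != 0 by rewrite -opprB oppr_eq0.
  have d3 : t1 - 2 * t1 != 0 by rewrite (_ : _ - _ = - t1) ?oppr_eq0//; ring.
  (* In the unknowns x, y t2, z t1 this is a Vandermonde system at the nodes 1, t2, t1 with moments
     c2/6, -c1/3, c0; the formulas apply these moments to the Lagrange polynomials. The nodes are
     distinct because n is at least 3. *)
  pose z := (c0 + (1 + t2) * (c1 / 3) + t2 * (c2 / 6)) / (t1 * (t1 - 1) * (t1 - t2)).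
  pose y := (c0 + (1 + t1) * (c1 / 3) + t1 * (c2 / 6)) / (t2 * (t2 - 1) * (t2 - t1)).
  pose x := (c0 + (t1 + t2) * (c1 / 3) + t1 * t2 * (c2 / 6)) / ((1 - t1) * (1 - t2)).
  have g1 : good (truncate t1 (E t1 3)) t1 3.
    by apply: (@good_truncate 1 3); rewrite ?p3 ?r1// (ltn_trans _ n3).
  have g2 : good (truncate t2 (E t2 3)) t2 3.
    by apply: (@good_truncate 2 3); rewrite ?p3 ?r1.
  apply: (@hermite_comb _ _ _ 1 t2 t1 3 3 3 x y z _ _ _ _ g2 g1);
    [by apply: good_poly; rewrite p3|..];
    rewrite !expr1n /x /y /z/= t21; field.
  all: by rewrite d3 t11 t10 t22 d2 d1.
Qed.

End Hermite.

(** * Tensor-product splines *)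

Section TensorSplines.
Variables (R : realType) (p r n : nat).
Hypotheses (hr : (1 <= r)%N) (hn : (1 <= n)%N).
Implicit Types (f g : R * R -> R) (u v : R -> R) (z w : R * R).

Lemma fst_within z (U : set R) : within (@I01 R) (nbhs z.1) U ->
  within (@Sq R) (nbhs z) (fst @^-1` U).
Proof.
move=> HU; have fz : fst @ nbhs z --> z.1 by exact: cvg_fst.
have H : nbhs z [set w : R * R | I01 w.1 -> U w.1] := fz _ HU.
change (nbhs z [set w : R * R | Sq w -> U w.1]).
by apply: filterS H => w H [/H].
Qed.

Lemma snd_within z (U : set R) : within (@I01 R) (nbhs z.2) U ->
  within (@Sq R) (nbhs z) (snd @^-1` U).
Proof.
move=> HU; have fz : snd @ nbhs z --> z.2 by exact: cvg_snd.
have H : nbhs z [set w : R * R | I01 w.2 -> U w.2] := fz _ HU.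
change (nbhs z [set w : R * R | Sq w -> U w.2]).
by apply: filterS H => w H [_ /H].
Qed.

Lemma cara_fst u z l : cara1 (@I01 R) u z.1 l ->
  cara (@Sq R) (fun w => u w.1) z l 0.
Proof.
move=> [q ql uq]; exists (fun w => q w.1), (fun=> 0); split.
- by move=> U /ql /fst_within.
- exact: cvg_cst.
- have H : \forall w \near within (@Sq R) (nbhs z),
      u w.1 - u z.1 = q w.1 * (w.1 - z.1) := fst_within uq.
  by apply: filterS H => w ->; rewrite mul0r addr0.
Qed.

Lemma cara_snd u z l : cara1 (@I01 R) u z.2 l ->
  cara (@Sq R) (fun w => u w.2) z 0 l.
Proof.
move=> [q ql uq]; exists (fun=> 0), (fun w => q w.2); split.
- exact: cvg_cst.
- by move=> U /ql /snd_within.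
- have H : \forall w \near within (@Sq R) (nbhs z),
      u w.2 - u z.2 = q w.2 * (w.2 - z.2) := snd_within uq.
  by apply: filterS H => w ->; rewrite mul0r add0r.
Qed.

Lemma cara_line1 (S : set (R * R)) (A : set R) f z a b :
  (forall t, A t -> S (t, z.2)) ->
  cara S f z a b -> cara1 A (fun t => f (t, z.2)) z.1 a.
Proof.
move=> AS [q [q' [qa qb fq]]].
have lc (U : set (R * R)) : within S (nbhs z) U ->
    within A (nbhs z.1) [set t | U (t, z.2)].
  move=> HU.
  have lz : (fun t : R => (t, z.2)) @ nbhs z.1 --> (z.1, z.2).
    exact: (@cvg_pair _ _ _ (nbhs z.1) (nbhs z.1) (nbhs z.2) _ _ _ id (fun=> z.2)
      (@cvg_id _ _) (@cvg_cst _ _ _ _ _)).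
  have {}HU : nbhs (z.1, z.2) [set w | S w -> U w] by rewrite -surjective_pairing.
  have H : nbhs z.1 [set t | S (t, z.2) -> U (t, z.2)] := lz _ HU.
  change (nbhs z.1 [set t | A t -> U (t, z.2)]).
  by apply: filterS H => t H /AS /H.
exists (fun t => q (t, z.2)); first by move=> U /qa /lc.
near=> t; rewrite -surjective_pairing.
have -> : f (t, z.2) - f z = q (t, z.2) * (t - z.1) + q' (t, z.2) * (z.2 - z.2).
  by near: t; exact: (lc _ fq).
by ring.
Unshelve. all: by end_near. Qed.

Lemma cara_line2 (S : set (R * R)) (A : set R) f z a b :
  (forall t, A t -> S (z.1, t)) ->
  cara S f z a b -> cara1 A (fun t => f (z.1, t)) z.2 b.
Proof.
move=> AS [q [q' [qa qb fq]]].
have lc (U : set (R * R)) : within S (nbhs z) U ->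
    within A (nbhs z.2) [set t | U (z.1, t)].
  move=> HU.
  have lz : (fun t : R => (z.1, t)) @ nbhs z.2 --> (z.1, z.2).
    exact: (@cvg_pair _ _ _ (nbhs z.2) (nbhs z.1) (nbhs z.2) _ _ _ (fun=> z.1) id
      (@cvg_cst _ _ _ _ _) (@cvg_id _ _)).
  have {}HU : nbhs (z.1, z.2) [set w | S w -> U w] by rewrite -surjective_pairing.
  have H : nbhs z.2 [set t | S (z.1, t) -> U (z.1, t)] := lz _ HU.
  change (nbhs z.2 [set t | A t -> U (z.1, t)]).
  by apply: filterS H => t H /AS /H.
exists (fun t => q' (z.1, t)); first by move=> U /qb /lc.
near=> t; rewrite -surjective_pairing.
have -> : f (z.1, t) - f z = q (z.1, t) * (z.1 - z.1) + q' (z.1, t) * (t - z.2).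
  by near: t; exact: (lc _ fq).
by ring.
Unshelve. all: by end_near. Qed.

Lemma cara_d1 f z a b : Sq z -> cara (@Sq R) f z a b -> d1 f z = a.
Proof.
move=> [z1 z2] cf; apply: cara1_deriv01 => //.
by apply: cara_line1 cf => t It; split.
Qed.

Lemma cara_d2 f z a b : Sq z -> cara (@Sq R) f z a b -> d2 f z = b.
Proof.
move=> [z1 z2] cf; apply: cara1_deriv01 => //.
by apply: cara_line2 cf => t It; split.
Qed.

Definition cell (j k : 'I_n) : set (R * R) :=
  [set` `[j%:R / n%:R, j.+1%:R / n%:R]] `*`
  [set` `[k%:R / n%:R, k.+1%:R / n%:R]].

Lemma cell_Sq j k : cell j k `<=` @Sq R.
Proof.
by move=> z [z1 z2]; split; apply: (cell_I01 hn);
  [move: z1|move: z2]; rewrite /= in_itv/=; apply.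
Qed.

(** Bundles the analytic facts with a symbolic form on each closed cell, so that one induction over
    the tensor terms of a spline proves them together. *)
Definition C1_expr f f1 f2 :=
  [/\ forall z, Sq z -> cara (@Sq R) f z (f1 z) (f2 z),
      {within @Sq R, continuous f1}, {within @Sq R, continuous f2}
    & forall j k : 'I_n, exists2 e : expr R, (forall z, ok e z) &
      forall z, cell j k z ->
        [/\ f z = ev e z, f1 z = ev (D false e) z & f2 z = ev (D true e) z]].

Lemma C1_exprD f f1 f2 g g1 g2 : C1_expr f f1 f2 -> C1_expr g g1 g2 ->
  C1_expr (fun z => f z + g z) (fun z => f1 z + g1 z) (fun z => f2 z + g2 z).
Proof.
move=> [cf c1 c2 ef] [cg c1' c2' eg]; split.
- by move=> z Sz; apply: caraD; [exact: cf|exact: cg].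
- exact: within_continuousD.
- exact: within_continuousD.
- move=> j k; have [e oe eE] := ef j k; have [e' oe' eE'] := eg j k.
  exists (EAdd e e'); first by move=> z /=; rewrite oe oe'.
  by move=> z cz; have [-> -> ->] := eE _ cz; have [-> -> ->] := eE' _ cz.
Qed.

Lemma C1_expr_tensor u v : spline p r n u -> spline p r n v ->
  C1_expr (fun z => u z.1 * v z.2) (fun z => deriv01 u z.1 * v z.2)
    (fun z => u z.1 * deriv01 v z.2).
Proof.
move=> su sv.
have cont (h : R -> R) : {within @I01 R, continuous h} -> forall z, Sq z ->
    (fun w : R * R => h w.1) @ within (@Sq R) (nbhs z) --> h z.1 /\
    (fun w : R * R => h w.2) @ within (@Sq R) (nbhs z) --> h z.2.
  move=> /subspace_continuousP hc z [z1 z2]; split.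
    by move=> U /(hc _ z1) /fst_within.
  by move=> U /(hc _ z2) /snd_within.
have d h : spline p r n h -> {within @I01 R, continuous (deriv01 h)}.
  case: r hr => // r' _ sh; exact: (spline_continuous (spline_deriv hn sh)).
split.
- move=> z Sz; have [z1 z2] := Sz.
  have := caraM (cara_fst (spline_cara1 hr su z1)) (cara_snd (spline_cara1 hr sv z2)).
  by rewrite mulr0 mul0r addr0 add0r.
- apply/subspace_continuousP => z Sz; apply: cvgM.
    by have [] := cont _ (d _ su) z Sz.
  by have [] := cont _ (spline_continuous sv) z Sz.
- apply/subspace_continuousP => z Sz; apply: cvgM.
    by have [] := cont _ (spline_continuous su) z Sz.
  by have [] := cont _ (d _ sv) z Sz.
- move=> j k; have [q qs uq] := su.2 j; have [q' qs' vq] := sv.2 k.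
  exists (EMul (EX q) (EY q')) => // z [z1 z2].
  have {}z1 : j%:R / n%:R <= z.1 <= j.+1%:R / n%:R by move: z1; rewrite /= in_itv.
  have {}z2 : k%:R / n%:R <= z.2 <= k.+1%:R / n%:R by move: z2; rewrite /= in_itv.
  rewrite /= !horner0 mulr0 mul0r addr0 add0r uq// vq//.
  by rewrite (spline_cell_deriv hn hr su uq)// (spline_cell_deriv hn hr sv vq).
Qed.

Lemma C1_expr0 : C1_expr (fun=> 0) (fun=> 0) (fun=> 0).
Proof.
split.
- by move=> z _; exact: cara_cst.
- by apply: continuous_subspaceT => z; exact: cvg_cst.
- by apply: continuous_subspaceT => z; exact: cvg_cst.
- by move=> j k; exists (EX 0) => // z _; rewrite /= deriv0 horner0.
Qed.

Lemma spline2_C1 f : spline2 p r n f -> C1_expr f (d1 f) (d2 f).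
Proof.
move=> [m [u [v [uv fE]]]].
have [f1 [f2 [cf c1 c2 ef]]] : exists f1 f2, C1_expr
    (fun z => \sum_(k < m) u k z.1 * v k z.2) f1 f2.
  elim: m u v uv {fE} => [|m IH] u v uv.
    exists (fun=> 0), (fun=> 0); have := C1_expr0.
    by congr C1_expr; apply/funext => z; rewrite big_ord0.
  have [f1 [f2 H]] := IH (fun k => u (widen_ord (leqnSn m) k))
    (fun k => v (widen_ord (leqnSn m) k)) (fun k => uv _).
  have [su sv] := uv ord_max.
  eexists; eexists; have := C1_exprD H (C1_expr_tensor su sv).
  rewrite [X in C1_expr X](_ : _ = (fun z => \sum_(k < m.+1) u k z.1 * v k z.2)).
    by apply.
  by apply/funext => z; rewrite big_ord_recr.
have cf' z : Sq z -> cara (@Sq R) f z (f1 z) (f2 z).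
  by move=> Sz; apply: cara_eq (cf z Sz) => // w Sw; rewrite fE.
have d1E z : Sq z -> d1 f z = f1 z by move=> Sz; exact: cara_d1 (cf' _ Sz).
have d2E z : Sq z -> d2 f z = f2 z by move=> Sz; exact: cara_d2 (cf' _ Sz).
have cc (h k : R * R -> R) : (forall z, Sq z -> h z = k z) ->
    {within @Sq R, continuous k} -> {within @Sq R, continuous h}.
  move=> hk /subspace_continuousP kc; apply/subspace_continuousP => z Sz.
  apply: (cvg_to_eq (esym (hk z Sz))).
  apply: near_cvg_eq (kc _ Sz).
  by rewrite near_withinE; apply: nearW => w /hk.
split.
- by move=> z Sz; rewrite d1E// d2E//; exact: cf'.
- exact: cc c1.
- exact: cc c2.
- move=> j k; have [e oe eE] := ef j k; exists e => // z cz.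
  have Sz := cell_Sq cz.
  by have [e0 e1 e2] := eE z cz; rewrite fE// d1E// d2E.
Qed.

Lemma spline2_rot f : spline2 p r n f -> spline2 p r n (f \o @rot R).
Proof.
move=> [m [u [v [uv fE]]]]; exists m, v, (fun k s => u k (1 - s)); split.
  by move=> k; have [su sv] := uv k; split => //; exact: spline_rev.
move=> z [z1 z2]; rewrite /= fE; last by split => //; apply/I01_rev.
by apply: eq_bigr => k _; rewrite /rot/= mulrC.
Qed.

Lemma spline2_lin f g (c : R) : spline2 p r n f -> spline2 p r n g ->
  spline2 p r n (fun z => c * f z + g z).
Proof.
move=> [m [u [v [uv fE]]]] [m' [u' [v' [uv' gE]]]].
have s0 : spline p r n (horner (0 : {poly R})).
  by apply: spline_poly; rewrite size_poly0.
exists (m + m')%N, (fun k s => match fintype.split k with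
  | inl i => c * u i s + (0 : {poly R}).[s] | inr i => u' i s end),
  (fun k => match fintype.split k with inl i => v i | inr i => v' i end); split.
- move=> k; case: fintype.split => i; last exact: uv'.
  by have [su sv] := uv i; split => //; exact: spline_lin.
- move=> z Sz; rewrite big_split_ord/= fE// gE// mulr_sumr; congr (_ + _).
  + apply: eq_bigr => k _; rewrite (_ : fintype.split _ = inl k) ?horner0 ?addr0 ?mulrA//.
    exact: (unsplitK (inl k)).
  + apply: eq_bigr => k _; rewrite (_ : fintype.split _ = inr k)//.
    exact: (unsplitK (inr k)).
Qed.

End TensorSplines.

Section VectorValued.
Variables (R : realType) (G : R * R -> R * R).

Lemma is_deriv01_pair (u v : R -> R) s a b : is_deriv01 u s a ->
  is_deriv01 v s b -> is_deriv01 (fun t => (u t, v t)) s (a, b).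
Proof. by move=> ua vb; exact: cvg_pair ua vb. Qed.

Lemma d1_pair z a b a' b' : Sq z -> cara (@Sq R) (fst \o G) z a b ->
  cara (@Sq R) (snd \o G) z a' b' -> d1 G z = (a, a').
Proof.
move=> [z1 z2] c1 c2; apply: deriv01_eq => //.
have -> : (fun s => G (s, z.2)) = (fun s => ((fst \o G) (s, z.2), (snd \o G) (s, z.2))).
  by apply/funext => s /=; case: (G _).
have line t : I01 t -> Sq (t, z.2) by split.
by apply: is_deriv01_pair; apply/is_deriv01P;
  [exact: cara_line1 line c1|exact: cara_line1 line c2].
Qed.

Lemma d2_pair z a b a' b' : Sq z -> cara (@Sq R) (fst \o G) z a b ->
  cara (@Sq R) (snd \o G) z a' b' -> d2 G z = (b, b').
Proof.
move=> [z1 z2] c1 c2; apply: deriv01_eq => //.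
have -> : (fun s => G (z.1, s)) = (fun s => ((fst \o G) (z.1, s), (snd \o G) (z.1, s))).
  by apply/funext => s /=; case: (G _).
have line t : I01 t -> Sq (z.1, t) by split.
by apply: is_deriv01_pair; apply/is_deriv01P;
  [exact: cara_line2 line c1|exact: cara_line2 line c2].
Qed.

Lemma pair_continuous (A : set (R * R)) : {within A, continuous (fst \o G)} ->
  {within A, continuous (snd \o G)} -> {within A, continuous G}.
Proof.
move=> /subspace_continuousP c1 /subspace_continuousP c2.
apply/subspace_continuousP => z Az.
apply: (@near_cvg_eq _ _ _ _ _ (fun w => ((fst \o G) w, (snd \o G) w))).
  by apply: filterE => w /=; exact: surjective_pairing.
apply: (@cvg_to_eq _ _ _ _ ((fst \o G) z, (snd \o G) z)).
  by rewrite /= -surjective_pairing.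
exact: cvg_pair (c1 _ Az) (c2 _ Az).
Qed.

End VectorValued.

(** * Gluing across patches *)

Section CaraUnion.
Variables (R : realType) (I : finType).

(** The slope functions may disagree on overlaps, so [sel] takes at each point those of some set
    containing it. Finiteness of [I] allows the neighbourhoods to be intersected. *)
Lemma cara_bigcup (S : I -> set (R * R)) (f : R * R -> R) z a b :
  (forall i, cara (S i) f z a b) -> cara (\bigcup_i S i) f z a b.
Proof.
move=> /choice[P /choice[Q PQ]].
pose sel (g : I -> R * R -> R) w :=
  if pselect (exists i, S i w) is left e then g (projT1 (cid e)) w else 0.
have selP g (B : R -> R * R -> Prop) :
    (forall i, \forall w \near within (S i) (nbhs z), B (g i w) w) ->
    \forall w \near within (\bigcup_i S i) (nbhs z), B (sel g w) w.
  move=> H; rewrite near_withinE.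
  have H' := filter_forall (nbhs_filter z) H.
  apply: filterS H' => w H' [i _ Siw]; rewrite /sel; case: pselect => [e|[]].
    by case: (cid e) => j Sjw /=; exact: H'.
  by exists i.
exists (sel P), (sel Q); split.
- move=> U Ua; apply: (selP P (fun y _ => U y)) => i.
  by have [pa _ _] := PQ i; exact: pa.
- move=> U Ua; apply: (selP Q (fun y _ => U y)) => i.
  by have [_ qb _] := PQ i; exact: qb.
- rewrite near_withinE.
  have H : forall i, \forall w \near nbhs z, S i w -> f w - f z =
      P i w * (w.1 - z.1) + Q i w * (w.2 - z.2).
    by move=> i; have [_ _] := PQ i; rewrite near_withinE.
  have H' := filter_forall (nbhs_filter z) H.
  apply: filterS H' => w H' [i _ Siw]; rewrite /sel; case: pselect => [e|[]].
    by case: (cid e) => j Sjw /=; exact: H'.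
  by exists i.
Qed.

End CaraUnion.

Section Gluing.
Variables (R : realType) (p r n : nat) (I : finType).
Variables (Omega : set (R * R)) (F : I -> R * R -> R * R).
Hypotheses (hr : (1 <= r)%N) (hn : (1 <= n)%N).
Hypothesis Oopen : open Omega.
Hypothesis Ocover : closure Omega = \bigcup_i cpatch F i.
Hypothesis Finj : forall i, {in @Sq R &, injective (F i)}.
Hypothesis Fspline : forall i, spline2 p r n (fst \o F i) /\
  spline2 p r n (snd \o F i).

Definition jac i z : R := d1 (fst \o F i) z * d2 (snd \o F i) z -
  d2 (fst \o F i) z * d1 (snd \o F i) z.

Hypothesis Fjac : forall i z, Sq z -> jac i z != 0.

Lemma Fcont i : {within @Sq R, continuous (F i)}.
Proof.
have [/(spline2_C1 hr hn)[c1 _ _ _] /(spline2_C1 hr hn)[c2 _ _ _]] := Fspline i.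
apply: pair_continuous; apply/subspace_continuousP => z Sz.
  exact: cara_cvg (c1 _ Sz).
exact: cara_cvg (c2 _ Sz).
Qed.

Lemma cpatch_closed i : closed (cpatch F i).
Proof.
apply: (image_closed (@Fcont i)) => //.
exact: (compact_closed (@prod_hausdorff R) (@Sq_compact R)).
Qed.

(** A closed patch that misses [z] also misses a neighbourhood of [z], and there are finitely many
    patches. *)
Lemma near_cpatch z (P : R * R -> Prop) :
  (forall i s, Sq s -> F i s = z ->
    \forall w \near within (cpatch F i) (nbhs z), P w) ->
  \forall w \near within (closure Omega) (nbhs z), P w.
Proof.
move=> H; rewrite near_withinE Ocover.
have H1 : forall i, \forall w \near nbhs z, cpatch F i w -> P w.
  move=> i; have [[s Ss Fs]|nz] := pselect (cpatch F i z); first exact: H Fs.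
  have : nbhs z (~` cpatch F i).
    by apply: open_nbhs_nbhs; split => //; apply: closed_openC; exact: cpatch_closed.
  by apply: filterS.
have H2 := filter_forall (nbhs_filter z) H1.
by apply: filterS H2 => w H2 [i _]; exact: H2.
Qed.

Definition compatible (h : I -> R * R -> R) :=
  forall i j s t, Sq s -> Sq t -> F i s = F j t -> h i s = h j t.

Definition paste (h : I -> R * R -> R) (z : R * R) : R :=
  if pselect (exists it : I * (R * R), Sq it.2 /\ F it.1 it.2 = z) is left e
  then h (projT1 (cid e)).1 (projT1 (cid e)).2 else 0.

Lemma pasteE h i s : compatible h -> Sq s -> paste h (F i s) = h i s.
Proof.
move=> hc Ss; rewrite /paste; case: pselect => [e|[]].
  by case: (cid e) => -[j t] /= [St Ft]; exact: hc.
by exists (i, s).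
Qed.

Lemma paste_out h z : ~ closure Omega z -> paste h z = 0.
Proof.
move=> nz; rewrite /paste; case: pselect => // -[[i s] /= [Ss Fs]]; case: nz.
by rewrite Ocover; exists i => //; exists s.
Qed.

Lemma paste_continuous h : compatible h ->
  (forall i, {within @Sq R, continuous (h i)}) ->
  {within closure Omega, continuous (paste h)}.
Proof.
move=> hc cont; apply/subspace_continuousP => z _ U HU.
apply: near_cpatch => i s Ss Fs.
have HU' : nbhs (h i s) U by rewrite -(pasteE i hc Ss) Fs.
rewrite -Fs; apply: (push_cvg (@Fcont i) (@Finj i) (fun _ => id) Ss (h := paste h)
  (v := h i) _ _ HU').
  by move=> t St; rewrite pasteE.
by move: (cont i) => /subspace_continuousP; exact.
Qed.

Lemma spline2_eq (f g : R * R -> R) : (forall z, Sq z -> f z = g z) -> spline2 p r n f ->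
  spline2 p r n g.
Proof.
move=> fg [m [u [v [uv fE]]]]; exists m, u, v; split => // z Sz.
by rewrite -fg// fE.
Qed.

Section Function.
Variable u : I -> R * R -> R.
Hypothesis uspline : forall i, spline2 p r n (u i).

(** With [grad2], the physical gradient: the chain rule through the chart solved by Cramer's
    rule. *)
Definition grad1 i z : R := (d1 (u i) z * d2 (snd \o F i) z -
  d2 (u i) z * d1 (snd \o F i) z) / jac i z.
Definition grad2 i z : R := (d2 (u i) z * d1 (fst \o F i) z -
  d1 (u i) z * d2 (fst \o F i) z) / jac i z.

Hypothesis ucompat : compatible u.
Hypothesis g1compat : compatible grad1.
Hypothesis g2compat : compatible grad2.

Lemma grad_continuous i : {within @Sq R, continuous (grad1 i)} /\
  {within @Sq R, continuous (grad2 i)}.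
Proof.
have [/(spline2_C1 hr hn)[_ c11 c12 _] /(spline2_C1 hr hn)[_ c21 c22 _]] := Fspline i.
have [_ c1 c2 _] := spline2_C1 hr hn (uspline i).
have k f z : Sq z -> {within @Sq R, continuous f} ->
    f @ within (@Sq R) (nbhs z) --> (f z : R).
  by move=> Sz /subspace_continuousP; exact.
have J z : Sq z -> (fun w => (jac i w)^-1) @ within (@Sq R) (nbhs z) --> (jac i z)^-1.
  move=> Sz; apply: cvgV; first exact: Fjac.
  exact: (cvgB (cvgM (k _ _ Sz c11) (k _ _ Sz c22)) (cvgM (k _ _ Sz c12) (k _ _ Sz c21))).
split; apply/subspace_continuousP => z Sz.
  exact: (cvgM (cvgB (cvgM (k _ _ Sz c1) (k _ _ Sz c22))
    (cvgM (k _ _ Sz c2) (k _ _ Sz c21))) (J z Sz)).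
exact: (cvgM (cvgB (cvgM (k _ _ Sz c2) (k _ _ Sz c11))
  (cvgM (k _ _ Sz c1) (k _ _ Sz c12))) (J z Sz)).
Qed.

Lemma paste_cara i s : Sq s ->
  cara (cpatch F i) (paste u) (F i s) (grad1 i s) (grad2 i s).
Proof.
move=> Ss.
have [/(spline2_C1 hr hn)[c1 _ _ _] /(spline2_C1 hr hn)[c2 _ _ _]] := Fspline i.
have [c _ _ _] := spline2_C1 hr hn (uspline i).
apply: (push_cara (@Fcont i) (@Finj i) (fun _ => id) Ss Ss (h := paste u) _ (c1 _ Ss) (c2 _ Ss)
  (c _ Ss)); last exact: Fjac.
by move=> t St; rewrite pasteE.
Qed.

Lemma paste_V1 : V1 p r n Omega F (paste u).
Proof.
have uc i : {within @Sq R, continuous (u i)}.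
  have [c _ _ _] := spline2_C1 hr hn (uspline i).
  by apply/subspace_continuousP => z Sz; exact: cara_cvg (c _ Sz).
split; first split.
- by move=> z; exact: paste_out.
- exact: paste_continuous.
- move=> i; apply: spline2_eq (uspline i) => z Sz; by rewrite /= pasteE.
exists (paste grad1), (paste grad2); split.
- by apply: paste_continuous => // i; have [] := grad_continuous i.
- by apply: paste_continuous => // i; have [] := grad_continuous i.
move=> z Oz.
have zc : nbhs z (\bigcup_i cpatch F i).
  rewrite -Ocover; apply: filterS (@subset_closure _ Omega) _.
  exact: open_nbhs_nbhs.
apply: (cara_is_derive zc); apply: cara_bigcup => i.
have [[s Ss <-]|nz] := pselect (cpatch F i z).
  by rewrite !pasteE//; exact: paste_cara.
(* The patch misses [z], so the increment condition is vacuous near [z] and constant slopes with the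
   right limits serve. *)
exists (fun=> paste grad1 z), (fun=> paste grad2 z).
split; [exact: cvg_cst|exact: cvg_cst|].
have : nbhs z (~` cpatch F i).
  by apply: open_nbhs_nbhs; split => //; apply: closed_openC; exact: cpatch_closed.
by rewrite near_withinE; apply: filterS.
Qed.

End Function.

End Gluing.

(** * Derivatives at the vertex *)

Section ChainRule.
Variable R : realType.
Implicit Types (e : expr R) (z : R * R).

Definition eq_jet1 z e e' := ev e z = ev e' z /\ forall b, ev (D b e) z = ev (D b e') z.
Definition eq_jet2 z e e' := eq_jet1 z e e' /\ forall b, eq_jet1 z (D b e) (D b e').

Variables (A1 A2 : expr R).

Definition EJ := EAdd (EMul (D false A1) (D true A2))
  (EMul (EC (-1)) (EMul (D true A1) (D false A2))).

(* If [f o (A1, A2) = e], then [(partial b f) o (A1, A2) = pull b e]. *)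
Definition pull (b : bool) (e : expr R) :=
  EMul (if b then EAdd (EMul (D true e) (D false A1))
                       (EMul (EC (-1)) (EMul (D false e) (D true A1)))
        else EAdd (EMul (D false e) (D true A2))
                  (EMul (EC (-1)) (EMul (D true e) (D false A2)))) (EInv EJ).

Lemma pull_eq z e e' b : eq_jet1 z e e' -> ev (pull b e) z = ev (pull b e') z.
Proof. by move=> [_ ee]; case: b; rewrite /= !ee. Qed.

(** A physical derivative involves only first parametric derivatives of [e], besides the chart;
    hence the physical 2-jet depends only on the parametric 2-jet. *)
Lemma pull_eq_jet1 z e e' b : eq_jet2 z e e' -> eq_jet1 z (pull b e) (pull b e').
Proof.
move=> [[e0 e1] e2]; split; first by apply: pull_eq.
by move=> c; case: b; rewrite /= !e1 !(proj2 (e2 _)).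
Qed.

Hypotheses (A1ok : forall z, ok A1 z) (A2ok : forall z, ok A2 z).

Lemma ok_pull b e z : ok e z -> ev EJ z != 0 -> ok (pull b e) z.
Proof. by move=> oe J0; case: b; rewrite /= !ok_D. Qed.

Lemma ok_foldr w e z : ok e z -> ev EJ z != 0 -> ok (foldr pull e w) z.
Proof. by move=> oe J0; elim: w => //= b w IH; exact: ok_pull. Qed.

End ChainRule.

Section Quadratic.
Variable R : realType.

Definition quad (c : R * R * R * (R * R * R)) (X Y : expr R) : expr R :=
  EAdd (EAdd (EC c.1.1.1) (EAdd (EMul (EC c.1.1.2) X) (EMul (EC c.1.2) Y)))
    (EAdd (EMul (EC c.2.1.1) (EMul X X)) (EAdd (EMul (EC c.2.1.2) (EMul X Y))
      (EMul (EC c.2.2) (EMul Y Y)))).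

Lemma ok_quad c X Y z : ok X z -> ok Y z -> ok (quad c X Y) z.
Proof. by move=> /= -> ->. Qed.

Definition Qat c (x : R * R) :=
  quad c (EX ('X - x.1%:P)) (EY ('X - x.2%:P)).

Definition shift1 (x : R) (A : expr R) := EAdd A (EC (- x)).

Lemma ev_quad c (x s y : R * R) A1 A2 : ev A1 s = y.1 -> ev A2 s = y.2 ->
  ev (quad c (shift1 x.1 A1) (shift1 x.2 A2)) s = ev (Qat c x) y.
Proof.
by move=> /= -> ->; rewrite ?(hornerC, hornerD, hornerN, hornerX).
Qed.

Definition jet_coef (c : R * R * R * (R * R * R)) (m1 m2 : nat) : R :=
  match m1, m2 with
  | 0%N, 0%N => c.1.1.1 | 1%N, 0%N => c.1.1.2 | 0%N, 1%N => c.1.2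
  | 2%N, 0%N => c.2.1.1 *+ 2 | 1%N, 1%N => c.2.1.2 | 0%N, 2%N => c.2.2 *+ 2
  | _, _ => 0
  end.

Definition word (m1 m2 : nat) := nseq m1 false ++ nseq m2 true.

Lemma Qat_jet c x m1 m2 : (m1 + m2 <= 2)%N ->
  ev (foldr (@D R) (Qat c x) (word m1 m2)) x = jet_coef c m1 m2.
Proof.
case: m1 => [|[|[|m1]]]; case: m2 => [|[|[|m2]]] //= _;
  rewrite ?(derivC, derivB, derivX, deriv0, subr0);
  rewrite ?(hornerC, hornerD, hornerN, hornerX, horner0); ring.
Qed.

End Quadratic.

(** * Physical derivatives on mesh elements and their limits at the vertex *)

Section VertexJets.
Variables (R : realType) (p r n : nat) (I : finType).
Variables (Omega : set (R * R)) (F : I -> R * R -> R * R).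
Hypotheses (hr : (1 <= r)%N) (hn : (1 <= n)%N).
Hypothesis Ocover : closure Omega = \bigcup_i cpatch F i.
Hypothesis Popen : forall i, open (patch F i).
Hypothesis Finj : forall i, {in @Sq R &, injective (F i)}.
Hypothesis Fspline : forall i, spline2 p r n (fst \o F i) /\
  spline2 p r n (snd \o F i).
Hypothesis Fjac : forall i z, Sq z -> jac F i z != 0.

Let Fc := Fcont hr hn Fspline.

Definition ocell (j k : 'I_n) : set (R * R) :=
  [set` `]j%:R / n%:R, j.+1%:R / n%:R[] `*`
  [set` `]k%:R / n%:R, k.+1%:R / n%:R[].

Lemma ocell_cell j k : ocell j k `<=` cell j k.
Proof.
move=> z []; rewrite /= !in_itv/= => /andP[a b] /andP[c d].
by split; rewrite /= in_itv/= !ltW.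
Qed.

Lemma ocell_Sq j k : ocell j k `<=` @Sq R.
Proof. by move=> z /ocell_cell; exact: cell_Sq. Qed.

Lemma ocell_Sqo j k : ocell j k `<=` @Sqo R.
Proof.
have n0 : (0 : R) < n%:R by rewrite ltr0n.
have H (l : 'I_n) (t : R) : l%:R / n%:R < t < l.+1%:R / n%:R -> 0 < t < 1.
  move=> /andP[a b]; rewrite (le_lt_trans _ a) ?cell_ge0//=.
  by rewrite (lt_le_trans b)// cell_le1.
move=> z []; rewrite /= !in_itv/= => /H a /H b.
by split; rewrite /I01o/= in_itv.
Qed.

Lemma ocell_open j k : open (ocell j k).
Proof.
have -> : ocell j k = (fst @^-1` [set` `]j%:R / n%:R, (j.+1%:R / n%:R : R)[]) `&`
  (snd @^-1` [set` `]k%:R / n%:R, (k.+1%:R / n%:R : R)[]) by [].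
by apply: openI; apply: open_comp; try exact: interval_open;
  move=> z _; [exact: cvg_fst|exact: cvg_snd].
Qed.

(** By injectivity the element is the open patch minus the image of the remaining parameters, and
    that image is closed by compactness. *)
Lemma elt_open i (j k : 'I_n) : open (elt F i j k).
Proof.
have -> : elt F i j k = patch F i `&` ~` (F i @` (@Sq R `\` ocell j k)).
  apply/seteqP; split => [z [s Os <-]|z [[s Ss <-] ns]].
    split; first by exists s => //; exact: ocell_Sqo Os.
    move=> [t [St Ot] /Finj]; rewrite !inE => /(_ St (ocell_Sq Os)) ts.
    by apply: Ot; rewrite ts.
  exists s => //; apply: contrapT => Os; apply: ns; exists s => //; split => //.
  by case: Ss => a b; split; [move: a|move: b]; rewrite /I01o /I01/= !in_itv/=;
    move=> /andP[/ltW -> /ltW ->].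
apply: openI => //; apply: closed_openC; apply: (image_closed (@Fc i)).
  apply: closedI; first exact: (compact_closed (@prod_hausdorff R) (@Sq_compact R)).
  by apply: open_closedC; exact: ocell_open.
by move=> s [].
Qed.

Section OneElement.
Variables (i : I) (j k : 'I_n) (A1 A2 : expr R).
Hypotheses (A1ok : forall z, ok A1 z) (A2ok : forall z, ok A2 z).
Hypothesis A1E : forall z, cell j k z -> [/\ (fst \o F i) z = ev A1 z,
  d1 (fst \o F i) z = ev (D false A1) z & d2 (fst \o F i) z = ev (D true A1) z].
Hypothesis A2E : forall z, cell j k z -> [/\ (snd \o F i) z = ev A2 z,
  d1 (snd \o F i) z = ev (D false A2) z & d2 (snd \o F i) z = ev (D true A2) z].

Lemma EJ_neq0 z : cell j k z -> ev (EJ A1 A2) z != 0.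
Proof.
move=> cz; have := Fjac i (cell_Sq hn cz); rewrite /jac.
have [_ -> ->] := A1E cz; have [_ -> ->] := A2E cz.
by rewrite /= hornerC mulN1r.
Qed.

(** The open element is a neighbourhood of each of its points, so the gradient relative to it is the
    classical one, and Cramer's quotients are the values of [pull]. *)
Lemma partial_pull h e : (forall z, ok e z) \/ (forall z, cell j k z -> ok e z) ->
  (forall s, ocell j k s -> h (F i s) = ev e s) -> forall s, ocell j k s ->
  differentiable h (F i s) /\
  forall b, partial b h (F i s) = ev (pull A1 A2 b e) s.
Proof.
move=> oe he s Os; have cs := ocell_cell Os.
have oes : ok e s by case: oe => [->|->].
have nb : nbhs (F i s) (F i @` ocell j k).
  by apply: open_nbhs_nbhs; split; [exact: elt_open|exists s].
have c1 : cara (ocell j k) (fst \o F i) s (ev (D false A1) s) (ev (D true A1) s).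
  apply: (@cara_eq _ _ (ev A1)) => //; last exact: cara_ev.
  by move=> w /ocell_cell /A1E[].
have c2 : cara (ocell j k) (snd \o F i) s (ev (D false A2) s) (ev (D true A2) s).
  apply: (@cara_eq _ _ (ev A2)) => //; last exact: cara_ev.
  by move=> w /ocell_cell /A2E[].
have J0 : ev (D false A1) s * ev (D true A2) s - ev (D true A1) s * ev (D false A2) s != 0.
  by have := EJ_neq0 cs; rewrite /= hornerC mulN1r.
have := push_cara (@Fc i) (@Finj i) (@ocell_Sq j k) (ocell_Sq Os) (h := h) Os he c1 c2
  (cara_ev _ oes) J0.
move=> ch; split; first exact: cara_differentiable nb ch.
have [d1 d2] := cara_is_derive nb ch.
by case; rewrite /partial/= derive_val hornerC !mulN1r.
Qed.

Lemma partials_pull h e w : (forall z, ok e z) ->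
  (forall s, ocell j k s -> h (F i s) = ev e s) -> forall s, ocell j k s ->
  differentiable (partials w h) (F i s) /\
  partials w h (F i s) = ev (foldr (pull A1 A2) e w) s.
Proof.
move=> oe he.
have okw v z : cell j k z -> ok (foldr (pull A1 A2) e v) z.
  by move=> cz; apply: ok_foldr => //; exact: EJ_neq0.
have pE v : forall s, ocell j k s -> partials v h (F i s) = ev (foldr (pull A1 A2) e v) s.
  elim: v => [|b v IH] s Os; first exact: he.
  by have [_ H] := @partial_pull _ _ (or_intror (okw v)) IH s Os; exact: H.
move=> s Os; split; last exact: pE.
by have [] := @partial_pull _ _ (or_intror (okw w)) (pE w) s Os.
Qed.

(** The expression valid on the open cell is continuous up to the closed one, since the Jacobian has
    no zero there. *)
Lemma partials_cvg h e w s : (forall z, ok e z) ->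
  (forall s, ocell j k s -> h (F i s) = ev e s) -> cell j k s ->
  partials w h @ within (elt F i j k) (nbhs (F i s)) -->
    ev (foldr (pull A1 A2) e w) s.
Proof.
move=> oe he cs.
apply: (push_cvg (@Fc i) (@Finj i) (@ocell_Sq j k) (cell_Sq hn cs)
  (v := ev (foldr (pull A1 A2) e w))).
  by move=> t Ot; have [] := partials_pull w oe he Ot.
by apply: ev_cvg; apply: ok_foldr => //; exact: EJ_neq0.
Qed.

End OneElement.

Definition corner_idx : 'I_n := Ordinal hn.

Lemma corner_cell : cell corner_idx corner_idx (0 : R, 0 : R).
Proof. by split; rewrite /= in_itv/= mul0r lexx/= mul1r invr_ge0. Qed.

Lemma corner_proper :
  ProperFilter (within (ocell corner_idx corner_idx) (nbhs (0 : R, 0 : R))).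
Proof.
apply: Build_ProperFilter_ex => P HP.
have /nbhs_ballP[e /= e0 H] : nbhs (0 : R, 0 : R) [set w | ocell corner_idx corner_idx w -> P w] := HP.
have n0 : (0 : R) < n%:R by rewrite ltr0n.
pose t := Num.min (e / 2) (n%:R^-1 / 2).
have t0 : 0 < t by rewrite lt_min !divr_gt0// invr_gt0.
exists (t, t); apply: H.
  have te : t < e by rewrite /t gt_min (_ : e / 2 < e)//; lra.
  by split; rewrite -ball_normE /ball_/= sub0r normrN gtr0_norm.
have tn : t < n%:R^-1.
  have n1 : (0 : R) < n%:R^-1 by rewrite invr_gt0.
  by rewrite /t gt_min [X in _ || X](_ : _ = true) ?orbT//; lra.
by split; rewrite /= in_itv/= mul0r t0 mul1r.
Qed.

Variable x : R * R.
Hypothesis Fx : forall i, cpatch F i x -> F i (0, 0) = x.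
Hypothesis xP : exists i, cpatch F i x.

(** The image of the open corner cell accumulates at [x], so limits along [elts] are unique. *)
Lemma elts_proper : ProperFilter (within (elts n F) (nbhs x)).
Proof.
apply: Build_ProperFilter_ex => P HP; have [i ix] := xP.
have S0 : Sq (0 : R, 0 : R) by exact: cell_Sq corner_cell.
have {}HP : nbhs (F i (0, 0)) [set w | elts n F w -> P w] by rewrite Fx.
have /subspace_continuousP /(_ _ S0 _ HP) H := @Fc i.
have H' : within (ocell corner_idx corner_idx) (nbhs (0 : R, 0 : R)) [set s | ocell corner_idx corner_idx s /\
    (elts n F (F i s) -> P (F i s))].
  have {}H : nbhs (0 : R, 0 : R) [set s | Sq s -> elts n F (F i s) -> P (F i s)] := H.
  change (nbhs (0 : R, 0 : R) [set s | ocell corner_idx corner_idx s -> ocell corner_idx corner_idx s /\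
    (elts n F (F i s) -> P (F i s))]).
  by apply: filterS H => s H Os; split => //; apply: H; exact: ocell_Sq Os.
have [s [Os Ps]] := @filter_ex _ _ corner_proper _ H'.
by exists (F i s); apply: Ps; exists i, corner_idx, corner_idx, s.
Qed.

Variables (u : I -> R * R -> R) (phi : R * R -> R).
Hypothesis uspline : forall i, spline2 p r n (u i).
Hypothesis phiE : forall i s, Sq s -> phi (F i s) = u i s.
Hypothesis phi_out : fun_on_closure Omega phi.
Hypothesis phi_cont : {within closure Omega, continuous phi}.

Variable c : R * R * R * (R * R * R).
Hypothesis ujet : forall i, cpatch F i x -> exists e A1 A2 : expr R,
  [/\ [/\ forall z, ok e z, forall z, ok A1 z & forall z, ok A2 z],
      forall z, cell corner_idx corner_idx z -> [/\ u i z = ev e z,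
        (F i z).1 = ev A1 z & (F i z).2 = ev A2 z]
    & eq_jet2 (0, 0) e (quad c (shift1 x.1 A1) (shift1 x.2 A2))].

Lemma vertex_smooth : piecewise_smooth n F phi.
Proof.
move=> i j k w.
have [/(spline2_C1 hr hn)[_ _ _ /(_ j k)[A1 A1ok A1E]]] := Fspline i.
move=> /(spline2_C1 hr hn)[_ _ _ /(_ j k)[A2 A2ok A2E]].
have [_ _ _ /(_ j k)[e oe eE]] := spline2_C1 hr hn (uspline i).
have he s : ocell j k s -> phi (F i s) = ev e s.
  move=> Os; rewrite phiE; last exact: ocell_Sq Os.
  by case: (eE _ (ocell_cell Os)).
split => [z [s Os <-]|z [s cs <-]].
  by have [] := partials_pull A1ok A2ok A1E A2E w oe he Os.
apply/cvg_ex; exists (ev (foldr (pull A1 A2) e w) s).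
exact: (@partials_cvg _ _ _ _ _ A1ok A2ok A1E A2E _ _ w s oe he cs).
Qed.

Lemma partials_Qat w z : differentiable (partials w (ev (Qat c x))) z /\
  partials w (ev (Qat c x)) z = ev (foldr (@D R) (Qat c x) w) z.
Proof.
have okD v y : ok (foldr (@D R) (Qat c x) v) y.
  by elim: v => //= b v IH; exact: ok_D.
have cD v y : cara setT (ev (foldr (@D R) (Qat c x) v)) y
    (ev (D false (foldr (@D R) (Qat c x) v)) y)
    (ev (D true (foldr (@D R) (Qat c x) v)) y).
  by apply: cara_ev; exact: okD.
have pE v : partials v (ev (Qat c x)) = ev (foldr (@D R) (Qat c x) v).
  elim: v => // b v IH; apply/funext => y; rewrite /= -/(partials v _) IH.
  have [h1 h2] := cara_is_derive filterT (cD v y).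
  by rewrite /partial; case: b; rewrite derive_val.
by rewrite pE; split => //; exact: (cara_differentiable filterT (cD w z)).
Qed.

Lemma foldr_pull_eq (A1 A2 e e' : expr R) w z : (size w <= 2)%N -> eq_jet2 z e e' ->
  ev (foldr (pull A1 A2) e w) z = ev (foldr (pull A1 A2) e' w) z.
Proof.
case: w => [_ [[]]//|b [_ [ee _]|b' [_ ee|//]]]; first exact: pull_eq.
by apply: pull_eq; exact: pull_eq_jet1.
Qed.

(** The limit depends only on the parametric 2-jet, so [e] may be replaced by the pullback of the
    polynomial. Its derivatives are then evaluated by computing one limit twice: once by continuity
    of the expression, once by continuity of the derivatives of the polynomial at [x]. No second
    order chain rule is expanded. *)
Lemma corner_cvg i w : cpatch F i x -> (size w <= 2)%N ->
  partials w phi @ within (elt F i corner_idx corner_idx) (nbhs x) -->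
    ev (foldr (@D R) (Qat c x) w) x.
Proof.
move=> ix w2; have [e [A1 [A2 [[oe A1ok A2ok] eE ee]]]] := ujet ix.
have [/(spline2_C1 hr hn)[cc1 _ _ _]] := Fspline i.
move=> /(spline2_C1 hr hn)[cc2 _ _ _].
(* [A1], [A2] are known to represent the chart only by value; [B1], [B2] come with matching first
   derivatives as well, as [pull] requires. *)
have [/(spline2_C1 hr hn)[_ _ _ /(_ corner_idx corner_idx)[B1 B1ok B1E]]] := Fspline i.
move=> /(spline2_C1 hr hn)[_ _ _ /(_ corner_idx corner_idx)[B2 B2ok B2E]].
have S0 : Sq (0 : R, 0 : R) by exact: cell_Sq corner_cell.
have he s : ocell corner_idx corner_idx s -> phi (F i s) = ev e s.
  move=> Os; rewrite phiE; last exact: ocell_Sq Os.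
  by case: (eE _ (ocell_cell Os)).
have hq s : cell corner_idx corner_idx s -> ev (Qat c x) (F i s) =
    ev (quad c (shift1 x.1 A1) (shift1 x.2 A2)) s.
  by move=> /eE[_ a1 a2]; rewrite (@ev_quad _ c x s (F i s)).
have oq s : ok (quad c (shift1 x.1 A1) (shift1 x.2 A2)) s.
  by apply: ok_quad; rewrite /= ?A1ok ?A2ok.
have qE s : ocell corner_idx corner_idx s -> ev (Qat c x) (F i s) =
    ev (quad c (shift1 x.1 A1) (shift1 x.2 A2)) s.
  by move=> /ocell_cell; exact: hq.
have PF := corner_proper.
have key : ev (foldr (pull B1 B2) e w) (0, 0) = ev (foldr (@D R) (Qat c x) w) x.
  rewrite (foldr_pull_eq _ _ w2 ee).
  pose g := ev (foldr (pull B1 B2) (quad c (shift1 x.1 A1) (shift1 x.2 A2)) w).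
  have l1 : g @ within (ocell corner_idx corner_idx) (nbhs (0, 0)) --> g (0, 0).
    apply: ev_cvg; apply: ok_foldr => //.
    exact: (EJ_neq0 B1E B2E) corner_cell.
  have l2 : g @ within (ocell corner_idx corner_idx) (nbhs (0, 0)) -->
      ev (foldr (@D R) (Qat c x) w) (F i (0, 0)).
    apply: (@near_cvg_eq _ _ _ _ _ (fun s => partials w (ev (Qat c x)) (F i s))).
      near=> s.
      have Os : ocell corner_idx corner_idx s by near: s; exact: near_within_self.
      by have [_ ->] := partials_pull B1ok B2ok B1E B2E w oq qE Os.
    have [dQ QE] := partials_Qat w (F i (0, 0)).
    apply: (cvg_to_eq QE).
    apply: (@cvg_comp _ _ _ (F i) (partials w (ev (Qat c x))) _ (nbhs (F i (0, 0)))).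
      have /subspace_continuousP/(_ _ S0) := @Fc i.
      by apply: cvg_within_sub; exact: ocell_Sq.
    exact: differentiable_continuous.
  have E : g (0, 0) = ev (foldr (@D R) (Qat c x) w) (F i (0, 0)).
    exact: (within_cvg_unique l1 l2).
  by rewrite (Fx ix) in E.
rewrite -key -(Fx ix).
exact: (@partials_cvg _ _ _ _ _ B1ok B2ok B1E B2E _ _ w _ oe he corner_cell).
Unshelve. all: by end_near. Qed.

Lemma celt_closed i (j k : 'I_n) : closed (celt F i j k).
Proof.
apply: (image_closed (@Fc i)); last exact: cell_Sq.
have -> : ([set` `[j%:R / n%:R, j.+1%:R / n%:R]] `*`
    [set` `[k%:R / n%:R, k.+1%:R / n%:R]]) =
    (fst @^-1` [set` `[j%:R / n%:R, (j.+1%:R / n%:R : R)]]) `&`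
    (snd @^-1` [set` `[k%:R / n%:R, (k.+1%:R / n%:R : R)]]) by [].
by apply: closedI; apply: closed_comp; try exact: interval_closed;
  move=> z _; [exact: cvg_fst|exact: cvg_snd].
Qed.

Lemma celt_vertex i (j k : 'I_n) : celt F i j k x -> [/\ cpatch F i x, j = corner_idx & k = corner_idx].
Proof.
move=> [s cs Fs]; have Ss := cell_Sq hn cs.
have ix : cpatch F i x by exists s.
have S0 : Sq (0 : R, 0 : R) by exact: cell_Sq corner_cell.
have s0 : s = (0, 0) by apply: (@Finj i); rewrite ?inE// Fs Fx.
have n0 : (0 : R) < n%:R by rewrite ltr0n.
move: cs; rewrite s0 => -[/=]; rewrite !in_itv/= => /andP[j0 _] /andP[k0 _].
split => //; apply/val_inj/eqP => /=; rewrite -leqn0 -(ler_nat R).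
  by move: j0; rewrite ler_pdivrMr// mul0r.
by move: k0; rewrite ler_pdivrMr// mul0r.
Qed.

Lemma vertex_cvg m1 m2 : (m1 + m2 <= 2)%N ->
  pderiv m1 m2 phi @ within (elts n F) (nbhs x) --> jet_coef c m1 m2.
Proof.
move=> m12; have pE : pderiv m1 m2 phi = partials (word m1 m2) phi.
  rewrite /pderiv /word /partials foldr_cat.
  have nE m b h : foldr (@partial R) h (nseq m b) = iter m (@partial R b) h.
    by elim: m => //= m ->.
  by rewrite !nE.
rewrite pE -(Qat_jet c x m12).
have sw : (size (word m1 m2) <= 2)%N by rewrite size_cat !size_nseq.
move=> U HU; change (nbhs x [set w | elts n F w -> U (partials (word m1 m2) phi w)]).
have H i (j k : 'I_n) : \forall w \near nbhs x, elt F i j k w -> U (partials (word m1 m2) phi w).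
  have [cx|ncx] := pselect (celt F i j k x).
    have [ix -> ->] := celt_vertex cx; exact: (corner_cvg ix sw HU).
  have : nbhs x (~` celt F i j k).
    by apply: open_nbhs_nbhs; split => //; apply: closed_openC; exact: celt_closed.
  apply: filterS => w nw ew; case: nw; case: ew => s Os <-; exists s => //.
  exact: ocell_cell Os.
have H1 i (j : 'I_n) := filter_forall (nbhs_filter x) (H i j).
have H2 i := filter_forall (nbhs_filter x) (H1 i).
have H3 := filter_forall (nbhs_filter x) H2.
by apply: filterS H3 => w H3 [i [j [k /H3]]].
Qed.

Lemma vertex_C2 : C2_at n Omega F x phi.
Proof.
split => //.
- exact: vertex_smooth.
- have xO : closure Omega x.
    by rewrite Ocover; have [i ix] := xP; exists i.
  by move: phi_cont => /subspace_continuousP; exact.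
- by move=> m1 m2 m12; apply/cvg_ex; exists (jet_coef c m1 m2); exact: vertex_cvg.
Qed.

End VertexJets.

(** * Spline pieces around the vertex *)

Section SplineExtra.
Variables (R : realType) (p r n : nat).
Hypotheses (hr : (1 <= r)%N) (hn : (1 <= n)%N).

Lemma spline_weaken (f : R -> R) : spline p r.+1 n f -> spline p r n f.
Proof.
move=> [[g [g0 gd gc]] fq]; split => //; exists g; split => //.
- by move=> j jr; apply: gd; exact: ltnW.
- by move=> j jr; apply: gc; exact: leqW.
Qed.

Definition jet1 (f : R -> R) s (c : R * R) := f s = c.1 /\ deriv01 f s = c.2.

Lemma jet21 (f : R -> R) s c : jet2 f s c -> jet1 f s c.1.
Proof. by case. Qed.

Lemma I01_0 : I01 (0 : R). Proof. by rewrite /I01/= in_itv/= lexx ler01. Qed.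
Lemma I01_1 : I01 (1 : R). Proof. by rewrite /I01/= in_itv/= lexx ler01. Qed.

Lemma corner_idx_0 : (corner_idx hn)%:R / n%:R <= (0 : R) <= (corner_idx hn).+1%:R / n%:R.
Proof. by rewrite /= mul0r lexx/= mul1r invr_ge0. Qed.

Lemma jet1_poly f q c : spline p r n f ->
  (forall s : R, (corner_idx hn)%:R / n%:R <= s <= (corner_idx hn).+1%:R / n%:R -> f s = q.[s]) ->
  jet1 f 0 c -> q.[0] = c.1 /\ q^`().[0] = c.2.
Proof.
move=> sf fq [<- <-]; rewrite fq ?corner_idx_0//; split => //.
by rewrite (spline_cell_deriv hn hr sf fq corner_idx_0).
Qed.

Lemma jet2_poly f q c : spline p r.+1 n f ->
  (forall s : R, (corner_idx hn)%:R / n%:R <= s <= (corner_idx hn).+1%:R / n%:R -> f s = q.[s]) ->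
  jet2 f 0 c -> [/\ q.[0] = c.1.1, q^`().[0] = c.1.2 & q^`()^`().[0] = c.2].
Proof.
by move=> sf fq [<- <- <-]; have [-> -> ->] := jet2_cell hr hn sf fq corner_idx_0.
Qed.

End SplineExtra.

(** * A spline with prescribed data on two adjacent sides *)

Section CornerFunction.
Variables (R : realType) (p r n : nat).
Hypotheses (hr : (1 <= r)%N) (hn : (1 <= n)%N).
Variables (N M fL gL fB gB : R -> R) (w00 w10 w01 w20 w11 w02 : R).
Hypotheses (sN : spline p r.+1 n N) (sM : spline p r.+1 n M)
  (sfL : spline p r.+1 n fL) (sfB : spline p r.+1 n fB)
  (sgL : spline p r n gL) (sgB : spline p r n gB).
Hypotheses (N0 : jet2 N 0 (1, 0, 0)) (N1 : jet2 N 1 (0, 0, 0))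
  (M0 : jet2 M 0 (0, 1, 0)) (M1 : jet2 M 1 (0, 0, 0))
  (fL0 : jet2 fL 0 (w00, w01, w02)) (fL1 : jet2 fL 1 (0, 0, 0))
  (fB0 : jet2 fB 0 (w00, w10, w20)) (fB1 : jet2 fB 1 (0, 0, 0))
  (gL0 : jet1 gL 0 (w10, w11)) (gL1 : jet1 gL 1 (0, 0))
  (gB0 : jet1 gB 0 (w01, w11)) (gB1 : jet1 gB 1 (0, 0)).

Let wN := spline_weaken sN.
Let wM := spline_weaken sM.
Let wfL := spline_weaken sfL.
Let wfB := spline_weaken sfB.

(** As in a Coons patch, [kN] and [kM] are the bottom data minus what the left-side terms already
    produce on the bottom side. The common value [w11] of the two mixed derivatives makes the
    correction consistent on both sides. *)
Let kN s := - w00 * N s + (- w10 * M s + fB s).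
Let kM s := - w01 * N s + (- w11 * M s + gB s).

Let skN : spline p r n kN.
Proof. exact: (spline_lin _ wN (spline_lin _ wM wfB)). Qed.
Let skM : spline p r n kM.
Proof. exact: (spline_lin _ wN (spline_lin _ wM sgB)). Qed.

(* The function with trace and normal derivative [fL], [gL] on the left side and
   [fB], [gB] on the bottom side. *)
Definition corner_fun (z : R * R) : R :=
  N z.1 * fL z.2 + (M z.1 * gL z.2 + (kN z.1 * N z.2 + kM z.1 * M z.2)).

Lemma corner_C1 : C1_expr n corner_fun
  (fun z => deriv01 N z.1 * fL z.2 + (deriv01 M z.1 * gL z.2 +
    (deriv01 kN z.1 * N z.2 + deriv01 kM z.1 * M z.2)))
  (fun z => N z.1 * deriv01 fL z.2 + (M z.1 * deriv01 gL z.2 +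
    (kN z.1 * deriv01 N z.2 + kM z.1 * deriv01 M z.2))).
Proof.
exact: (C1_exprD (C1_expr_tensor hr hn wN wfL) (C1_exprD
  (C1_expr_tensor hr hn wM sgL) (C1_exprD (C1_expr_tensor hr hn skN wN)
  (C1_expr_tensor hr hn skM wM)))).
Qed.

Lemma corner_spline2 : spline2 p r n corner_fun.
Proof.
exists 4%N, (fun k => [tuple N; M; kN; kM]`_k),
  (fun k => [tuple fL; gL; N; M]`_k); split.
  by case=> -[|[|[|[|//]]]] /= _.
by move=> z _; rewrite /corner_fun !big_ord_recl big_ord0 addr0.
Qed.

Lemma corner_d1 z : Sq z -> d1 corner_fun z =
  deriv01 N z.1 * fL z.2 + (deriv01 M z.1 * gL z.2 +
    (deriv01 kN z.1 * N z.2 + deriv01 kM z.1 * M z.2)).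
Proof. by move=> Sz; have [c _ _ _] := corner_C1; exact: cara_d1 (c _ Sz). Qed.

Lemma corner_d2 z : Sq z -> d2 corner_fun z =
  N z.1 * deriv01 fL z.2 + (M z.1 * deriv01 gL z.2 +
    (kN z.1 * deriv01 N z.2 + kM z.1 * deriv01 M z.2)).
Proof. by move=> Sz; have [c _ _ _] := corner_C1; exact: cara_d2 (c _ Sz). Qed.

Let dlin (a b : R) (g : R -> R) s : spline p r n g -> I01 s ->
  deriv01 (fun s => a * N s + (b * M s + g s)) s =
  a * deriv01 N s + (b * deriv01 M s + deriv01 g s).
Proof.
move=> sg Is; have c h := fun sh : spline p r n h => spline_cara1 hr sh Is.
apply: deriv01_lin => //; first exact: c wN.
by apply: cara1D; [apply: cara1Z; exact: c wM|exact: c sg].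
Qed.

Let dkN s : I01 s -> deriv01 kN s =
  - w00 * deriv01 N s + (- w10 * deriv01 M s + deriv01 fB s).
Proof. exact: dlin. Qed.

Let dkM s : I01 s -> deriv01 kM s =
  - w01 * deriv01 N s + (- w11 * deriv01 M s + deriv01 gB s).
Proof. exact: dlin. Qed.

Definition values (f : R * R -> R) z (c : R * R * R) :=
  [/\ f z = c.1.1, d1 f z = c.1.2 & d2 f z = c.2].

Lemma corner_left s : I01 s ->
  values corner_fun (0, s) (fL s, gL s, deriv01 fL s).
Proof.
move=> Is; have Ss : Sq (0, s) by split => //; exact: I01_0.
case: N0 M0 fB0 gB0 => /= n0 n1 n2 [/= m0 m1 m2] [/= b0 b1 b2] [/= h0 h1].
split; rewrite /= ?corner_d1 ?corner_d2//= ?(dkN (@I01_0 R)) ?(dkM (@I01_0 R));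
  rewrite /corner_fun /kN /kM /= ?n0 ?n1 ?m0 ?m1 ?b0 ?b1 ?h0 ?h1; ring.
Qed.

Lemma corner_bottom s : I01 s ->
  values corner_fun (s, 0) (fB s, deriv01 fB s, gB s).
Proof.
move=> Is; have Ss : Sq (s, 0) by split => //; exact: I01_0.
case: N0 M0 fL0 gL0 => /= n0 n1 n2 [/= m0 m1 m2] [/= b0 b1 b2] [/= h0 h1].
split; rewrite /= ?corner_d1 ?corner_d2//= ?(dkN Is) ?(dkM Is);
  rewrite /corner_fun /kN /kM /= ?n0 ?n1 ?m0 ?m1 ?b0 ?b1 ?h0 ?h1; ring.
Qed.

Lemma corner_far z : Sq z -> z.1 = 1 \/ z.2 = 1 -> values corner_fun z (0, 0, 0).
Proof.
case: N1 M1 => /= n0 n1 n2 [/= m0 m1 m2].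
case: fL1 gL1 fB1 gB1 => /= l0 l1 l2 [/= k0 k1] [/= b0 b1 b2] [/= h0 h1].
move=> Sz [z1|z1]; split; rewrite /= ?corner_d1 ?corner_d2//= /corner_fun !z1
  ?(dkN (@I01_1 R)) ?(dkM (@I01_1 R)) /kN /kM
  ?n0 ?n1 ?m0 ?m1 ?l0 ?l1 ?k0 ?k1 ?b0 ?b1 ?h0 ?h1; ring.
Qed.

Lemma corner_expr : exists2 e : expr R, (forall z, ok e z) &
  (forall z, cell (corner_idx hn) (corner_idx hn) z -> corner_fun z = ev e z) /\
  let E w := ev (foldr (@D R) e w) (0, 0) in
  [/\ E [::] = w00, E [:: false] = w10 & E [:: true] = w01] /\
  [/\ E [:: false; false] = w20, E [:: true; false] = w11,
    E [:: false; true] = w11 & E [:: true; true] = w02].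
Proof.
have [qN _ qNE] := sN.2 (corner_idx hn); have [qM _ qME] := sM.2 (corner_idx hn).
have [qfL _ qfLE] := sfL.2 (corner_idx hn); have [qfB _ qfBE] := sfB.2 (corner_idx hn).
have [qgL _ qgLE] := sgL.2 (corner_idx hn); have [qgB _ qgBE] := sgB.2 (corner_idx hn).
have [n0 n1 n2] := jet2_poly hr sN qNE N0.
have [m0 m1 m2] := jet2_poly hr sM qME M0.
have [l0 l1 l2] := jet2_poly hr sfL qfLE fL0.
have [b0 b1 b2] := jet2_poly hr sfB qfBE fB0.
have [k0 k1] := jet1_poly hr sgL qgLE gL0.
have [h0 h1] := jet1_poly hr sgB qgBE gB0.
pose eN := EAdd (EMul (EC (- w00)) (EX qN)) (EAdd (EMul (EC (- w10)) (EX qM)) (EX qfB)).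
pose eM := EAdd (EMul (EC (- w01)) (EX qN)) (EAdd (EMul (EC (- w11)) (EX qM)) (EX qgB)).
exists (EAdd (EMul (EX qN) (EY qfL)) (EAdd (EMul (EX qM) (EY qgL))
  (EAdd (EMul eN (EY qN)) (EMul eM (EY qM))))) => //; split.
  move=> z [z1 z2].
  have {}z1 : (corner_idx hn)%:R / n%:R <= z.1 <= (corner_idx hn).+1%:R / n%:R.
    by move: z1; rewrite /= in_itv.
  have {}z2 : (corner_idx hn)%:R / n%:R <= z.2 <= (corner_idx hn).+1%:R / n%:R.
    by move: z2; rewrite /= in_itv.
  rewrite /corner_fun /kN /kM /= !hornerC qNE// qME// qfLE// qfBE// qgLE// qgBE//.
  by rewrite qNE// qME.
rewrite /= in n0 n1 n2 m0 m1 m2 l0 l1 l2 b0 b1 b2 k0 k1 h0 h1.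
by split; split; rewrite /= ?(derivC, deriv0, horner0, hornerC)
  ?n2 ?m2 ?l2 ?b2 ?n1 ?m1 ?l1 ?b1 ?k1 ?h1 ?n0 ?m0 ?l0 ?b0 ?k0 ?h0; ring.
Qed.

End CornerFunction.

(** With [p] the common tangent of the interface and [f] the derivative of the trace, the three
    relations say that (B1, B2, gB) is a combination of (A1, A2, gL) and (p1, p2, f). Both pieces
    thus have the same tangent plane. *)
Lemma grad_match (R : realType) (a1 a2 b A1 A2 p1 p2 B1 B2 gL gB f : R) :
  a1 != 0 -> A1 * p2 - p1 * A2 != 0 -> p1 * B2 - B1 * p2 != 0 ->
  a1 * B1 + a2 * A1 + b * p1 = 0 -> a1 * B2 + a2 * A2 + b * p2 = 0 ->
  a1 * gB + a2 * gL + b * f = 0 ->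
  (gL * p2 - f * A2) / (A1 * p2 - p1 * A2) =
    (f * B2 - gB * p2) / (p1 * B2 - B1 * p2) /\
  (f * A1 - gL * p1) / (A1 * p2 - p1 * A2) =
    (gB * p1 - f * B1) / (p1 * B2 - B1 * p2).
Proof.
move=> a0 J1 J2 H1 H2 H3.
have e1 : B1 = - (a2 * A1 + b * p1) / a1.
  by apply: (mulfI a0); rewrite [RHS]mulrC divfK//; rewrite -[LHS]addr0 -oppr0 -H1; ring.
have e2 : B2 = - (a2 * A2 + b * p2) / a1.
  by apply: (mulfI a0); rewrite [RHS]mulrC divfK//; rewrite -[LHS]addr0 -oppr0 -H2; ring.
have e3 : gB = - (a2 * gL + b * f) / a1.
  by apply: (mulfI a0); rewrite [RHS]mulrC divfK//; rewrite -[LHS]addr0 -oppr0 -H3; ring.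
by split; apply/eqP; rewrite eqr_div//; apply/eqP; rewrite e1 e2 e3; field.
Qed.

(** * Matching the pieces around the vertex *)

Section VertexFunction.
Variables (R : realType) (p r n : nat) (I : finType).
Variables (F : I -> R * R -> R * R).
Hypotheses (hr : (1 <= r)%N) (hn : (1 <= n)%N).
Hypothesis Finj : forall i, {in @Sq R &, injective (F i)}.
Hypothesis Fspline : forall i, spline2 p r n (fst \o F i) /\
  spline2 p r n (snd \o F i).
Hypothesis Fjac : forall i z, Sq z -> jac F i z != 0.
Variable x : R * R.
Hypothesis Fx : forall i, cpatch F i x -> F i (0, 0) = x.

Definition glued i j :=
  (forall s, I01 s -> F i (0, s) = F j (s, 0)) /\
  exists a1 a2 b1 b2 : {poly R},
  [/\ (size a1 <= 2)%N /\ (size a2 <= 2)%N, (size b1 <= 2)%N /\ (size b2 <= 2)%N,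
      forall s, I01 s -> a1.[s] != 0
    & forall s, I01 s -> a1.[s] *: d2 (F j) (s, 0) + a2.[s] *: d1 (F i) (0, s) +
        (a1 * b2 + a2 * b1).[s] *: d2 (F i) (0, s) = 0].

(* [j] follows [i] clockwise around [x]: the left side of [i] is the bottom side
   of [j]. *)
Definition next i j := [/\ i <> j, cpatch F i x, cpatch F j x & glued i j].

Hypothesis next_inj : forall i j j', next i j -> next i j' -> j = j'.
Hypothesis next_inj' : forall i i' j, next i j -> next i' j -> i = i'.
Hypothesis meet : forall i j s t, i <> j -> Sq s -> Sq t -> F i s = F j t ->
  cpatch F i x ->
  (~ cpatch F j x /\ (s.1 = 1 \/ s.2 = 1)) \/
  (cpatch F j x /\ [\/ s = (0, 0) /\ t = (0, 0),
     [/\ next i j, s = (0, s.2) & t = (s.2, 0)]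
   | [/\ next j i, t = (0, t.2) & s = (t.2, 0)]]).

Variable c : R * R * R * (R * R * R).

Let cc := cell (R := R) (corner_idx hn) (corner_idx hn).

Definition chart_expr i (A : expr R * expr R) :=
  [/\ forall z, ok A.1 z, forall z, ok A.2 z & forall z, cc z ->
    [/\ F i z = (ev A.1 z, ev A.2 z),
        d1 (F i) z = (ev (D false A.1) z, ev (D false A.2) z)
      & d2 (F i) z = (ev (D true A.1) z, ev (D true A.2) z)]].

Lemma d12F i z : Sq z ->
  d1 (F i) z = (d1 (fst \o F i) z, d1 (snd \o F i) z) /\
  d2 (F i) z = (d2 (fst \o F i) z, d2 (snd \o F i) z).
Proof.
move=> Sz.
have [/(spline2_C1 hr hn)[c1 _ _ _] /(spline2_C1 hr hn)[c2 _ _ _]] := Fspline i.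
by split; [exact: (d1_pair Sz (c1 _ Sz) (c2 _ Sz))|
  exact: (d2_pair Sz (c1 _ Sz) (c2 _ Sz))].
Qed.

Lemma side_deriv i j s : (forall t, I01 t -> F i (0, t) = F j (t, 0)) ->
  I01 s -> d2 (F i) (0, s) = d1 (F j) (s, 0).
Proof.
move=> Fij Is.
have Si : Sq (0, s) by split => //; exact: I01_0.
have Sj : Sq (s, 0) by split => //; exact: I01_0.
have [/(spline2_C1 hr hn)[ci _ _ _] /(spline2_C1 hr hn)[ci' _ _ _]] := Fspline i.
have [/(spline2_C1 hr hn)[cj _ _ _] /(spline2_C1 hr hn)[cj' _ _ _]] := Fspline j.
have [_ ->] := d12F i Si; have [-> _] := d12F j Sj; congr pair.
- apply/esym/cara1_deriv01 => //.
  apply: (@cara1_eq _ _ (fun t => (fst \o F i) (0, t))) => //.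
    by move=> t It /=; rewrite Fij.
  by apply: (cara_line2 _ (ci _ Si)) => t It; split => //; exact: I01_0.
- apply/esym/cara1_deriv01 => //.
  apply: (@cara1_eq _ _ (fun t => (snd \o F i) (0, t))) => //.
    by move=> t It /=; rewrite Fij.
  by apply: (cara_line2 _ (ci' _ Si)) => t It; split => //; exact: I01_0.
Qed.

Lemma chart_exprP i : exists A, chart_expr i A.
Proof.
have [/(spline2_C1 hr hn)[_ _ _ /(_ (corner_idx hn) (corner_idx hn))[A1 o1 e1]]] := Fspline i.
move=> /(spline2_C1 hr hn)[_ _ _ /(_ (corner_idx hn) (corner_idx hn))[A2 o2 e2]].
exists (A1, A2); split => // z cz.
have [-> ->] := d12F i (cell_Sq hn cz).
have [f1 -> ->] := e1 _ cz; have [f2 -> ->] := e2 _ cz; split => //.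
by rewrite /= -f1 -f2 /= -surjective_pairing.
Qed.

Variable A : I -> expr R * expr R.
Hypothesis AP : forall i, chart_expr i (A i).

Definition pullback i := quad c (shift1 x.1 (A i).1) (shift1 x.2 (A i).2).
Definition cjet i v := ev (foldr (@D R) (pullback i) v) (0, 0).

Lemma ok_pullback i z : ok (pullback i) z.
Proof.
by have [k1 k2 _] := AP i; apply: ok_quad; rewrite /= ?k1 ?k2. Qed.

(** [q1] and [q2] are the partial derivatives of the prescribed polynomial at a physical point. *)
Let q1 (y : R * R) := c.1.1.2 + 2 * c.2.1.1 * (y.1 - x.1) + c.2.1.2 * (y.2 - x.2).
Let q2 (y : R * R) := c.1.2 + c.2.1.2 * (y.1 - x.1) + 2 * c.2.2 * (y.2 - x.2).

Lemma pullback_grad b i z : cc z -> ev (D b (pullback i)) z =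
  q1 (F i z) * ev (D b (A i).1) z + q2 (F i z) * ev (D b (A i).2) z.
Proof.
move=> cz; have [_ _ /(_ _ cz) [-> _ _]] := AP i; rewrite /q1 /q2 /pullback /quad /=.
case: b; rewrite ?(derivC, horner0, hornerC); ring.
Qed.

Variable h : R * R * R -> R -> R.
Hypothesis hP : forall c, [/\ spline p r.+1 n (h c), jet2 (h c) 0 c
  & jet2 (h c) 1 (0, 0, 0)].

Definition fL i := h (cjet i [::], cjet i [:: true], cjet i [:: true; true]).
Definition fB i := h (cjet i [::], cjet i [:: false], cjet i [:: false; false]).

Let seg : set R := [set` `[0, n%:R^-1]].

Let ninv_gt0 : (0 : R) < n%:R^-1. Proof. by rewrite invr_gt0 ltr0n. Qed.

Let seg0 : seg 0. Proof. by rewrite /seg/= in_itv/= lexx ltW. Qed.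

Let seg_cell t : seg t -> cc (0, t) /\ cc (t, 0).
Proof.
rewrite /seg/= in_itv/= => /andP[t0 t1]; rewrite /cc /cell/=.
by split; split; rewrite /= in_itv/= mul0r mul1r ?lexx ?t0 ?t1 ?(ltW ninv_gt0).
Qed.

Let seg_I01 t : seg t -> I01 t.
Proof. by move=> /seg_cell[/(cell_Sq hn)[]]. Qed.

Lemma ev_left e t : (forall z, ok e z) ->
  cara1 seg (fun t => ev e (0, t)) t (ev (D true e) (0, t)).
Proof.
by move=> oe; exact: (@cara_line2 _ setT seg (ev e) (0, t) _ _ (fun _ _ => Logic.I)
  (cara_ev setT (oe (0, t)))).
Qed.

Lemma ev_bottom e t : (forall z, ok e z) ->
  cara1 seg (fun t => ev e (t, 0)) t (ev (D false e) (t, 0)).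
Proof.
by move=> oe; exact: (@cara_line1 _ setT seg (ev e) (t, 0) _ _ (fun _ _ => Logic.I)
  (cara_ev setT (oe (t, 0)))).
Qed.

(** Lets an identity along the first mesh segment of a side be differentiated, also at the
    corner. *)
Lemma seg_unique (f g : R -> R) t k l : seg t -> (forall t, seg t -> f t = g t) ->
  cara1 seg f t k -> cara1 seg g t l -> k = l.
Proof.
move=> st fg fk gl; have t01 : 0 <= t <= n%:R^-1 by move: st; rewrite /seg/= in_itv.
by apply: (cara1_unique ninv_gt0 t01 _ gl); exact: cara1_eq fk.
Qed.

Section Pair.
Variables i j : I.
Hypothesis ij : next i j.

Lemma pullback_side t : seg t -> ev (pullback i) (0, t) = ev (pullback j) (t, 0).
Proof.
move=> st; have [ci cj] := seg_cell st; have [_ _ _ [Fij _]] := ij.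
have [_ _ /(_ _ ci)[Fi _ _]] := AP i; have [_ _ /(_ _ cj)[Fj _ _]] := AP j.
by have := Fij _ (seg_I01 st); rewrite Fi Fj /pullback /quad /= => -[-> ->]; rewrite !hornerC.
Qed.

Lemma pullback_side1 t : seg t -> ev (D true (pullback i)) (0, t) = ev (D false (pullback j)) (t, 0).
Proof.
move=> st; apply: (seg_unique st pullback_side); first exact: ev_left (ok_pullback i).
exact: ev_bottom (ok_pullback j).
Qed.

Lemma pullback_side2 t : seg t ->
  ev (D true (D true (pullback i))) (0, t) = ev (D false (D false (pullback j))) (t, 0).
Proof.
move=> st; apply: (seg_unique st pullback_side1).
  by apply: ev_left => z; apply: ok_D; exact: ok_pullback.
by apply: ev_bottom => z; apply: ok_D; exact: ok_pullback.
Qed.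

(** The traces are equal as functions because [h] is one fixed function of the jet, and the
    pullbacks of one polynomial have the same tangential jets along the common side. *)
Lemma fL_fB : fL i = fB j.
Proof.
rewrite /fL /fB; congr (h (_, _, _)).
- exact: pullback_side seg0.
- exact: pullback_side1 seg0.
- exact: pullback_side2 seg0.
Qed.

Definition edge_data (gL gB : R -> R) :=
  [/\ [/\ spline p r n gL, jet1 gL 0 (cjet i [:: false], cjet i [:: true; false])
        & jet1 gL 1 (0, 0)],
      [/\ spline p r n gB, jet1 gB 0 (cjet j [:: true], cjet j [:: true; false])
        & jet1 gB 1 (0, 0)]
    & exists a1 a2 b : R -> R, forall s, I01 s ->
      [/\ a1 s != 0,
          a1 s *: d2 (F j) (s, 0) + a2 s *: d1 (F i) (0, s) +
            b s *: d2 (F i) (0, s) = 0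
        & a1 s * gB s + a2 s * gL s + b s * deriv01 (fL i) s = 0]].

(** The factor 1 gives the sum the shape that [spline_lin] and [deriv01_lin] expect. *)
Let gen (la lb : {poly R}) (K f : R -> R) s :=
  1 * (la.[s] * deriv01 K s) + lb.[s] * deriv01 f s.

Let gen_spline (la lb : {poly R}) K f : (size la <= 2)%N -> (size lb <= 2)%N ->
  spline p r.+1 n K -> spline p r.+1 n f -> spline p r n (gen la lb K f).
Proof.
by move=> sa sb sK sf; apply: spline_lin; exact: spline_mul_deriv.
Qed.

Let gen_jet (la lb : {poly R}) K f s k l : I01 s ->
  spline p r.+1 n K -> spline p r.+1 n f -> jet2 K s k -> jet2 f s l ->
  jet1 (gen la lb K f) s (la.[s] * k.1.2 + lb.[s] * l.1.2,
    la^`().[s] * k.1.2 + la.[s] * k.2 + (lb^`().[s] * l.1.2 + lb.[s] * l.2)).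
Proof.
move=> Is sK sf [_ k1 k2] [_ l1 l2]; rewrite -k1 -k2 -l1 -l2.
split; rewrite /gen /= ?mul1r//; rewrite -[X in X + _]mul1r.
apply: deriv01_lin => //; apply: cara1M; first exact: cara1_poly.
- exact: (spline_cara1 hr (spline_deriv hn sK)).
- exact: cara1_poly.
- exact: (spline_cara1 hr (spline_deriv hn sf)).
Qed.

(** The gluing relation between the two transversal derivatives is an identity in [K], which leaves
    K'(0) and K''(0) to fit the corner data on the side of [i]. The data on the side of [j] then
    hold, since the pullbacks obey the same relation and [a1] does not vanish at 0. *)
Lemma edge_exists : exists g, edge_data g.1 g.2.
Proof.
have [_ _ _ [_ [a1 [a2 [b1 [b2 [[sa1 sa2] [sb1 sb2] a10 glue]]]]]]] := ij.
pose b := a1 * b2 + a2 * b1.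
pose wi v := cjet i v; pose wj v := cjet j v.
have a00 : a1.[0] != 0 by apply: a10; exact: seg_I01.
(* By the chain rule, the coordinate gluing relations weighted with [q1] and [q2] give the relation
   for the pullbacks. *)
have W_glue t : seg t -> a1.[t] * ev (D true (pullback j)) (t, 0) +
    a2.[t] * ev (D false (pullback i)) (0, t) + b.[t] * ev (D true (pullback i)) (0, t) = 0.
  move=> st; have [ci cj] := seg_cell st; have It := seg_I01 st.
  have [_ _ _ [Fij _]] := ij.
  rewrite !pullback_grad// -Fij//; set y := F i (0, t).
  have := glue _ It.
  have [_ _ /(_ _ ci)[_ -> ->]] := AP i; have [_ _ /(_ _ cj)[_ _ ->]] := AP j.
  rewrite -/b => -[e1 e2].
  have {}e1 : a1.[t] * ev (D true (A j).1) (t, 0) +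
    a2.[t] * ev (D false (A i).1) (0, t) + b.[t] * ev (D true (A i).1) (0, t) = 0 := e1.
  have {}e2 : a1.[t] * ev (D true (A j).2) (t, 0) +
    a2.[t] * ev (D false (A i).2) (0, t) + b.[t] * ev (D true (A i).2) (0, t) = 0 := e2.
  transitivity (q1 y * (a1.[t] * ev (D true (A j).1) (t, 0) +
    a2.[t] * ev (D false (A i).1) (0, t) + b.[t] * ev (D true (A i).1) (0, t)) +
    q2 y * (a1.[t] * ev (D true (A j).2) (t, 0) +
    a2.[t] * ev (D false (A i).2) (0, t) + b.[t] * ev (D true (A i).2) (0, t))).
    by ring.
  by rewrite e1 e2; ring.
have G0 := W_glue _ seg0.
(* The derivative of [W_glue] along the side at the corner. *)
have G1 : a1^`().[0] * wj [:: true] + a1.[0] * wj [:: true; false] +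
    (a2^`().[0] * wi [:: false] + a2.[0] * wi [:: true; false]) +
    (b^`().[0] * wi [:: true] + b.[0] * wi [:: true; true]) = 0.
  rewrite [wj [:: true; false]]ev_DC.
  apply: (seg_unique seg0 W_glue); last first.
    by have := cara1_poly seg 0 0; rewrite deriv0 horner0; apply: cara1_eq => // t;
      rewrite horner0.
  apply: cara1D; first apply: cara1D; apply: cara1M; try exact: cara1_poly.
  - by apply: ev_bottom => z; apply: ok_D; exact: ok_pullback.
  - by apply: ev_left => z; apply: ok_D; exact: ok_pullback.
  - by apply: ev_left => z; apply: ok_D; exact: ok_pullback.
have wj1 : wj [:: true] = - (a2.[0] * wi [:: false] + b.[0] * wi [:: true]) / a1.[0].
  apply: (mulfI a00); rewrite [RHS]mulrC divfK//; apply/eqP.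
  by rewrite -subr_eq0 opprK; apply/eqP; rewrite -[RHS]G0 addrA.
have wj2 : wj [:: true; false] = - (a1^`().[0] * wj [:: true] +
    (a2^`().[0] * wi [:: false] + a2.[0] * wi [:: true; false]) +
    (b^`().[0] * wi [:: true] + b.[0] * wi [:: true; true])) / a1.[0].
  apply: (mulfI a00); rewrite [RHS]mulrC divfK//; apply/eqP.
  by rewrite -subr_eq0 opprK; apply/eqP; rewrite -[RHS]G1; ring.
(* [ka] and [kb] solve the conditions on the value and the derivative of a1 K' - b1 f' at 0. *)
pose ka := (wi [:: false] + b1.[0] * wi [:: true]) / a1.[0].
pose kb := (wi [:: true; false] - a1^`().[0] * ka + b1^`().[0] * wi [:: true] +
  b1.[0] * wi [:: true; true]) / a1.[0].
(* Only derivatives of [K] enter, so its value at 0 is free and set to 0. *)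
have [sK K0 K1] := hP (0, ka, kb).
have [sf f0 f1] := hP (wi [::], wi [:: true], wi [:: true; true]).
exists (gen a1 (- b1) (h (0, ka, kb)) (fL i), gen (- a2) (- b2) (h (0, ka, kb)) (fL i)).
have sN (q : {poly R}) : (size q <= 2)%N -> (size (- q)%R <= 2)%N by rewrite size_polyN.
have I0 := @I01_0 R; have I1 := @I01_1 R.
split => /=.
- split; first by apply: gen_spline => //; exact: sN.
  + have := gen_jet a1 (- b1) I0 sK sf K0 f0; congr jet1; rewrite /= derivN !hornerN.
    by congr pair; rewrite /kb /ka /wi; field.
  + have := gen_jet a1 (- b1) I1 sK sf K1 f1; congr jet1.
    by rewrite /= !mulr0 !addr0.
- split; first by apply: gen_spline => //; exact: sN.
  + have := gen_jet (- a2) (- b2) I0 sK sf K0 f0; congr jet1.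
    rewrite /= !derivN !hornerN; congr pair.
      by rewrite -/(wj [:: true]) wj1 /b hornerD !hornerM /ka; field.
    rewrite -/(wj [:: true; false]) wj2 wj1 /b derivD !derivM !hornerD !hornerM.
    by rewrite /kb /ka; field.
  + have := gen_jet (- a2) (- b2) I1 sK sf K1 f1; congr jet1.
    by rewrite /= !mulr0 !addr0.
exists (horner a1), (horner a2), (horner b) => s Is; split.
- exact: a10.
- exact: glue.
- by rewrite /gen /b !(hornerD, hornerM, hornerN); ring.
Qed.

End Pair.

Lemma pair_data (ij : I * I) : exists g, next ij.1 ij.2 -> edge_data ij.1 ij.2 g.1 g.2.
Proof.
have [nij|nn] := pselect (next ij.1 ij.2); last by exists (fun=> 0, fun=> 0).
by have [g gP] := edge_exists nij; exists g.
Qed.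

Variable P : I * I -> (R -> R) * (R -> R).
Hypothesis PP : forall ij, next ij.1 ij.2 ->
  edge_data ij.1 ij.2 (P ij).1 (P ij).2.

(** Without a neighbour across the side there is no gluing condition; any spline with the right
    1-jet at the corner and zero 1-jet at the far end serves, here with second derivative 0. *)
Definition gL i := if pselect (exists j, next i j) is left e
  then (P (i, projT1 (cid e))).1 else h (cjet i [:: false], cjet i [:: true; false], 0).
Definition gB j := if pselect (exists i, next i j) is left e
  then (P (projT1 (cid e), j)).2 else h (cjet j [:: true], cjet j [:: true; false], 0).

Lemma gL_next i j : next i j -> gL i = (P (i, j)).1.
Proof.
move=> ij; rewrite /gL; case: pselect => [e|[]]; last by exists j.
by case: (cid e) => j' ij' /=; rewrite (next_inj ij ij').
Qed.

Lemma gB_next i j : next i j -> gB j = (P (i, j)).2.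
Proof.
move=> ij; rewrite /gB; case: pselect => [e|[]]; last by exists i.
by case: (cid e) => i' ij' /=; rewrite (next_inj' ij ij').
Qed.

Lemma edge_next i j : next i j -> edge_data i j (gL i) (gB j).
Proof. by move=> ij; rewrite (gL_next ij) (gB_next ij); exact: (PP (ij := (i, j))). Qed.

Lemma gLP i : [/\ spline p r n (gL i),
  jet1 (gL i) 0 (cjet i [:: false], cjet i [:: true; false]) & jet1 (gL i) 1 (0, 0)].
Proof.
have [[j ij]|nn] := pselect (exists j, next i j); first by have [] := edge_next ij.
rewrite /gL; case: pselect => // e.
have [sh h0 h1] := hP (cjet i [:: false], cjet i [:: true; false], 0).
by split; [exact: spline_weaken|exact: jet21 h0|exact: jet21 h1].
Qed.

Lemma gBP j : [/\ spline p r n (gB j),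
  jet1 (gB j) 0 (cjet j [:: true], cjet j [:: true; false]) & jet1 (gB j) 1 (0, 0)].
Proof.
have [[i ij]|nn] := pselect (exists i, next i j); first by have [] := edge_next ij.
rewrite /gB; case: pselect => // e.
have [sh h0 h1] := hP (cjet j [:: true], cjet j [:: true; false], 0).
by split; [exact: spline_weaken|exact: jet21 h0|exact: jet21 h1].
Qed.

Let N := h (1, 0, 0).
Let M := h (0, 1, 0).

Definition vertex_fun i : R * R -> R := if pselect (cpatch F i x) is left _
  then corner_fun N M (fL i) (gL i) (fB i) (gB i) (cjet i [::]) (cjet i [:: false])
    (cjet i [:: true]) (cjet i [:: true; false])
  else fun=> 0.

Lemma vertex_fun_in i : cpatch F i x ->
  vertex_fun i = corner_fun N M (fL i) (gL i) (fB i) (gB i) (cjet i [::]) (cjet i [:: false])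
    (cjet i [:: true]) (cjet i [:: true; false]).
Proof. by move=> ix; rewrite /vertex_fun; case: pselect. Qed.

Lemma vertex_fun_out i z : ~ cpatch F i x -> Sq z -> values (vertex_fun i) z (0, 0, 0).
Proof.
move=> nx Sz; rewrite /vertex_fun; case: pselect => // _.
split => //=; first exact: (cara_d1 Sz (cara_cst (@Sq R) 0 z)).
exact: (cara_d2 Sz (cara_cst (@Sq R) 0 z)).
Qed.

Lemma vertex_fun_spline i : spline2 p r n (vertex_fun i).
Proof.
have [sN _ _] := hP (1, 0, 0); have [sM _ _] := hP (0, 1, 0).
have [sL _ _] := hP (cjet i [::], cjet i [:: true], cjet i [:: true; true]).
have [sB _ _] := hP (cjet i [::], cjet i [:: false], cjet i [:: false; false]).
have [tL _ _] := gLP i; have [tB _ _] := gBP i.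
rewrite /vertex_fun; case: pselect => _; first exact: corner_spline2.
exists 0%N, (fun _ => id), (fun _ => id); split; first by case.
by move=> z _; rewrite big_ord0.
Qed.

Lemma vertex_fun_left i s : cpatch F i x -> I01 s ->
  values (vertex_fun i) (0, s) (fL i s, gL i s, deriv01 (fL i) s).
Proof.
have [sN N0 _] := hP (1, 0, 0); have [sM M0 _] := hP (0, 1, 0).
have [sL _ _] := hP (cjet i [::], cjet i [:: true], cjet i [:: true; true]).
have [sB B0 _] := hP (cjet i [::], cjet i [:: false], cjet i [:: false; false]).
have [tL _ _] := gLP i; have [tB b0 _] := gBP i.
move=> ix Is; rewrite vertex_fun_in//; exact: (corner_left hr hn sN sM sL sB tL tB N0 M0 B0 b0 Is).
Qed.

Lemma vertex_fun_bottom i s : cpatch F i x -> I01 s ->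
  values (vertex_fun i) (s, 0) (fB i s, deriv01 (fB i) s, gB i s).
Proof.
have [sN N0 _] := hP (1, 0, 0); have [sM M0 _] := hP (0, 1, 0).
have [sL L0 _] := hP (cjet i [::], cjet i [:: true], cjet i [:: true; true]).
have [sB _ _] := hP (cjet i [::], cjet i [:: false], cjet i [:: false; false]).
have [tL l0 _] := gLP i; have [tB _ _] := gBP i.
move=> ix Is; rewrite vertex_fun_in//; exact: (corner_bottom hr hn sN sM sL sB tL tB N0 M0 L0 l0 Is).
Qed.

Lemma vertex_fun_far i z : Sq z -> z.1 = 1 \/ z.2 = 1 -> values (vertex_fun i) z (0, 0, 0).
Proof.
have [sN _ N1] := hP (1, 0, 0); have [sM _ M1] := hP (0, 1, 0).
have [sL _ L1] := hP (cjet i [::], cjet i [:: true], cjet i [:: true; true]).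
have [sB _ B1] := hP (cjet i [::], cjet i [:: false], cjet i [:: false; false]).
have [tL _ l1] := gLP i; have [tB _ b1] := gBP i.
have [ix|nx] := pselect (cpatch F i x); last by move=> Sz _; exact: vertex_fun_out.
move=> Sz z1; rewrite (vertex_fun_in ix).
exact: (corner_far hr hn _ _ _ _ sN sM sL sB tL tB N1 M1 L1 B1 l1 b1 Sz z1).
Qed.

Let same i j s t := [/\ vertex_fun i s = vertex_fun j t,
  grad1 F vertex_fun i s = grad1 F vertex_fun j t
  & grad2 F vertex_fun i s = grad2 F vertex_fun j t].

Let same_sym i j s t : same i j s t -> same j i t s.
Proof. by move=> [a b d]; split; exact: esym. Qed.

Let same_zero i j s t : values (vertex_fun i) s (0, 0, 0) -> values (vertex_fun j) t (0, 0, 0) ->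
  same i j s t.
Proof.
have grad0 k y : values (vertex_fun k) y (0, 0, 0) ->
    [/\ vertex_fun k y = 0, grad1 F vertex_fun k y = 0 & grad2 F vertex_fun k y = 0].
  by move=> [e0 e1 e2]; split => //; rewrite /grad1 /grad2 e1 e2 /= !mul0r subrr mul0r.
move=> /grad0[a0 a1 a2] /grad0[b0 b1 b2].
by split; [rewrite a0 b0|rewrite a1 b1|rewrite a2 b2].
Qed.

Let same_next i j s : next i j -> I01 s -> same i j (0, s) (s, 0).
Proof.
move=> ij Is; have [nij ix jx [Fij _]] := ij.
have Si : Sq (0, s) by split => //; exact: I01_0.
have Sj : Sq (s, 0) by split => //; exact: I01_0.
have [u0 u1 u2] := vertex_fun_left ix Is; have [v0 v1 v2] := vertex_fun_bottom jx Is.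
have LB := fL_fB ij.
have [_ _ [a1 [a2 [b H]]]] := edge_next ij; have [a0 e1 e2] := H _ Is.
have [A1 P1] := d12F i Si; have [P2 B2] := d12F j Sj.
have PP' := side_deriv Fij Is.
have [p1 p2] : d2 (fst \o F i) (0, s) = d1 (fst \o F j) (s, 0) /\
    d2 (snd \o F i) (0, s) = d1 (snd \o F j) (s, 0).
  by move: PP'; rewrite P1 P2 => -[-> ->].
move: e1; rewrite A1 P1 B2 => -[e11 e12].
have J1 := Fjac i Si; have J2 := Fjac j Sj.
rewrite /jac -p1 -p2 in J1 J2.
have [g1 g2] := grad_match a0 J1 J2 e11 e12 e2.
split; first by rewrite u0 v0 LB.
- by rewrite /grad1 /jac u1 u2 v1 v2 -LB /= -p1 -p2.
- by rewrite /grad2 /jac u1 u2 v1 v2 -LB /= -p1 -p2.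
Qed.

(** If one of two distinct patches misses [x], the common point lies on a far side of the other, or
    both functions are zero. Otherwise it is [x], where both gradients are those of the polynomial,
    or it lies on an interface through [x], where [grad_match] applies. *)
Lemma vertex_fun_compat i j s t : Sq s -> Sq t -> F i s = F j t -> same i j s t.
Proof.
move=> Ss St st; have [ij|/eqP ij] := eqVneq i j.
  by move: st; rewrite ij => /Finj; rewrite !inE => ->.
have [ix|nix] := pselect (cpatch F i x); last first.
  have [jx|njx] := pselect (cpatch F j x); last first.
    by apply: same_zero; apply: vertex_fun_out.
  have [[_ far]|[]//] := meet (nesym ij) St Ss (esym st) jx.
  by apply: same_zero; [exact: vertex_fun_out|exact: vertex_fun_far].
have [[njx far]|[jx]] := meet ij Ss St st ix.
  by apply: same_zero; [exact: vertex_fun_far|exact: vertex_fun_out].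
case=> [[s0 t0]|[nij s0 t0]|[nji t0 s0]].
- have I0 := @I01_0 R; have S0 : Sq (0 : R, 0 : R) by split.
  have cell0 : cc (0 : R, 0 : R) by exact: corner_cell.
  (* The parametric derivatives at the corner are the chain rule for the polynomial, which Cramer's
     rule inverts. *)
  have key k : cpatch F k x -> [/\ vertex_fun k (0, 0) = c.1.1.1,
      grad1 F vertex_fun k (0, 0) = c.1.1.2 & grad2 F vertex_fun k (0, 0) = c.1.2].
    move=> kx; have [u0 u1 u2] := vertex_fun_left kx I0; have [v0 v1 v2] := vertex_fun_bottom kx I0.
    have [_ L0 _] := hP (cjet k [::], cjet k [:: true], cjet k [:: true; true]).
    have {}L0 : jet2 (fL k) 0 (cjet k [::], cjet k [:: true], cjet k [:: true; true]) := L0.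
    have [_ g0 _] := gLP k; case: L0 g0 => /= l0 l1 l2 [/= g0 g1].
    have [_ _ /(_ _ cell0) [Fk D1 D2]] := AP k.
    rewrite Fx// in Fk; have [d1E d2E] := d12F k S0.
    rewrite d1E in D1; rewrite d2E in D2; case: D1 => D11 D12; case: D2 => D21 D22.
    have J := Fjac k S0; rewrite /grad1 /grad2.
    have x1 : ev (A k).1 (0, 0) = x.1 by rewrite [in RHS]Fk.
    have x2 : ev (A k).2 (0, 0) = x.2 by rewrite [in RHS]Fk.
    have w0 : cjet k [::] = c.1.1.1.
      by rewrite /cjet /pullback /quad /= x1 x2 !hornerC; ring.
    have w1 : cjet k [:: false] = q1 x * ev (D false (A k).1) (0, 0) +
        q2 x * ev (D false (A k).2) (0, 0).
      by have := pullback_grad false k cell0; rewrite Fx.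
    have w2 : cjet k [:: true] = q1 x * ev (D true (A k).1) (0, 0) +
        q2 x * ev (D true (A k).2) (0, 0).
      by have := pullback_grad true k cell0; rewrite Fx.
    have qx : q1 x = c.1.1.2 /\ q2 x = c.1.2 by split; rewrite /q1 /q2; ring.
    rewrite u0 u1 u2 /= g0 l0 l1 w0 w1 w2 (proj1 qx) (proj2 qx).
    move: J; rewrite /jac D11 D12 D21 D22 => J.
    by split => //; field.
  rewrite s0 t0; have [a0 a1 a2] := key _ ix; have [b0 b1 b2] := key _ jx.
  by split; [rewrite a0 b0|rewrite a1 b1|rewrite a2 b2].
- by rewrite s0 t0; apply: same_next => //; case: Ss.
- by rewrite s0 t0; apply: same_sym; apply: same_next => //; case: St.
Qed.

Lemma vertex_fun_jet i : cpatch F i x -> exists e A1 A2 : expr R,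
  [/\ [/\ forall z, ok e z, forall z, ok A1 z & forall z, ok A2 z],
      forall z, cc z -> [/\ vertex_fun i z = ev e z, (F i z).1 = ev A1 z & (F i z).2 = ev A2 z]
    & eq_jet2 (0, 0) e (quad c (shift1 x.1 A1) (shift1 x.2 A2))].
Proof.
move=> ix.
have [sN N0 _] := hP (1, 0, 0); have [sM M0 _] := hP (0, 1, 0).
have [sL L0 _] := hP (cjet i [::], cjet i [:: true], cjet i [:: true; true]).
have [sB B0 _] := hP (cjet i [::], cjet i [:: false], cjet i [:: false; false]).
have [tL l0 _] := gLP i; have [tB b0 _] := gBP i.
have [e oe [eE [[e0 e1 e2] [e3 e4 e5 e6]]]] :=
  corner_expr hr hn sN sM sL sB tL tB N0 M0 L0 B0 l0 b0.
have [k1 k2 AE] := AP i.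
exists e, (A i).1, (A i).2; split => //.
  by move=> z cz; rewrite vertex_fun_in// eE//; have [-> _ _] := AE z cz.
split; first by split; [exact: e0|case; [exact: e2|exact: e1]].
case; split; [exact: e2| |exact: e1|by case; [exact: e4|exact: e3]].
by case; [exact: e6|rewrite [RHS]ev_DC; exact: e5].
Qed.

End VertexFunction.

(** * Rotations of the parameter square *)

Section Interpolation.
Variables (R : realType) (p r n : nat) (I : finType).
Variables (Omega : set (R * R)) (F : I -> R * R -> R * R).
Hypotheses (hr : (1 <= r)%N) (hp : (r + 2 <= p)%N) (hn : (1 <= n)%N)
  (hn4 : (4%:R - r%:R) / (p%:R - r%:R - 1) <= n%:R :> R).
Hypothesis Oopen : open Omega.
Hypothesis Ocover : closure Omega = \bigcup_i cpatch F i.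
Hypothesis Popen : forall i, open (patch F i).
Hypothesis Finj : forall i, {in @Sq R &, injective (F i)}.
Hypothesis Fspline : forall i, spline2 p r n (fst \o F i) /\
  spline2 p r n (snd \o F i).
Hypothesis Fjac : forall i z, Sq z -> jac F i z != 0.
Variable x : R * R.
Hypothesis Fx : forall i, cpatch F i x -> F i (0, 0) = x.
Hypothesis xP : exists i, cpatch F i x.
Hypothesis next_inj : forall i j j', next F x i j -> next F x i j' -> j = j'.
Hypothesis next_inj' : forall i i' j, next F x i j -> next F x i' j -> i = i'.
Hypothesis meet : forall i j s t, i <> j -> Sq s -> Sq t -> F i s = F j t ->
  cpatch F i x ->
  (~ cpatch F j x /\ (s.1 = 1 \/ s.2 = 1)) \/
  (cpatch F j x /\ [\/ s = (0, 0) /\ t = (0, 0),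
     [/\ next F x i j, s = (0, s.2) & t = (s.2, 0)]
   | [/\ next F x j i, t = (0, t.2) & s = (t.2, 0)]]).

Lemma jet_interpolation c : exists f, [/\ V1 p r n Omega F f,
  C2_at n Omega F x f & forall m1 m2, (m1 + m2 <= 2)%N ->
    pderiv m1 m2 f @ within (elts n F) (nbhs x) --> (jet_coef c m1 m2 : R)].
Proof.
have [A AP] := choice (chart_exprP hr hn Fspline).
(* One interpolant per jet, chosen once for all patches, so that equal jets give equal traces. *)
have [h hP] := choice (hermite hr hn hp hn4).
have [P PP] := choice (pair_data hr x c AP hP).
have us := vertex_fun_spline next_inj next_inj' hP PP.
have uc := vertex_fun_compat hr Finj Fspline Fjac Fx next_inj next_inj' meet AP hP PP.
have uj := vertex_fun_jet hr next_inj next_inj' AP hP PP.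
set v := vertex_fun F x c A h P in us uc uj.
have vc : compatible F v by move=> i j s t Ss St st; have [] := uc i j s t Ss St st.
have g1 : compatible F (grad1 F v).
  by move=> i j s t Ss St st; have [] := uc i j s t Ss St st.
have g2 : compatible F (grad2 F v).
  by move=> i j s t Ss St st; have [] := uc i j s t Ss St st.
have pV := paste_V1 hr hn Oopen Ocover Finj Fspline Fjac us vc g1 g2.
have [[p0 pc _] _] := pV.
have pE i s : Sq s -> paste F v (F i s) = v i s by exact: pasteE.
exists (paste F v); split => //.
- exact: (vertex_C2 hr Ocover Popen Finj Fspline Fjac Fx xP us pE p0 pc uj).
- move=> m1 m2 m12.
  exact: (vertex_cvg hr Popen Finj Fspline Fjac Fx pE uj m12).
Qed.

End Interpolation.

(** * Quarter turns of the parameter square *)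

Section Rotation.
Variable R : realType.
Implicit Types (z w : R * R) (G : R * R -> R * R).

Lemma rotnD k m z : rotn (k + m) z = rotn k (rotn m z).
Proof. exact: iterD. Qed.

Lemma rotn4 z : rotn 4 z = z.
Proof. by case: z => a b; rewrite /rotn /rot/=; congr pair; ring. Qed.

Lemma rotn_mod4 m : exists a : 'I_4, forall z, rotn m z = rotn a z.
Proof.
exists (inord (m %% 4)) => z; rewrite inordK ?ltn_mod// {1}(divn_eq m 4).
elim: (m %/ 4)%N => // q IH; by rewrite mulSn -addnA rotnD rotn4 IH.
Qed.

Lemma rotn_diff (k : 'I_4) a : exists b : 'I_4, forall z, rotn a z = rotn k (rotn b z).
Proof.
have [b bE] := rotn_mod4 (a + (4 - k)); exists b => z.
rewrite -bE -rotnD addnCA subnKC; last exact: ltnW.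
by rewrite rotnD rotn4.
Qed.

Lemma rotn_inv (k : 'I_4) : exists b : 'I_4,
  (forall z, rotn k (rotn b z) = z) /\ (forall z, rotn b (rotn k z) = z).
Proof.
have [b bE] := rotn_mod4 (4 - k); exists b.
have k4 := ltnW (ltn_ord k).
by split=> z; rewrite -bE -rotnD ?subnKC ?subnK// rotn4.
Qed.

Lemma rotn_Sq k z : Sq z -> Sq (rotn k z).
Proof.
by move=> Sz; elim: k => // k [h1 h2]; split => //; apply/I01_rev.
Qed.

Lemma rotn_Sqo k z : Sqo z -> Sqo (rotn k z).
Proof.
move=> Sz; elim: k => // k [h1 h2]; split => //.
by move: h2; rewrite /I01o/= !in_itv/= => /andP[a b]; apply/andP; split; lra.
Qed.

Lemma rotn_image (k : 'I_4) G (S : set (R * R)) :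
  (forall m z, S z -> S (rotn m z)) -> (G \o rotn k) @` S = G @` S.
Proof.
move=> SR; apply/seteqP; split => _ [z Sz <-].
  by exists (rotn k z) => //; exact: SR.
have [b [kb _]] := rotn_inv k.
by exists (rotn b z); [exact: SR|rewrite /= kb].
Qed.

Lemma rotn_values (a : 'I_4) (t : R) :
  [\/ [/\ a = 0%N :> nat, rotn a (t, 0) = (t, 0) & rotn a (0, t) = (0, t)],
      [/\ a = 1%N :> nat, rotn a (t, 0) = (1, t) & rotn a (0, t) = (1 - t, 0)],
      [/\ a = 2%N :> nat, rotn a (t, 0) = (1 - t, 1) & rotn a (0, t) = (1, 1 - t)]
    | [/\ a = 3%N :> nat, rotn a (t, 0) = (0, 1 - t) & rotn a (0, t) = (t, 1)]].
Proof.
case: a => -[|[|[|[|//]]]] i; [constructor 1|constructor 2|constructor 3|constructor 4];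
  split => //; rewrite /rotn /rot/=; congr pair; ring.
Qed.

Variables (p r n : nat).
Hypotheses (hr : (1 <= r)%N) (hn : (1 <= n)%N).

Lemma spline2_rotn k (f : R * R -> R) :
  spline2 p r n f -> spline2 p r n (f \o @rotn R k).
Proof.
by elim: k f => // k IH f sf; exact: (IH _ (spline2_rot hn sf)).
Qed.

Lemma d2_rot (f : R * R -> R) z : spline2 p r n f -> Sq z ->
  d2 (f \o @rot R) z = - d1 f (rot z).
Proof.
move=> sf [z1 z2]; have Sz : Sq (rot z) by split => //; apply/I01_rev.
have [c _ _ _] := spline2_C1 hr hn sf; apply: cara1_deriv01 => //.
apply: (@cara1_rev _ (fun s => f (s, z.1))).
by apply: (cara_line1 _ (c _ Sz)) => t It; split.
Qed.

(** A quarter turn replaces the pair of partial derivatives (d1, d2) by (d2, -d1), which preserves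
    the determinant. *)
Lemma jac_rotn (J : finType) (H : J -> R * R -> R * R) j k z :
  spline2 p r n (fst \o H j) -> spline2 p r n (snd \o H j) -> Sq z ->
  jac (fun j => H j \o @rotn R k) j z = jac H j (rotn k z).
Proof.
elim: k H z => // k IH H z s1 s2 Sz.
rewrite -[LHS]/(jac (fun j => (H j \o @rot R) \o @rotn R k) j z).
rewrite (IH (fun j => H j \o @rot R)); last first.
- exact: Sz.
- exact: (spline2_rot hn s2).
- exact: (spline2_rot hn s1).
have Sk := rotn_Sq k Sz.
rewrite /jac -[fst \o (H j \o _)]/((fst \o H j) \o @rot R).
rewrite -[snd \o (H j \o _)]/((snd \o H j) \o @rot R) !d2_rot//.
rewrite -[d1 ((fst \o H j) \o _) _]/(d2 (fst \o H j) (rot (rotn k z))).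
rewrite -[d1 ((snd \o H j) \o _) _]/(d2 (snd \o H j) (rot (rotn k z))).
rewrite -[rotn k.+1 z]/(rot (rotn k z)); ring.
Qed.

(** [S] stands for open or closed intervals and [SE] for their symmetry under s -> 1 - s, so that
    both kinds of cells are treated at once. *)
Lemma cell_rot (S : R -> R -> set R)
    (SE : forall (a b : nat) (s : R), (a <= n)%N -> (b <= n)%N ->
    S (a%:R / n%:R) (b%:R / n%:R) (1 - s) <-> S ((n - b)%:R / n%:R) ((n - a)%:R / n%:R) s)
    G (j k : 'I_n) :
  (G \o @rot R) @` (S (j%:R / n%:R) (j.+1%:R / n%:R) `*` S (k%:R / n%:R) (k.+1%:R / n%:R)) =
  G @` (S ((rev_ord k)%:R / n%:R) ((rev_ord k).+1%:R / n%:R) `*`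
        S (j%:R / n%:R) (j.+1%:R / n%:R)).
Proof.
have kn := ltn_ord k; have E : (rev_ord k).+1 = (n - k)%N by rewrite /= subnSK.
apply/seteqP; split => _ [z [z1 z2] <-].
  exists (rot z) => //; split => //=; rewrite E.
  by apply/SE; rewrite ?leq_subr// ?subKn// ltnW.
exists (z.2, 1 - z.1); last first.
  rewrite /= /rot /=; congr G; case: z {z1 z2} => a b /=.
  by congr pair; ring.
split => //=; move: z1; rewrite E /= => z1.
by apply/SE => //; exact: ltnW.
Qed.

Lemma ocell_rotn G m (j k : 'I_n) : exists j' k' : 'I_n,
  (G \o @rotn R m) @` (ocell j k) = G @` (ocell j' k') /\
  (G \o @rotn R m) @` (cell j k) = G @` (cell j' k').
Proof.
have n0 : (0 : R) < n%:R by rewrite ltr0n.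
elim: m G => [|m IH] G; first by exists j, k.
have [j' [k' [e1 e2]]] := IH (G \o @rot R); exists (rev_ord k'), j'.
rewrite -[G \o _]/((G \o @rot R) \o @rotn R m) e1 e2; split.
- apply: (@cell_rot (fun a b => [set` `]a, b[])) => a b s an bn.
  rewrite /= !in_itv/= !natrB// !mulrBl divff ?gt_eqF//.
  by split => /andP[h1 h2]; apply/andP; split; lra.
- apply: (@cell_rot (fun a b => [set` `[a, b]])) => a b s an bn.
  rewrite /= !in_itv/= !natrB// !mulrBl divff ?gt_eqF//.
  by split => /andP[h1 h2]; apply/andP; split; lra.
Qed.

End Rotation.

Section RotatedFamily.
Variables (R : realType) (p r n : nat) (I : finType).
Variables (Omega : set (R * R)) (F : I -> R * R -> R * R) (k : I -> 'I_4).
Hypotheses (hr : (1 <= r)%N) (hn : (1 <= n)%N).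

(** Each patch has its own rotation, to be chosen so that the vertex becomes the corner (0, 0). *)
Definition rotF i := F i \o @rotn R (k i).

Lemma rotF_inv i : exists b : 'I_4, F i = rotF i \o @rotn R b.
Proof.
have [b [kb _]] := rotn_inv R (k i); exists b.
by apply/funext => z; rewrite /rotF /= kb.
Qed.

Lemma elt_rotF i (j l : 'I_n) : exists j' l' : 'I_n,
  elt (rotF) i j l = elt F i j' l' /\ celt (rotF) i j l = celt F i j' l'.
Proof. exact: (ocell_rotn hn (F i) (k i) j l). Qed.

Lemma elt_rotF' i (j l : 'I_n) : exists j' l' : 'I_n,
  elt F i j l = elt (rotF) i j' l' /\ celt F i j l = celt (rotF) i j' l'.
Proof.
have [b bE] := rotF_inv i.
have [j' [l' [e1 e2]]] := ocell_rotn hn (rotF i) b j l; exists j', l'.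
by rewrite /elt /celt bE; split.
Qed.

Lemma elts_rotF : elts n (rotF) = elts n F.
Proof.
apply/seteqP; split => z [i [j [l e]]].
  by have [j' [l' [E _]]] := elt_rotF i j l; exists i, j', l'; rewrite -E.
by have [j' [l' [E _]]] := elt_rotF' i j l; exists i, j', l'; rewrite -E.
Qed.

Lemma smooth_rotF f : piecewise_smooth n (rotF) f <-> piecewise_smooth n F f.
Proof.
split => sf i j l w.
  by have [j' [l' [-> ->]]] := elt_rotF' i j l; exact: sf.
by have [j' [l' [-> ->]]] := elt_rotF i j l; exact: sf.
Qed.

Lemma C2_rotF x f : C2_at n Omega (rotF) x f <-> C2_at n Omega F x f.
Proof.
by split => -[f0 fs fc fl]; split => //;
  [exact/smooth_rotF|rewrite -elts_rotF|exact/smooth_rotF|rewrite elts_rotF].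
Qed.

Lemma V1_rotF f : V1 p r n Omega (rotF) f -> V1 p r n Omega F f.
Proof.
move=> [[f0 fc fs] f1]; split => //; split => // i.
have [b bE] := rotF_inv i; rewrite bE.
exact: (spline2_rotn hn b (fs i)).
Qed.

Lemma cpatch_rotF i : cpatch (rotF) i = cpatch F i.
Proof. by apply: rotn_image => m z; exact: rotn_Sq. Qed.

Lemma patch_rotF i : patch (rotF) i = patch F i.
Proof. by apply: rotn_image => m z; exact: rotn_Sqo. Qed.

End RotatedFamily.

(** * The projector *)

Lemma near_eq_differentiable (R : realType) (f g : R * R -> R) z :
  {near z, f =1 g} -> differentiable f z -> differentiable g z.
Proof.
move=> fg df; have /diff_locallyP[dc dE] := df.
have E e : 0 < e -> \forall y \near (0 : R * R),
    `|(g \o shift z - (cst (g z) + 'd f z)) y| <= e * `|y|.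
  move=> e0; move/eqaddoP: dE => /(_ e e0) dE.
  have sz : shift z @ (0 : R * R) --> z.
    apply: (@cvg_to_eq _ _ _ _ (0 + z)); first by rewrite add0r.
    by apply: cvgD; [exact: cvg_id|exact: cvg_cst].
  have fgz := sz _ fg.
  near=> y; have -> : (g \o shift z - (cst (g z) + 'd f z)) y =
      (f \o shift z - (cst (f z) + 'd f z)) y.
    rewrite !fctE /=; congr (_ - (_ + _)).
      by apply/esym; near: y; exact: fgz.
    by apply/esym; exact: (nbhs_singleton fg).
  by near: y; exact: dE.
have dgE : 'd g z = 'd f z :> (_ -> _).
  apply: (@diff_unique R (R * R)%type R g ('d f z) z) => //.
  by apply/eqaddoP => e /E.
apply/diff_locallyP; rewrite dgE; split; first exact: dc.
by apply/eqaddoP => e /E.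
Unshelve. all: by end_near. Qed.

Section LinearStructure.
Variables (R : realType) (p r n : nat) (I : finType).
Variables (Omega : set (R * R)) (F : I -> R * R -> R * R) (x : R * R).
Hypothesis eopen : forall i (j k : 'I_n), open (elt F i j k).
Hypothesis eproper : ProperFilter (within (elts n F) (nbhs x)).
Implicit Types (f g : R * R -> R) (a : R).

Lemma V1_lin a f g : V1 p r n Omega F f -> V1 p r n Omega F g ->
  V1 p r n Omega F (a *: f + g).
Proof.
have lincont (h k : R * R -> R) : {within closure Omega, continuous h} ->
    {within closure Omega, continuous k} ->
    {within closure Omega, continuous (a *: h + k)}.
  move=> /subspace_continuousP hc /subspace_continuousP kc.
  apply/subspace_continuousP => z Oz.
  by apply: cvgD; [apply: cvgM; [exact: cvg_cst|exact: hc]|exact: kc].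
move=> [[f0 fc fs] [f1 [f2 [fc1 fc2 fd]]]] [[g0 gc gs] [g1 [g2 [gc1 gc2 gd]]]].
split; first split.
- move=> z nz; change (a * f z + g z = 0); rewrite f0// g0//; ring.
- exact: lincont.
- move=> i; exact: (spline2_lin a (fs i) (gs i)).
exists (a *: f1 + g1), (a *: f2 + g2); split; [exact: lincont|exact: lincont|].
move=> z Oz; have [h1 h2] := fd z Oz; have [k1 k2] := gd z Oz.
by split; apply: is_deriveD; exact: is_deriveZ.
Qed.

(** Linearity is available only where the derivatives exist, on the elements; their openness lets
    the induction hypothesis hold near [z]. *)
Lemma partials_lin a f g w : piecewise_smooth n F f -> piecewise_smooth n F g ->
  forall z, elts n F z -> partials w (a *: f + g) z = a * partials w f z + partials w g z.
Proof.
move=> sf sg; elim: w => // b w IH z [i [j [k ez]]].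
rewrite /= -!/(partials w _) /partial.
set v := if b then _ else _.
have [/(_ _ ez) df _] := sf i j k w; have [/(_ _ ez) dg _] := sg i j k w.
rewrite (@near_eq_derive _ _ _ _ (a *: partials w f + partials w g)); last first.
  have : nbhs z (elt F i j k) by apply: open_nbhs_nbhs.
  by apply: filterS => y ey; apply: IH; exists i, j, k.
have dvf : derivable (partials w f) z v by exact: diff_derivable.
have dvg : derivable (partials w g) z v by exact: diff_derivable.
by rewrite deriveD ?deriveZ//; exact: derivableZ.
Qed.

Lemma pderivE m1 m2 f : pderiv m1 m2 f = partials (word m1 m2) f.
Proof.
rewrite /pderiv /word /partials foldr_cat.
have nE m b h : foldr (@partial R) h (nseq m b) = iter m (@partial R b) h.
  by elim: m => //= m ->.
by rewrite !nE.
Qed.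

Lemma pderiv_lin_cvg a f g m1 m2 k l :
  piecewise_smooth n F f -> piecewise_smooth n F g ->
  pderiv m1 m2 f @ within (elts n F) (nbhs x) --> (k : R) ->
  pderiv m1 m2 g @ within (elts n F) (nbhs x) --> (l : R) ->
  pderiv m1 m2 (a *: f + g) @ within (elts n F) (nbhs x) --> a * k + l.
Proof.
rewrite !pderivE => sf sg fk gl.
apply: (@near_cvg_eq _ _ _ _ _
    (fun z => a * partials (word m1 m2) f z + partials (word m1 m2) g z)).
  rewrite near_withinE; apply: nearW => z ez; exact: partials_lin.
by apply: cvgD => //; apply: cvgM => //; exact: cvg_cst.
Qed.

Lemma smooth_lin a f g : piecewise_smooth n F f -> piecewise_smooth n F g ->
  piecewise_smooth n F (a *: f + g).
Proof.
move=> sf sg i j k w.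
have wE z : elt F i j k z -> partials w (a *: f + g) z =
    a * partials w f z + partials w g z.
  by move=> ez; apply: partials_lin => //; exists i, j, k.
have [df cf] := sf i j k w; have [dg cg] := sg i j k w.
split=> z ez.
- have dfg : differentiable (a *: partials w f + partials w g) z.
    by apply: differentiableD; [apply: differentiableZ; exact: df|exact: dg].
  have nz : nbhs z (elt F i j k) by apply: open_nbhs_nbhs.
  have nw : {near z, (a *: partials w f + partials w g) =1 partials w (a *: f + g)}.
    by apply: filterS nz => y /wE ->.
  exact: (near_eq_differentiable nw dfg).
- have /cvg_ex[k1 h1] := cf z ez; have /cvg_ex[k2 h2] := cg z ez.
  apply/cvg_ex; exists (a * k1 + k2).
  apply: (@near_cvg_eq _ _ _ _ _ (fun z => a * partials w f z + partials w g z)).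
    by rewrite near_withinE; apply: nearW => y /wE.
  by apply: cvgD => //; apply: cvgM => //; exact: cvg_cst.
Qed.

Lemma C2_lin a f g : C2_at n Omega F x f -> C2_at n Omega F x g ->
  C2_at n Omega F x (a *: f + g).
Proof.
move=> [f0 sf fc fl] [g0 sg gc gl]; split.
- move=> z nz; change (a * f z + g z = 0); rewrite f0// g0//; ring.
- exact: smooth_lin.
- by apply: cvgD => //; apply: cvgM => //; exact: cvg_cst.
- move=> m1 m2 m12; have /cvg_ex[k hk] := fl _ _ m12; have /cvg_ex[l hl] := gl _ _ m12.
  by apply/cvg_ex; exists (a * k + l); exact: pderiv_lin_cvg.
Qed.

Lemma pderiv_at_eq f m1 m2 (l : R) :
  pderiv m1 m2 f @ within (elts n F) (nbhs x) --> l -> pderiv_at n F m1 m2 f x = l.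
Proof. by move=> fl; apply: cvg_lim => //; exact: norm_hausdorff. Qed.

Lemma pderiv_at_lin a f g m1 m2 : (m1 + m2 <= 2)%N ->
  C2_at n Omega F x f -> C2_at n Omega F x g ->
  pderiv_at n F m1 m2 (a *: f + g) x =
    a * pderiv_at n F m1 m2 f x + pderiv_at n F m1 m2 g x.
Proof.
move=> m12 [_ sf _ fl] [_ sg _ gl].
have /cvg_ex[k hk] := fl _ _ m12; have /cvg_ex[l hl] := gl _ _ m12.
rewrite (pderiv_at_eq hk) (pderiv_at_eq hl); apply: pderiv_at_eq.
exact: pderiv_lin_cvg.
Qed.

Hypothesis interpolation : forall c, exists f, [/\ V1 p r n Omega F f,
  C2_at n Omega F x f & forall m1 m2, (m1 + m2 <= 2)%N ->
    pderiv m1 m2 f @ within (elts n F) (nbhs x) --> (jet_coef c m1 m2 : R)].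

Definition order (k : 'I_6) : nat * nat :=
  nth (0, 0)%N [:: (0, 0); (1, 0); (0, 1); (2, 0); (1, 1); (0, 2)]%N k.

Lemma order_le2 k : ((order k).1 + (order k).2 <= 2)%N.
Proof. by case: k => -[|[|[|[|[|[|//]]]]]]. Qed.

Lemma orderP m1 m2 : (m1 + m2 <= 2)%N -> exists k, order k = (m1, m2).
Proof.
case: m1 => [|[|[|//]]]; case: m2 => [|[|[|//]]] // _.
- by exists (@Ordinal 6 0 isT).
- by exists (@Ordinal 6 2 isT).
- by exists (@Ordinal 6 5 isT).
- by exists (@Ordinal 6 1 isT).
- by exists (@Ordinal 6 4 isT).
- by exists (@Ordinal 6 3 isT).
Qed.

Let jet (k : 'I_6) f := pderiv_at n F (order k).1 (order k).2 f x.

(** The six interpolants are dual to the six derivatives at the vertex, listed by [order]. *)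
Lemma dual_basis : exists b : 'I_6 -> R * R -> R, forall k,
  [/\ V1 p r n Omega F (b k), C2_at n Omega F x (b k)
    & forall l, jet l (b k) = (l == k)%:R].
Proof.
suff H k : exists f, [/\ V1 p r n Omega F f, C2_at n Omega F x f
    & forall l, jet l f = (l == k)%:R].
  by have [b bP] := choice H; exists b.
pose d (l : nat) : R := (l == k)%:R.
have [f [fV fC fj]] :=
  (* The halves cancel the factor 2 from differentiating the squares. *)
  interpolation ((d 0%N, d 1%N, d 2%N), (d 3%N / 2, d 4%N, d 5%N / 2)).
exists f; split => // l; rewrite /jet (pderiv_at_eq (fj _ _ (order_le2 l))).
have half (y : R) : (y / 2) *+ 2 = y by rewrite -mulr_natr mulfVK// pnatr_eq0.
rewrite -(inj_eq val_inj) /=.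
by case: l => -[|[|[|[|[|[|//]]]]]] /= _; rewrite ?half.
Qed.

(** [Pi] sums the dual basis weighted by the derivatives at the vertex. Duality gives linear
    independence, idempotence and preservation of the 2-jet. *)
Theorem interpolating_projector : exists (A : set (R * R -> R))
    (Pi : (R * R -> R) -> (R * R -> R)),
  [/\ A `<=` V1 p r n Omega F, dimension 6 A, projector (C2_at n Omega F x) A Pi
    & forall f, C2_at n Omega F x f -> forall m1 m2, (m1 + m2 <= 2)%N ->
        pderiv_at n F m1 m2 (Pi f) x = pderiv_at n F m1 m2 f x].
Proof.
have [b bP] := dual_basis.
have [Z0 ZC] : V1 p r n Omega F 0 /\ C2_at n Omega F x 0.
  have [v1 c2 _] := bP ord0; rewrite -(addNr (b ord0)) -scaleN1r.
  by split; [exact: V1_lin|exact: C2_lin].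
have jet0 k : jet k 0 = 0.
  have := pderiv_at_lin 1 (order_le2 k) ZC ZC; rewrite scale1r addr0 mul1r.
  by move/eqP; rewrite -subr_eq0 opprD addrA subrr sub0r oppr_eq0 => /eqP.
have sumP (c : 'I_6 -> R) (s : seq 'I_6) : [/\ V1 p r n Omega F (\sum_(k <- s) c k *: b k),
    C2_at n Omega F x (\sum_(k <- s) c k *: b k)
  & forall l, jet l (\sum_(k <- s) c k *: b k) = \sum_(k <- s) c k * (l == k)%:R].
  elim: s => [|k s [sV sC sj]].
    by rewrite !big_nil; split => // l; rewrite big_nil jet0.
  have [bV bC bj] := bP k; rewrite !big_cons; split.
  - exact: V1_lin.
  - exact: C2_lin.
  - move=> l; rewrite big_cons -sj -bj; exact: pderiv_at_lin (order_le2 l) bC sC.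
have jetS (c : 'I_6 -> R) l : jet l (\sum_k c k *: b k) = c l.
  have [_ _ ->] := sumP c (index_enum 'I_6).
  rewrite (bigD1 l)//= eqxx mulr1 big1 ?addr0// => k kl.
  by rewrite eq_sym (negbTE kl) mulr0.
pose Pi f := \sum_k jet k f *: b k.
exists [set f | exists c : 'I_6 -> R, f = \sum_k c k *: b k], Pi; split.
- by move=> _ [c ->]; have [] := sumP c (index_enum 'I_6).
- exists b; split => // c c0 k; by rewrite -(jetS c k) c0 jet0.
- split.
  + move=> a f g fC gC; rewrite /Pi scaler_sumr -big_split/=; apply: eq_bigr => k _.
    rewrite /jet (pderiv_at_lin a (order_le2 k) fC gC).
    by rewrite scalerDl scalerA.
  + apply/seteqP; split => [_ [f fC <-]|_ [c ->]]; first by exists (jet ^~ f).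
    exists (\sum_k c k *: b k); first by have [] := sumP c (index_enum 'I_6).
    by rewrite /Pi; apply: eq_bigr => k _; rewrite jetS.
  + by move=> _ [c ->]; have [] := sumP c (index_enum 'I_6).
  + by move=> f fC; rewrite /Pi; apply: eq_bigr => k _; rewrite jetS.
- move=> f fC m1 m2 /orderP[k mE].
  by have := jetS (jet ^~ f) k; rewrite /jet mE.
Qed.

End LinearStructure.

(** * Patches around the vertex *)

Section Star.
Variables (R : realType) (p r n : nat) (I : finType).
Variables (Omega : set (R * R)) (F : I -> R * R -> R * R).
Hypotheses (hr : (1 <= r)%N) (hn : (1 <= n)%N).
Hypotheses (MP : multipatch p r n Omega F) (AS : AS_G1 F).
Variable x : R * R.
Hypothesis Vx : vertex F x.

Let Fjac i z : Sq z -> jac F i z != 0.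
Proof.
move=> Sz; have := mp_jacobian MP i Sz.
have [-> ->] := d12F hr hn (mp_spline MP) i Sz.
by rewrite /det2 /jac /= => /gt_eqF ->.
Qed.

Lemma side_inter (k l : 'I_4) (s t : R) : k <> l -> side k s = side l t ->
  exists m : 'I_4, side k s = corner R m.
Proof.
move=> kl st.
suff [s0|s1] : s = 0 \/ s = 1.
- by exists k; rewrite s0.
- have [m mE] := rotn_mod4 R (k + 1); exists m.
  rewrite /corner -mE rotnD s1 /side; congr (rotn k _).
  by rewrite /rotn /rot/=; congr pair; ring.
have {}kl : k <> l :> nat by move=> /val_inj.
move: st; rewrite /side.
by case: (rotn_values k s) => -[k0 -> _]; case: (rotn_values l t) => -[l0 -> _];
  rewrite k0 l0 in kl => // -[e1 e2];
  first [left; lra|right; lra|exfalso; lra].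
Qed.

(** A corner of one patch is not a priori a corner of the others. The star gives two distinct edges
    of each patch through [x]; by injectivity of the chart, the point is common to two sides of the
    square, hence a corner. *)
Lemma vertex_corner i : cpatch F i x -> exists k : 'I_4, F i (rotn k (0, 0)) = x.
Proof.
move=> ix; have [nu [s [e [_ _ sP eP _]]]] := mp_star MP Vx.
have [l ln si] := (sP i).1 ix.
have [ee e1 e2 [k kE] [k' kE']] := eP l ln.
have kk' : k <> k' by move=> kk; apply: ee; rewrite kE kE' kk.
move: e1 e2; rewrite kE kE' si => -[a Ia aE] [b Ib bE].
have Sside m c : I01 c -> @Sq R (side m c).
  by move=> Ic; apply: rotn_Sq; split => //; exact: I01_0.
have ab : side k a = side k' b.
  by apply: (mp_inj MP (i := i)); rewrite ?inE ?aE ?bE//; exact: Sside.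
have [m mE] := side_inter kk' ab; exists m.
by rewrite -[rotn m _]/(corner R m) -mE aE.
Qed.

(** Patches away from [x] keep their parametrization, through the default [ord0]. *)
Definition kx i : 'I_4 :=
  if pselect (exists k : 'I_4, F i (rotn k (0, 0)) = x) is left e
  then projT1 (cid e) else ord0.

Let G := rotF F kx.

Lemma G_x i : cpatch G i x -> G i (0, 0) = x.
Proof.
rewrite cpatch_rotF => /vertex_corner e; rewrite /G /rotF /= /kx.
by case: pselect => // e'; case: (cid e').
Qed.

Let Gin i : cpatch G i x <-> cpatch F i x. Proof. by rewrite cpatch_rotF. Qed.

Lemma G_inj i : {in @Sq R &, injective (G i)}.
Proof.
move=> z w; rewrite !inE => Sz Sw zw.
have [b [_ kb]] := rotn_inv R (kx i).
rewrite -(kb z) -(kb w); congr (rotn b _).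
by apply: (mp_inj MP (i := i)); rewrite ?inE//; exact: rotn_Sq.
Qed.

Lemma G_spline i : spline2 p r n (fst \o G i) /\ spline2 p r n (snd \o G i).
Proof.
have [s1 s2] := mp_spline MP i.
by split; [exact: (spline2_rotn hn (kx i) s1)|exact: (spline2_rotn hn (kx i) s2)].
Qed.

Lemma G_jac i z : Sq z -> jac G i z != 0.
Proof.
move=> Sz; have [s1 s2] := mp_spline MP i.
rewrite -[jac G i z]/(jac (fun j => F j \o @rotn R (kx i)) i z).
by rewrite (jac_rotn hr hn _ s1 s2 Sz) Fjac//; exact: rotn_Sq.
Qed.

Let S0 : Sq (0 : R, 0 : R). Proof. by split; exact: I01_0. Qed.
Let SL t : I01 t -> @Sq R (0, t). Proof. by split => //; exact: I01_0. Qed.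
Let SB t : I01 t -> @Sq R (t, 0). Proof. by split => //; exact: I01_0. Qed.
Let Srot (m : 'I_4) z : Sq z -> @Sq R (rotn m z). Proof. exact: rotn_Sq. Qed.

Let G_eq i z w : Sq z -> Sq w -> G i z = G i w -> z = w.
Proof. by move=> Sz Sw; apply: G_inj; rewrite inE. Qed.

Definition left_side i : set (R * R) := (fun t => G i (0, t)) @` @I01 R.
Definition bottom_side i : set (R * R) := (fun t => G i (t, 0)) @` @I01 R.

Lemma F_rotn i a : exists b : 'I_4, forall z, F i (rotn a z) = G i (rotn b z).
Proof.
have [b bE] := rotn_diff R (kx i) a; exists b => z.
by rewrite bE.
Qed.

Lemma rotn_zero (a : 'I_4) (t : R) :
  (rotn a (t, 0) = (0, 0) -> (a = 0%N :> nat /\ t = 0) \/ (a = 3%N :> nat /\ t = 1)) /\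
  (rotn a (0, t) = (0, 0) -> (a = 0%N :> nat /\ t = 0) \/ (a = 1%N :> nat /\ t = 1)).
Proof.
case: (rotn_values a t) => -[a0 -> ->]; split => e;
  have e1 := congr1 fst e; have e2 := congr1 snd e; rewrite /= in e1 e2;
  first [by left; split; [exact: a0|lra]|by right; split; [exact: a0|lra]
    |by move/eqP: e1; rewrite oner_eq0|by move/eqP: e2; rewrite oner_eq0].
Qed.

(** After rotation the vertex has the only parameter (0, 0), which lies on the left and bottom sides
    alone. *)
Lemma cedge_x i (k : 'I_4) : cedge F i k x ->
  cedge F i k = left_side i \/ cedge F i k = bottom_side i.
Proof.
move=> kx0; have [b bE] := F_rotn i k.
have [t It tx] := kx0.
have ix : cpatch F i x by exists (side k t) => //; apply: rotn_Sq; exact: SB.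
have Gx := G_x ((Gin i).2 ix).
have cE : cedge F i k = (fun t => G i (rotn b (t, 0))) @` @I01 R.
  by congr image; apply/funext => s; rewrite /side bE.
move: tx; rewrite /side bE -Gx => /(G_eq (Srot b (SB It)) S0).
move=> /(proj1 (rotn_zero b t))[[b0 _]|[b3 _]]; [right|left]; rewrite cE.
  have -> : b = @Ordinal 4 0 isT by exact: val_inj.
  by [].
have e3 y : rotn b (y, 0) = (0, 1 - y).
  by case: (rotn_values b y) => -[b' e1 _] //; move: b'; rewrite b3.
apply/seteqP; split => _ [s Is <-]; exists (1 - s); try exact/I01_rev.
  by rewrite e3.
by rewrite e3 subKr.
Qed.

Lemma star_sides i l (nu : nat) (s : nat -> I) (e : nat -> set (R * R)) :
  s l = i -> [/\ e l <> e l.+1, e l x, e l.+1 x,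
    exists k, e l = cedge F (s l) k & exists k, e l.+1 = cedge F (s l) k] ->
  (left_side i = e l \/ left_side i = e l.+1) /\
  (bottom_side i = e l \/ bottom_side i = e l.+1).
Proof.
move=> <- [ne e1 e2 [k kE] [k' kE']]; move: e1 e2 ne; rewrite kE kE' => e1 e2 ne.
have := cedge_x e1; have := cedge_x e2 => -[] h1 [] h2; rewrite h1 h2 in ne *;
  by split; auto.
Qed.

(** An edge through [x] belongs to at most two patches. Each patch has it as its first or its second
    edge in the star; two of any three patches have it in the same position, and injectivity of the
    edge sequence identifies them. *)
Lemma star_unique (E : set (R * R)) i j m :
  cpatch F i x -> cpatch F j x -> cpatch F m x ->
  E = left_side i \/ E = bottom_side i -> E = left_side j \/ E = bottom_side j ->
  E = left_side m \/ E = bottom_side m -> [\/ i = j, i = m | j = m].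
Proof.
move=> ix jx mx Ei Ej Em; have [nu [s [e [nu0 sinj sP eP eI]]]] := mp_star MP Vx.
have H k : cpatch F k x -> E = left_side k \/ E = bottom_side k ->
    exists l, [/\ (l < nu)%N, s l = k & E = e l \/ E = e l.+1].
  move=> kx0 Ek; have [l ln sk] := (sP k).1 kx0; exists l; split => //.
  by have [h1 h2] := star_sides nu sk (eP l ln); case: Ek => ->.
have [a [an sa Ea]] := H i ix Ei; have [b [bn sb Eb]] := H j jx Ej.
have [c [cn sc Ec]] := H m mx Em.
have einj k l : (k < nu)%N -> (l < nu)%N -> e k = e l -> k = l.
  move=> kn ln; case: eI => [[_ inj _]|[_ inj _ _]]; apply: inj; rewrite inE //.
    exact: ltnW.
  exact: ltnW.
(* At an interior vertex the sequence is injective only below [nu], so the index that wraps around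
   to 0 is treated apart. *)
have einj' k l : (k < nu)%N -> (l < nu)%N -> e k.+1 = e l.+1 -> k = l.
  move=> kn ln; case: eI => [[_ inj enu]|[_ inj _ _]] kl; last first.
    by apply: succn_inj; apply: inj kl; rewrite inE.
  have [kn'|] := ltnP k.+1 nu; have [ln'|] := ltnP l.+1 nu.
  - by apply: succn_inj; apply: inj kl; rewrite inE.
  - move=> nl; have lE : l.+1 = nu by apply/eqP; rewrite eqn_leq ln nl.
    move: kl; rewrite lE enu => kl.
    by have : k.+1 = 0%N by apply: inj kl; rewrite inE.
  - move=> nk; have kE : k.+1 = nu by apply/eqP; rewrite eqn_leq kn nk.
    move: kl; rewrite kE enu => kl.
    by have : 0%N = l.+1 by apply: inj kl; rewrite inE.
  - by move=> nl nk; apply: succn_inj; apply/eqP; rewrite eqn_leq (leq_trans kn nl) (leq_trans ln nk).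
rewrite -sa -sb -sc.
case: Ea Eb Ec => -> [] e1 [] e2.
- by constructor 1; rewrite (einj _ _ an bn e1).
- by constructor 1; rewrite (einj _ _ an bn e1).
- by constructor 2; rewrite (einj _ _ an cn e2).
- by constructor 3; rewrite (einj' _ _ bn cn (etrans (esym e1) e2)).
- by constructor 3; rewrite (einj _ _ bn cn (etrans (esym e1) e2)).
- by constructor 2; rewrite (einj' _ _ an cn e2).
- by constructor 1; rewrite (einj' _ _ an bn e1).
- by constructor 1; rewrite (einj' _ _ an bn e1).
Qed.

Lemma next_side i j : next G x i j ->
  [/\ i <> j, cpatch F i x, cpatch F j x & left_side i = bottom_side j].
Proof.
move=> [ij /Gin ix /Gin jx [e _]]; split => //.
by apply/seteqP; split => _ [t It <-]; exists t => //; rewrite e.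
Qed.

Lemma G_next_inj i j j' : next G x i j -> next G x i j' -> j = j'.
Proof.
move=> /next_side[ij ix jx e] /next_side[ij' _ jx' e'].
by have [] := @star_unique (left_side i) i j j' ix jx jx'
  (or_introl erefl) (or_intror e) (or_intror e').
Qed.

Lemma G_next_inj' i i' j : next G x i j -> next G x i' j -> i = i'.
Proof.
move=> /next_side[ij ix jx e] /next_side[ij' ix' _ e'].
have [//|ji|ji] := @star_unique (bottom_side j) i i' j ix ix' jx
  (or_introl (esym e)) (or_introl (esym e')) (or_intror erefl); by [case: ij|case: ij'].
Qed.

Lemma glued_left i j : standard_form (G i) (G j) -> AS_G1_gluing (G i) (G j) ->
  glued G i j.
Proof.
move=> sf [a1 [a2 [b1 [b2 [sa sb _ gl]]]]]; split => //.
exists a1, a2, b1, b2; split => // t It; have [pos e] := gl t It => //.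
by apply: contraTneq pos => ->; rewrite mul0r ltxx.
Qed.

Lemma size_rev (q : {poly R}) : (size q <= 2)%N -> (size (q \Po (1 - 'X)) <= 2)%N.
Proof.
move=> sq; apply: leq_trans (size_comp_poly_leq _ _) _; rewrite ltnS.
have -> : size (1 - 'X : {poly R}) = 2%N.
  by rewrite -opprB size_polyN -polyC1 size_XsubC.
by rewrite muln1; case: (size q) sq.
Qed.

Lemma d2_rotn1 i z : Sq z -> d2 (G i \o @rotn R 1) z = - d1 (G i) (rot z).
Proof.
move=> Sz; have [s1 s2] := G_spline i.
have Hs j : spline2 p r n (fst \o (fun j => G j \o @rot R) j) /\
    spline2 p r n (snd \o (fun j => G j \o @rot R) j).
  by have [h1 h2] := G_spline j; split;
    [exact: (spline2_rot hn h1)|exact: (spline2_rot hn h2)].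
have [_ e2] := d12F hr hn Hs i Sz.
have [e1 _] := d12F hr hn G_spline i (rotn_Sq 1 Sz).
rewrite -[LHS]/(d2 (G i \o @rot R) z) e2 -[rot z]/(rotn 1 z) e1.
rewrite -[fst \o (G i \o _)]/((fst \o G i) \o @rot R).
rewrite -[snd \o (G i \o _)]/((snd \o G i) \o @rot R).
by rewrite (d2_rot hr hn s1 Sz) (d2_rot hr hn s2 Sz).
Qed.

(* The same interface seen from its other end point: the roles of the patches
   are exchanged. *)
Lemma glued_right i j : standard_form (G i \o @rotn R 1) (G j \o @rotn R 3) ->
  AS_G1_gluing (G i \o @rotn R 1) (G j \o @rotn R 3) -> glued G j i.
Proof.
move=> sf [a1 [a2 [b1 [b2 [[sa1 sa2] [sb1 sb2] _ gl]]]]].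
have r1 (y z : R) : rotn 1 (y, z) = (1 - z, y) by [].
have r3 (y z : R) : rotn 3 (y, z) = (z, 1 - y).
  by rewrite /rotn /rot/=; congr pair; ring.
have ji t : I01 t -> G j (0, t) = G i (t, 0).
  move=> It; have e : G i (rotn 1 (0, 1 - t)) = G j (rotn 3 (1 - t, 0)).
    exact: (sf _ ((I01_rev t).2 It)).
  by rewrite r1 r3 !subKr in e.
split => //.
(* Reversing the interface exchanges the factors [alpha] and reverses the tangent, hence the sign of
   the factors [beta]. *)
exists (a2 \Po (1 - 'X)), (a1 \Po (1 - 'X)), (- (b2 \Po (1 - 'X))),
  (- (b1 \Po (1 - 'X))); rewrite !size_polyN; split.
- by split; exact: size_rev.
- by split; exact: size_rev.
- move=> t It; have [pos _] := gl (1 - t) ((I01_rev t).2 It).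
  rewrite horner_comp !hornerE; apply: contraTneq pos => ->.
  by rewrite mulr0 ltxx.
move=> t It; have It' := (I01_rev t).2 It.
have [_] := gl (1 - t) It'.
have -> : d2 (G j \o @rotn R 3) (1 - t, 0) = d1 (G j) (0, t).
  congr (deriv01 _ _); apply/funext => y.
  by change (G j (rotn 3 (1 - t, y)) = G j (y, t)); rewrite r3 subKr.
have -> : d1 (G i \o @rotn R 1) (0, 1 - t) = d2 (G i) (t, 0).
  congr (deriv01 _ _); apply/funext => y.
  by change (G i (rotn 1 (y, 1 - t)) = G i (t, y)); rewrite r1 subKr.
have -> : d2 (G i \o @rotn R 1) (0, 1 - t) = - d2 (G j) (0, t).
  rewrite d2_rotn1; last exact: SL.
  by rewrite (side_deriv hr hn G_spline ji It) /rot /= subKr.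
have h (q : {poly R}) : (q \Po (1 - 'X)).[t] = q.[1 - t].
  by rewrite horner_comp !hornerE.
set v1 := d1 _ _; set v2 := d2 (G i) _; set w := d2 _ _ => e.
have -> : ((a2 \Po (1 - 'X)) * - (b1 \Po (1 - 'X)) +
    (a1 \Po (1 - 'X)) * - (b2 \Po (1 - 'X))).[t] = - (a1 * b2 + a2 * b1).[1 - t].
  by rewrite !(hornerD, hornerM, hornerN) !h; ring.
by rewrite !h scaleNr -scalerN [X in X + _]addrC.
Qed.

(** Conformity makes the intersection a full corner or edge. If [j] misses [x], that corner or edge
    avoids (0, 0) in the chart of [i] and so lies on a far side. If both patches contain [x], it is
    the vertex itself or an interface through it. *)
Lemma G_meet i j s t : i <> j -> Sq s -> Sq t -> G i s = G j t ->
  cpatch G i x ->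
  (~ cpatch G j x /\ (s.1 = 1 \/ s.2 = 1)) \/
  (cpatch G j x /\ [\/ s = (0, 0) /\ t = (0, 0),
     [/\ next G x i j, s = (0, s.2) & t = (s.2, 0)]
   | [/\ next G x j i, t = (0, t.2) & s = (t.2, 0)]]).
Proof.
move=> ij Ss St st Gix; have ix := (Gin i).1 Gix.
have Gxi := G_x Gix.
have GF k z : Sq z -> cpatch F k (G k z) by move=> Sz; exists (rotn (kx k) z) => //; exact: Srot.
have yij : (cpatch F i `&` cpatch F j) (G i s) by split; [exact: GF|rewrite st; exact: GF].
have I0 := @I01_0 R; have I1 := @I01_1 R.
have [jx|njx] := pselect (cpatch F j x); last first.
  left; split; first by move/Gin.
  have [e0|[k [l [_ e]]]|[k [l [e _]]]] := mp_conforming MP ij.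
  - by rewrite e0 in yij.
  - have [b bE] := F_rotn i k.
    have sE : s = rotn b (0, 0).
      apply: (G_eq (i := i)) => //; first exact: Srot.
      by move: (yij); rewrite e /= /corner bE.
    case: (rotn_values b (0 : R)) => -[b0 v _]; rewrite sE v /= ?subr0; try tauto.
    by case: njx; rewrite -Gxi -v -sE; case: yij.
  - have [b bE] := F_rotn i k.
    have cx (c : R) : I01 c -> rotn b (c, 0) <> (0, 0).
      move=> Ic cE; apply: njx; have : (cpatch F i `&` cpatch F j) x; last by case.
      by rewrite e; exists c => //; rewrite /side bE cE.
    move: (yij); rewrite e => -[c Ic cE].
    have sE : s = rotn b (c, 0).
      apply: (G_eq (i := i)) => //; first exact: Srot (SB Ic).
      by rewrite -cE /side bE.
    case: (rotn_values b c) => -[b0 v _]; rewrite sE v /=;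
      [exfalso; apply: (cx _ I0)|by left|by right|exfalso; apply: (cx _ I1)].
    + case: (rotn_values b (0 : R)) => -[b0' v' _];
        first [by rewrite b0 in b0'|exact: v'].
    + case: (rotn_values b (1 : R)) => -[b0' v' _];
        first [by rewrite b0 in b0'|by rewrite v' subrr].
right; split; first exact/Gin.
have Gjx := (Gin j).2 jx; have Gxj := G_x Gjx.
have xij : (cpatch F i `&` cpatch F j) x by [].
have [e0|[k [l [_ e]]]|me] := mp_conforming MP ij.
- by rewrite e0 in yij.
- constructor 1; move: (yij) (xij); rewrite e /= => yE xE.
  split; first by apply: (G_eq (i := i)) => //; rewrite yE -xE.
  by apply: (G_eq (i := j)) => //; rewrite -st yE -xE.
(* The standard form comes with its own rotations [a] and [b], which are re-expressed relative to
   those that bring [x] to (0, 0). *)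
have [a [b /= [e sf gl]]] := AS ij me.
have [a' aE] := F_rotn i a; have [b' bE] := F_rotn j b.
have aF : F i \o @rotn R a = G i \o @rotn R a' by apply/funext => z; exact: aE.
have bF : F j \o @rotn R b = G j \o @rotn R b' by apply/funext => z; exact: bE.
rewrite aF bF in sf gl; move: (xij) (yij); rewrite e => -[c Ic cx] [d Id dy].
rewrite aE in cx; rewrite aE in dy.
have ca : rotn a' (0, c) = (0, 0) by apply: (G_eq (i := i)) => //; [exact: Srot (SL Ic)|rewrite cx].
have cb : rotn b' (c, 0) = (0, 0).
  by apply: (G_eq (i := j)) => //; [exact: Srot (SB Ic)|rewrite Gxj -cx; exact: esym (sf c Ic)].
have sE : s = rotn a' (0, d).
  by apply: (G_eq (i := i)) => //; exact: Srot (SL Id).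
have tE : t = rotn b' (d, 0).
  by apply: (G_eq (i := j)) => //; [exact: Srot (SB Id)|rewrite -st -dy; exact: (sf d Id)].
(* The vertex is the start or the end of the interface. At the start [j] follows [i]; at the end the
   two are exchanged. The mixed cases would place the vertex at both ends. *)
have [[a0 c0]|[a1 c1]] := (rotn_zero a' c).2 ca; have [[b0 c0']|[b3 c1']] := (rotn_zero b' c).1 cb.
- constructor 2; rewrite a0 b0 in sf gl sE tE.
  rewrite sE tE; split => //; split => //; exact: glued_left.
- by exfalso; move/eqP: c0; rewrite c1' oner_eq0.
- by exfalso; move/eqP: c1; rewrite c0' eq_sym oner_eq0.
- constructor 3; rewrite a1 b3 in sf gl sE tE.
  have tE' : t = (0, 1 - d) by rewrite tE /rotn /rot/=; congr pair; ring.
  by rewrite sE tE'; split => //; split => //; [exact: nesym|exact: glued_right].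
Qed.

End Star.

Theorem lemma3 (R : realType) (p r n : nat)
    (hr : (1 <= r)%N) (hp : (r + 2 <= p)%N) (hn : (1 <= n)%N)
    (hn4 : (4%:R - r%:R) / (p%:R - r%:R - 1) <= n%:R :> R)
    (I : finType) (Omega : set (R * R)) (F : I -> R * R -> R * R)
    (HOmega : multipatch p r n Omega F) (HF : AS_G1 F)
    (x : R * R) (Hx : vertex F x) :
  exists (A : set (R * R -> R)) (Pi : (R * R -> R) -> (R * R -> R)),
    [/\ A `<=` V1 p r n Omega F,
        dimension 6 A,
        projector (C2_at n Omega F x) A Pi
      & forall phi, C2_at n Omega F x phi ->
          forall m1 m2 : nat, (m1 + m2 <= 2)%N ->
            pderiv_at n F m1 m2 (Pi phi) x = pderiv_at n F m1 m2 phi x].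

Proof.
have Ocover := mp_cover HOmega; have Popen := mp_patch_open HOmega.
have Fjac i z : Sq z -> jac F i z != 0.
  move=> Sz; have := mp_jacobian HOmega i Sz.
  have [-> ->] := d12F hr hn (mp_spline HOmega) i Sz.
  by rewrite /det2 /jac /= => /gt_eqF ->.
have eopen := elt_open hr hn Popen (mp_inj HOmega) (mp_spline HOmega).
(* The construction is carried out for the rotated charts, with the vertex at (0, 0) in every patch
   containing it. The function spaces and the mesh elements do not change, so the result transfers
   to [F]. *)
pose G := rotF F (kx F x).
have GOcover : closure Omega = \bigcup_i cpatch G i.
  by rewrite Ocover; apply: eq_bigcupr => i _; rewrite cpatch_rotF.
have GPopen i : open (patch G i) by rewrite patch_rotF.
have Ginj i : {in @Sq R &, injective (G i)} by exact: (G_inj HOmega).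
have Gspline := G_spline hn HOmega x.
have Gjac i z : Sq z -> jac G i z != 0 by exact: (G_jac hr hn HOmega).
have Gx := G_x HOmega Hx.
have xP : exists i, cpatch G i x.
  have [i [k ->]] := Hx; exists i; rewrite cpatch_rotF.
  by exists (corner R k) => //; apply: rotn_Sq; split; exact: I01_0.
have eproper : ProperFilter (within (elts n F) (nbhs x)).
  by rewrite -(elts_rotF F (kx F x) hn); exact: (elts_proper hr hn Gspline Gx xP).
apply: (interpolating_projector eopen eproper) => c.
have [f [fV fC fj]] := jet_interpolation hr hp hn hn4 (mp_open HOmega) GOcover
  GPopen Ginj Gspline Gjac Gx xP (G_next_inj HOmega Hx) (G_next_inj' HOmega Hx)
  (G_meet hr hn HOmega HF Hx) c.
exists f; split; [exact: V1_rotF fV|by apply/(C2_rotF Omega F (kx F x) hn)|].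
by move=> m1 m2 m12; rewrite -(elts_rotF F (kx F x) hn); exact: fj.
Qed.
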